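(* Let $n \geq 2$ and let $p$ be a prime number. Fix $b_1 \in \mathbb{Z}_p$ and let \[ V_n(\mathbb{Z}_p)_{a_1 = b_1, p \nmid a_n} = \{f(x) = x^n + a_1 x^{n - 1} + \ldots + a_n \in \mathbb{Z}_p[x] : a_1 = b_1, p \nmid a_n\}. \] Then \begin{align*} P^{\mathrm{sqf}}(V_n(\mathbb{Z}_p)_{a_1 = b_1, p \nmid a_n}) &= \begin{cases} 2/3 + O(1/2^n) & \text{if } p = 2, \\ 1 - \dfrac{3p - 1}{p(p + 1)^2} + O\left(\dfrac{n}{p^{n - 1}}\right) & \text{if } p \neq 2, \end{cases} \\ P^{\max}(V_n(\mathbb{Z}_p)_{a_1 = b_1, p \nmid a_n}) &= 1 - \frac{1}{p^2 + p + 1} + O\left(\frac{1}{p^{n + \lfloor n/2 \rfloor - 1}}\right), \end{align*} where the implied constants are absolute. These densities are positive, with one exception: if $b_1 \in \mathbb{Z}_2$ is not a unit, then $P^{\mathrm{sqf}}(V_2(\mathbb{Z}_2)_{a_1 = b_1, 2 \nmid a_n}) = 0$. Both densities depend strictly on whether $b_1$ is a unit in $\mathbb{Z}_p$ or not.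
   Context: $V_n(\mathbb{Z}_p)$ denotes the set of monic polynomials of degree $n$ over $\mathbb{Z}_p$, identified with $\mathbb{Z}_p^n$ via the coefficients $(a_1,\dots,a_n)$. A subset $\Sigma$ defined by fixing exactly $k$ coefficients and imposing congruence conditions on the others is viewed as a subset of $\mathbb{Z}_p^{n-k}$ of positive measure with Haar measure. $P^{\mathrm{sqf}}(\Sigma)$ denotes the density (measure of the subset divided by measure of $\Sigma$) of $f \in \Sigma$ whose discriminant is not divisible by $p^2$, and $P^{\max}(\Sigma)$ denotes the density of $f \in \Sigma$ such that $\mathbb{Z}_p[x]/(f(x))$ is the maximal order of $\mathbb{Q}_p[x]/(f(x))$. *)

(* Defs.v *)
From HB Require Import structures.
From mathcomp Require Import all_boot all_order all_algebra.
From mathcomp Require Import zify.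
From mathcomp Require Import all_classical all_reals all_analysis.

Set Implicit Arguments.
Unset Strict Implicit.
Unset Printing Implicit Defensive.

Import Order.TTheory GRing.Theory Num.Theory.

Local Open Scope classical_set_scope.
Local Open Scope ring_scope.

(* The ring Z_p = lim Z/p^k: a p-adic integer is the compatible sequence of its
   residues modulo p^k, each represented by a natural number below p^k. The
   primality proof is a parameter so that Z_p is canonically a domain. *)
Record padic_int (p : nat) (p_pr : prime p) : Type := PadicInt {
  padic_res :> nat -> nat;
  padic_resS : forall k, (padic_res k.+1 %% p ^ k)%N = padic_res k }.

Section PadicIntegers.
Variables (p : nat) (p_pr : prime p).
Local Notation padic_int := (padic_int p_pr).

HB.instance Definition _ := gen_eqMixin padic_int.
HB.instance Definition _ := gen_choiceMixin padic_int.

Let pk_gt0 k : (0 < p ^ k)%N.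
Proof. by rewrite expn_gt0 prime_gt0. Qed.

Lemma padic_intP (x y : padic_int) : x =1 y -> x = y.
Proof.
case: x y => [x hx] [y hy] /= /funext xy; case: y / xy hy => hy.
by congr PadicInt; apply: Prop_irrelevance.
Qed.

Lemma padic_res_lt (x : padic_int) k : (x k < p ^ k)%N.
Proof. by rewrite -padic_resS ltn_mod. Qed.

Lemma padic_res_mod (x : padic_int) k l : (k <= l)%N -> (x l %% p ^ k)%N = x k.
Proof.
move=> kl; rewrite -(subnK kl); elim: (l - k)%N => [|m IH].
  by rewrite add0n modn_small // padic_res_lt.
by rewrite -IH -(padic_resS x (m + k)) modn_dvdm // dvdn_exp2l // leq_addl.
Qed.

Section Reduce.
Variable s : nat -> nat.
Hypothesis sS : forall k, s k.+1 = s k %[mod p ^ k].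

Lemma padic_of_subproof k :
  ((s k.+1 %% p ^ k.+1) %% p ^ k)%N = (s k %% p ^ k)%N.
Proof. by rewrite modn_dvdm ?sS // dvdn_exp2l. Qed.

Definition padic_of := PadicInt p_pr padic_of_subproof.
End Reduce.

Lemma padic_nat_subproof m k : m = m %[mod p ^ k]. Proof. by []. Qed.

Definition padic_nat m := padic_of (padic_nat_subproof m).

Lemma padic_add_subproof (x y : padic_int) k :
  (x k.+1 + y k.+1 = x k + y k %[mod p ^ k])%N.
Proof. by rewrite -modnDm !padic_resS. Qed.

Definition padic_add x y := padic_of (padic_add_subproof x y).

Lemma padic_mul_subproof (x y : padic_int) k :
  (x k.+1 * y k.+1 = x k * y k %[mod p ^ k])%N.
Proof. by rewrite -modnMm !padic_resS. Qed.

Definition padic_mul x y := padic_of (padic_mul_subproof x y).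

Lemma padic_opp_subproof (x : padic_int) k :
  (p ^ k.+1 - x k.+1 = p ^ k - x k %[mod p ^ k])%N.
Proof.
apply/eqP; rewrite -(eqn_modDr (x k.+1)) subnK; last exact/ltnW/padic_res_lt.
rewrite -modnDmr padic_resS subnK; last exact/ltnW/padic_res_lt.
by rewrite expnS modnMl modnn.
Qed.

Definition padic_opp x := padic_of (padic_opp_subproof x).

Lemma padic_addA : associative padic_add.
Proof.
by move=> x y z; apply: padic_intP => k /=; rewrite modnDmr modnDml addnA.
Qed.

Lemma padic_addC : commutative padic_add.
Proof. by move=> x y; apply: padic_intP => k /=; rewrite addnC. Qed.

Lemma padic_add0 : left_id (padic_nat 0) padic_add.
Proof.
move=> x; apply: padic_intP => k /=.
by rewrite mod0n add0n modn_small // padic_res_lt.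
Qed.

Lemma padic_addN : left_inverse (padic_nat 0) padic_opp padic_add.
Proof.
move=> x; apply: padic_intP => k /=.
by rewrite modnDml subnK ?modnn ?mod0n //; apply/ltnW/padic_res_lt.
Qed.

HB.instance Definition _ := GRing.isZmodule.Build padic_int
  padic_addA padic_addC padic_add0 padic_addN.

Lemma padic_mulA : associative padic_mul.
Proof.
by move=> x y z; apply: padic_intP => k /=; rewrite modnMmr modnMml mulnA.
Qed.

Lemma padic_mulC : commutative padic_mul.
Proof. by move=> x y; apply: padic_intP => k /=; rewrite mulnC. Qed.

Lemma padic_mul1 : left_id (padic_nat 1) padic_mul.
Proof.
move=> x; apply: padic_intP => k /=.
by rewrite modnMml mul1n modn_small // padic_res_lt.
Qed.

Lemma padic_mulD : left_distributive padic_mul padic_add.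
Proof.
by move=> x y z; apply: padic_intP => k /=; rewrite modnMml modnDm mulnDl.
Qed.

Lemma padic_1neq0 : padic_nat 1 != 0.
Proof.
apply/eqP => /(congr1 (fun x : padic_int => x 1%N)) /=.
by rewrite mod0n modn_small // expn1 prime_gt1.
Qed.

HB.instance Definition _ := GRing.Zmodule_isComNzRing.Build padic_int
  padic_mulA padic_mulC padic_mul1 padic_mulD padic_1neq0.

Definition padic_unit : {pred padic_int} := fun x => `[< exists y, y * x = 1 >].

Definition padic_inv (x : padic_int) : padic_int := xget x [set y | y * x = 1].

Lemma padic_mulV : {in padic_unit, left_inverse 1 padic_inv *%R}.
Proof.
move=> x /asboolP xu; rewrite /padic_inv; case: xgetP => [y _ //|].
by case: xu => y yx /(_ y).
Qed.

Lemma padic_unitPl (x y : padic_int) : y * x = 1 -> padic_unit x.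
Proof. by move=> yx; apply/asboolP; exists y. Qed.

Lemma padic_inv_out : {in [predC padic_unit], padic_inv =1 id}.
Proof.
move=> x; rewrite inE /= => /asboolP xN; rewrite /padic_inv.
by case: xgetP => // y _ yx; case: xN; exists y.
Qed.

HB.instance Definition _ := GRing.ComNzRing_hasMulInverse.Build padic_int
  padic_mulV padic_unitPl padic_inv_out.

Lemma padic_neq0 (x : padic_int) : x != 0 ->
  exists k, forall m, (k <= m)%N -> ~~ (p ^ k %| x m)%N.
Proof.
move=> x0; have [k xk] : exists k, x k != 0%N.
  apply: contrapT => xN; move/eqP: x0; apply; apply: padic_intP => k /=.
  by rewrite mod0n; apply/eqP/negP => /negP xk; apply: xN; exists k.
by exists k => m km; rewrite /dvdn padic_res_mod.
Qed.

Lemma padic_mulf_eq0 (x y : padic_int) : x * y = 0 -> (x == 0) || (y == 0).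
Proof.
move=> xy; apply: contraT; rewrite negb_or.
case/andP=> /padic_neq0[i xi] /padic_neq0[j yj].
have := congr1 (fun z : padic_int => z (i + j)%N) xy.
rewrite /= mod0n => /eqP; rewrite -/(dvdn _ _).
have {}xi := xi _ (leq_addr j i); have {}yj := yj _ (leq_addl i j).
have x_gt0 : (0 < x (i + j)%N)%N by case: posnP xi => // ->; rewrite dvdn0.
have y_gt0 : (0 < y (i + j)%N)%N by case: posnP yj => // ->; rewrite dvdn0.
move: xi yj; rewrite !pfactor_dvdn ?muln_gt0 ?x_gt0 // lognM // -!ltnNge.
lia.
Qed.

HB.instance Definition _ := GRing.ComUnitRing_isIntegral.Build padic_int
  padic_mulf_eq0.

Lemma padic_res_nat m k : (m%:R : padic_int) k = (m %% p ^ k)%N.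
Proof.
elim: m => [//|m IH]; rewrite mulrS.
rewrite [LHS](_ : _ = (1 %% p ^ k + (m%:R : padic_int) k) %% p ^ k)%N //.
by rewrite IH modnDm.
Qed.

Lemma padic_res0P (x : padic_int) k :
  x k = 0%N <-> exists y, x = p%:R ^+ k * y.
Proof.
split=> [xk|[y ->]]; last first.
  rewrite -natrX [LHS](_ : _ = ((p ^ k)%:R : padic_int) k * y k %% p ^ k)%N //.
  by rewrite padic_res_nat modnn mod0n.
have s_mod l : x (l + k)%N = (x (l + k) %/ p ^ k * p ^ k)%N.
  by rewrite divnK // /dvdn padic_res_mod ?leq_addl // xk.
have sS l : (x (l.+1 + k) %/ p ^ k = x (l + k) %/ p ^ k %[mod p ^ l])%N.
  apply/eqP; rewrite -(eqn_pmul2r (pk_gt0 k)) !muln_modl -!expnD -!s_mod.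
  by rewrite !padic_res_mod // addSn leqnSn.
exists (padic_of sS); apply: padic_intP => l.
rewrite -natrX [RHS](_ : _ =
  ((p ^ k)%:R : padic_int) l * (x (l + k) %/ p ^ k %% p ^ l) %% p ^ l)%N //.
by rewrite padic_res_nat modnMm mulnC -s_mod padic_res_mod // leq_addr.
Qed.

Lemma padic_res_eq (x y : padic_int) k :
  x k = y k <-> exists z, x - y = p%:R ^+ k * z.
Proof.
rewrite -padic_res0P [X in _ <-> X](_ : _ =
  ((x k + (p ^ k - y k) %% p ^ k) %% p ^ k = 0)%N) //.
rewrite modnDmr; split=> [->|/eqP].
  by rewrite subnKC ?modnn //; apply/ltnW/padic_res_lt.
rewrite -[X in _ == X -> _](mod0n (p ^ k)) -(eqn_modDr (y k)) -addnA.
rewrite subnK; last exact/ltnW/padic_res_lt.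
by rewrite modnDr add0n !modn_small ?padic_res_lt // => /eqP.
Qed.

(* The p-adic topology: by padic_res_eq, the set of y with y k = x k is the
   ball x + p^k Z_p. *)
Definition padic_open : set_system padic_int :=
  [set U | forall x : padic_int, U x ->
     exists k, [set y : padic_int | y k = x k] `<=` U].

Lemma padic_openT : padic_open setT.
Proof. by move=> x _; exists 0%N. Qed.

Lemma padic_openI : setI_closed padic_open.
Proof.
move=> U V oU oV x [/oU[k kU] /oV[l lV]]; exists (maxn k l) => y /= yx; split.
  by apply: kU => /=; rewrite -!(padic_res_mod _ (leq_maxl k l)) yx.
by apply: lV => /=; rewrite -!(padic_res_mod _ (leq_maxr k l)) yx.
Qed.

Lemma padic_open_bigU (I : Type) (f : I -> set padic_int) :
  (forall i, padic_open (f i)) -> padic_open (\bigcup_i f i).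
Proof.
move=> of_ x [i _ /of_[k kf]]; exists k => y /kf fy.
by exists i.
Qed.

HB.instance Definition _ := isOpenTopological.Build padic_int
  padic_openT padic_openI padic_open_bigU.
HB.instance Definition _ := isPointed.Build padic_int 0.

End PadicIntegers.

Section Orders.
Variables (D : idomainType) (A : algType {fraction D}).

(* A D-order of the Frac(D)-algebra A: a subring that is a finitely generated
   D-module and spans A over Frac(D). *)
Definition is_order (O : set A) : Prop :=
  [/\ O 1,
      forall x y, O x -> O y -> O (x - y) /\ O (x * y),
      exists s : seq A,
        O = [set x | exists c : nat -> D,
                       x = \sum_(i < size s) tofrac (c i) *: s`_i]
    & forall x : A, exists2 d : D, d != 0 & O (tofrac d *: x)].

(* As A is commutative in all uses, the product of two orders is again an order,
   so that a maximal order contains every order. *)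
Definition is_maximal_order (O : set A) : Prop :=
  is_order O /\ forall O' : set A, is_order O' -> O `<=` O' -> O' = O.
End Orders.

Section PolynomialOrder.
Variables (D : idomainType) (f : {poly D}).

(* Frac(D)[x]/(f) for f monic of positive degree; for any other f, the notation
   {poly %/ _} silently divides by 'X instead. *)
Definition frac_quotient := {poly %/ map_poly (@tofrac D) f}.

(* The image of D[x]/(f) in Frac(D)[x]/(f). *)
Definition poly_order : set frac_quotient :=
  [set in_qpoly _ (map_poly (@tofrac D) g) | g in [set: {poly D}]].
End PolynomialOrder.

(* For monic f; over a domain of characteristic 0 the resultant is then taken in
   the full degrees n and n - 1. *)
Definition discriminant (D : idomainType) (f : {poly D}) : D :=
  (-1) ^+ 'C((size f).-1, 2) * resultant f f^`().

Section Densities.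
Variables (p : nat) (p_pr : prime p).
Local Notation Zp := (padic_int p_pr).

Definition padic_dvd (x y : Zp) : Prop := exists z, y = x * z.

Definition sqf_disc (f : {poly Zp}) : Prop :=
  ~ padic_dvd (p%:R ^+ 2) (discriminant f).

Definition generates_maximal_order (f : {poly Zp}) : Prop :=
  @is_maximal_order Zp (frac_quotient f) (@poly_order Zp f).

(* V_n(Z_p)_{a_1 = b, p not dividing a_n}. *)
Definition V_fixed (n : nat) (b : Zp) : set {poly Zp} :=
  [set f | [/\ f \is monic, size f = n.+1, f`_(n.-1) = b
             & ~ padic_dvd p%:R f`_0]].

(* Coordinates a = (a_2, ..., a_n): the entry a 0 i is a_{i+2}, the coefficient
   of x^(n - 2 - i). *)
Definition poly_of_coefs (n : nat) (b : Zp) (a : 'rV[Zp]_n.-1) : {poly Zp} :=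
  'X^n + b *: 'X^(n.-1) + \sum_(i < n.-1) a 0 i *: 'X^(n - 2 - i).

Definition borel_space (m : nat) := g_sigma_algebraType (@open 'rV[Zp]_m).

(* Normalized Haar measure: mu is a probability on the Borel sets. *)
Definition is_haar (R : realType) (m : nat) (mu : probability (borel_space m) R)
    : Prop :=
  forall (v : 'rV[Zp]_m) (E : set (borel_space m)), measurable E ->
    mu [set v + (a : 'rV[Zp]_m) | a in E] = mu E.

(* V_fixed n b is viewed in Z_p^(n-1) through its free coefficients. *)
Definition density (R : realType) (n : nat) (b : Zp)
    (mu : set 'rV[Zp]_n.-1 -> \bar R) (P : set {poly Zp}) : R :=
  let F := @poly_of_coefs n b in
  fine (mu (F @^-1` (V_fixed n b `&` P))) / fine (mu (F @^-1` V_fixed n b)).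

End Densities.

(* Main.v *)
(* Write [f = f0 + p r] with [f0] the lift of [f] modulo [p]. By Dedekind's
   criterion the order of [f] is maximal iff, for each irreducible [g] with [g^2]
   dividing [f0] modulo [p], the residue of [r] avoids one class modulo [g]; for
   odd [p], [p^2] does not divide the discriminant iff moreover the repeated part
   of [f0] is trivial or a single [(x - a)^2], and for [p = 2] iff [f0] is
   squarefree modulo [2]. By the Chinese remainder theorem each density is a
   weighted count of polynomials over [F_p] with prescribed second coefficient
   and nonzero constant term. The weight [w] satisfies
   [sum_(g^2 | f) x^(deg g) w(f / g^2) = 1], so summing over [f] expresses the
   known number of all such [f] as a convolution involving the weighted counts.
   This gives linear recurrences in [n] for the sum of these counts over the
   second coefficient [b] and for the difference between [b = 0] and [b <> 0],
   hence closed forms; the difference never vanishes. For odd [p] the polynomials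
   with one double root [a] are counted by removing the factor [(x - a)^2] and
   sieving out the root [a]. *)

Require Import Defs.
From HB Require Import structures.
From mathcomp Require Import all_boot all_order all_algebra.
From mathcomp Require Import zify ring lra.
From mathcomp Require cyclic.
From mathcomp Require Import all_classical all_reals all_analysis.

Set Implicit Arguments.
Unset Strict Implicit.
Unset Printing Implicit Defensive.

Import Order.TTheory GRing.Theory Num.Theory.

Local Open Scope classical_set_scope.
Local Open Scope ring_scope.

(** * Reduction modulo [p], lifting of residues, and Dedekind's condition at one prime *)

Section Reduction.
Variables (p : nat) (p_pr : prime p).
Local Notation Zp := (padic_int p_pr).

(** Both conditions on [f] depend only on its coefficients modulo [p^2], so each Haar density is a
    quotient of counts of pairs of digit vectors. The degrees of the repeated primes of [f0] add up
    to at most [n / 2 <= n - 1], so the [n - 1] free digits of [r] realise all their residues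
    uniformly. Summed over [b], the admissible polynomials have the series [(1 - t) / (1 - q t)],
    and the weight multiplies it by [(1 - q x t^2) / (1 - x t^2)]. The value of this factor at the
    pole [t = 1 / q] is the main term: [1 - 1 / (q^2 + q + 1)] for [x = 1 / q] and [q / (q + 1)] for
    [x = 1]. For odd [p] each double root [a != 0] adds the factor [t^2 / (1 + t)], a proportion
    [(q - 1) / (q + 1)^2] in all, of whose lifts [1 - 1 / q] are good; this gives
    [1 - (3 q - 1) / (q (q + 1)^2)]. A factor [g^2] shifts the second coefficient by twice that of
    [g]. Doubling is bijective for odd [p] and zero for [p = 2]: the sum over [b] obeys one
    recurrence, the difference obeys two. *)

Definition red (x : Zp) : 'F_p := (x 1%N)%:R.

Lemma red_is_zmod_morphism : zmod_morphism red.
Proof.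
have redD x y : red (x + y) = red x + red y.
  rewrite [LHS](_ : _ = ((x 1 + y 1) %% p ^ 1)%N%:R) //.
  by rewrite expn1 (Fp_nat_mod p_pr) natrD.
by move=> x y; apply: (canRL (addrK _)); rewrite -redD subrK.
Qed.

Lemma red_is_monoid_morphism : monoid_morphism red.
Proof.
split=> [|x y]; first by rewrite /red (padic_res_nat p_pr 1) expn1 Fp_nat_mod.
rewrite [LHS](_ : _ = ((x 1 * y 1) %% p ^ 1)%N%:R) //.
by rewrite expn1 (Fp_nat_mod p_pr) natrM.
Qed.

HB.instance Definition _ := GRing.isZmodMorphism.Build Zp 'F_p red
  red_is_zmod_morphism.
HB.instance Definition _ := GRing.isMonoidMorphism.Build Zp 'F_p red
  red_is_monoid_morphism.

(** A section of [red] by the representatives [0, ..., p - 1]. It is not additive, so identities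
    lifted from ['F_p] hold only up to multiples of [p]. *)
Definition lift (a : 'F_p) : Zp := (val a)%:R.

Lemma liftK : cancel lift red.
Proof. by move=> a; rewrite /lift rmorph_nat natr_Zp. Qed.

Lemma lift0 : lift 0 = 0. Proof. by []. Qed.

Lemma lift1 : lift 1 = 1. Proof. by []. Qed.

Lemma red_p : red p%:R = 0.
Proof. by rewrite rmorph_nat pchar_Fp_0. Qed.

Lemma red_res (x : Zp) : val (red x) = x 1%N.
Proof.
rewrite [LHS]val_Fp_nat // modn_small //.
by have := padic_res_lt x 1; rewrite expn1.
Qed.

Lemma red_eq0 (x : Zp) : red x = 0 <-> exists y, x = p%:R * y.
Proof.
split=> [x0|[y ->]]; last by rewrite rmorphM /= red_p mul0r.
have /padic_res0P[y] : x 1%N = 0%N by rewrite -red_res x0.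
by rewrite expr1; exists y.
Qed.

Lemma padic_p_neq0 : p%:R != 0 :> Zp.
Proof.
apply/eqP => /(congr1 (fun x : Zp => x 2%N)).
rewrite padic_res_nat [RHS]mod0n modn_small; last first.
  by rewrite -[X in (X < _)%N]expn1 ltn_exp2l ?prime_gt1.
by move/eqP; rewrite eqn0Ngt prime_gt0.
Qed.

(** By Euler's theorem [x^(totient (p^k) - 1)] inverts [x] modulo [p^k]; these inverses are
    compatible because inverses are unique. *)
Lemma padic_unitE (x : Zp) : (x \is a GRing.unit) = (red x != 0).
Proof.
apply/idP/idP => [xu|x0]; first by rewrite -unitfE rmorph_unit.
have cop k : coprime (x k) (p ^ k).
  case: k => [|k]; first by rewrite expn0 coprimen1.
  rewrite coprimeXr // coprime_sym prime_coprime // /dvdn -[X in (_ %% X)%N]expn1.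
  rewrite padic_res_mod // -red_res; apply: contraNneq x0 => x0.
  exact/eqP/val_inj.
pose s k := (x k ^ (totient (p ^ k)).-1)%N.
have xs k : (x k * s k = 1 %[mod p ^ k])%N.
  rewrite -expnS prednK; first exact: cyclic.Euler_exp_totient.
  by rewrite totient_gt0 expn_gt0 prime_gt0.
have sS k : (s k.+1 = s k %[mod p ^ k])%N.
  have xsS : (x k * s k.+1 = 1 %[mod p ^ k])%N.
    rewrite -modnMml -(padic_resS x) modn_mod modnMml.
    have := congr1 (fun m => m %% p ^ k)%N (xs k.+1).
    by rewrite !modn_dvdm // dvdn_exp2l.
  rewrite -[X in (X = _ %[mod _])%N]muln1 -modnMmr -(xs k) modnMmr.
  by rewrite mulnA [(s _ * _)%N]mulnC -modnMml xsS modnMml mul1n.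
apply/unitrP; exists (padic_of p_pr sS).
have ys : padic_of p_pr sS * x = 1.
  apply: padic_intP => k.
  by rewrite [LHS](_ : _ = (s k %% p ^ k * x k) %% p ^ k)%N // modnMml mulnC xs.
by rewrite ys mulrC.
Qed.

(** Dividing [d] by [p] as long as possible leaves a unit. Denominators of fractions can therefore
    be taken to be powers of [p]. *)
Lemma padic_dvd_pow (d : Zp) : d != 0 -> exists k u, p%:R ^+ k = d * u.
Proof.
move=> d0; have [k] := padic_neq0 d0; move/(_ k (leqnn k)).
elim: k d d0 => [|k IH] d d0 dk; first by rewrite dvd1n in dk.
have [/red_eq0[y dy]|du] := eqVneq (red d) 0; last first.
  exists 0%N, d^-1; rewrite expr0 divrr //.
  by rewrite padic_unitE.
have y0 : y != 0 by apply: contraNneq d0 => y0; rewrite dy y0 mulr0.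
have yk : ~~ (p ^ k %| y k)%N.
  apply: contra dk; rewrite /dvdn padic_res_mod // => /eqP /padic_res0P[z yz].
  apply/eqP; rewrite padic_res_mod //; apply/padic_res0P; exists z.
  by rewrite dy yz mulrA -exprS.
have [l [u plu]] := IH _ y0 yk.
by exists l.+1, u; rewrite dy exprS plu mulrA.
Qed.

Lemma padic_natr_neq0 (m : nat) : (0 < m)%N -> m%:R != 0 :> Zp.
Proof.
move=> m0; apply/eqP => /(congr1 (fun x : Zp => x m)).
rewrite padic_res_nat [RHS]mod0n modn_small; first by move=> mE; rewrite mE in m0.
by rewrite ltn_expl ?prime_gt1.
Qed.

Definition liftp (g : {poly 'F_p}) : {poly Zp} := map_poly lift g.

Lemma liftpK : cancel liftp (map_poly red).
Proof.
by move=> g; apply/polyP => i; rewrite coef_map /= coef_map_id0 //; apply: liftK.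
Qed.

Lemma redp_eq0 (f : {poly Zp}) :
  map_poly red f = 0 <-> exists g, f = p%:R * g.
Proof.
split=> [f0|[g ->]]; last by rewrite rmorphM rmorph_nat -polyC_natr pchar_Fp_0 // mul0r.
have fi i : exists y, f`_i = p%:R * y.
  by apply/red_eq0; rewrite -coef_map f0 coef0.
have [y fy] := choice fi.
exists (\poly_(i < size f) y i); apply/polyP => i.
rewrite -polyC_natr coefCM coef_poly.
by case: ltnP => [_|si]; rewrite -?fy ?mulr0 // nth_default.
Qed.

Lemma redp_eq (f g : {poly Zp}) :
  map_poly red f = map_poly red g <-> exists h, f = g + p%:R * h.
Proof.
split=> [fg|[h ->]]; last first.
  by rewrite rmorphD /= [X in _ + X](_ : _ = 0) ?addr0 //; apply/redp_eq0; exists h.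
have /redp_eq0[h fgh] : map_poly red (f - g) = 0.
  by rewrite rmorphB /= fg subrr.
by exists h; rewrite -fgh addrC subrK.
Qed.

Lemma redp_dvd (f g : {poly Zp}) :
  map_poly red g %| map_poly red f -> exists a b, f = g * a + p%:R * b.
Proof.
move=> /dvdpP[q fE]; have : map_poly red f = map_poly red (g * liftp q).
  by rewrite fE rmorphM /= liftpK mulrC.
by move=> /redp_eq[b ->]; exists (liftp q), b.
Qed.

(** With [G] the lift of [g], this is membership of [f] in the ideal [(p, G)^2], as [dedekind_badE]
    displays. Quantifying over the decomposition avoids choosing one. *)
Definition dedekind_bad (f : {poly Zp}) (g : {poly 'F_p}) :=
  exists C E, f = liftp g ^+ 2 * C + p%:R * E /\ g %| map_poly red E.

Lemma dedekind_badE f g : dedekind_bad f g <->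
  exists C H K, f = liftp g ^+ 2 * C + p%:R * (liftp g * H + p%:R * K).
Proof.
split=> [[C [E [-> ]]]|[C [H [K ->]]]].
  by rewrite -{1}(liftpK g) => /redp_dvd[H [K ->]]; exists C, H, K.
exists C, (liftp g * H + p%:R * K); split=> //.
rewrite rmorphD rmorphM /= liftpK [X in _ + X](_ : _ = 0) ?addr0 ?dvdp_mulr //.
by apply/redp_eq0; exists K.
Qed.

(** Two decompositions have [C = C'] modulo [p] because [g != 0]; hence [E] changes modulo [p] by a
    multiple of [g^2] only, and any single decomposition decides the condition. *)
Lemma dedekind_bad_dvdE g C E : g != 0 ->
  dedekind_bad (liftp g ^+ 2 * C + p%:R * E) g <-> g %| map_poly red E.
Proof.
move=> g0; split=> [[C' [E' [fE gE']]]|gE]; last by exists C, E.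
have : map_poly red (liftp g ^+ 2 * (C - C')) = 0.
  apply/redp_eq0; exists (E' - E); rewrite !mulrBr; apply/eqP.
  by rewrite subr_eq addrAC -subr_eq opprK fE addrC.
rewrite rmorphM rmorphXn /= liftpK rmorphB /= => /eqP.
rewrite mulf_eq0 expf_eq0 (negPf g0) /= subr_eq0 => /eqP /redp_eq[D CE].
have p0 : p%:R != 0 :> {poly Zp} by rewrite -polyC_natr polyC_eq0 padic_p_neq0.
have -> : E = E' - liftp g ^+ 2 * D.
  apply: (mulfI p0); rewrite CE in fE; apply: (addrI (liftp g ^+ 2 * (C' + p%:R * D))).
  by rewrite fE; ring.
by rewrite rmorphB rmorphM rmorphXn /= liftpK dvdp_sub // exprS -mulrA dvdp_mulr.
Qed.

Lemma dedekind_bad_dvd f g : dedekind_bad f g -> g ^+ 2 %| map_poly red f.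
Proof.
case=> C [E [-> _]]; rewrite rmorphD /= [X in _ + X](_ : _ = 0) ?addr0.
  by rewrite rmorphM rmorphXn /= liftpK dvdp_mulr.
by apply/redp_eq0; exists E.
Qed.

End Reduction.

(** * Squarefree polynomials and radicals over a field *)

Section Squarefree.
Variable F : fieldType.
Implicit Types f g h r : {poly F}.

Lemma irred_factor f : (1 < size f)%N ->
  exists g, [/\ irreducible_poly g, g \is monic & g %| f].
Proof.
have [m] := ubnP (size f); elim: m f => // m IH f fm f1.
have [[g [g1 gf gNf]]|fi] := pselect (exists g, [/\ size g != 1%N, g %| f & ~~ (g %= f)]).
  have f0 : f != 0 by rewrite -size_poly_gt0 (ltn_trans _ f1).
  have g0 : g != 0 by apply: contraTneq gf => ->; rewrite dvd0p.
  have gs : (size g < size f)%N.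
    by rewrite ltn_neqAle dvdp_leq // andbT dvdp_size_eqp.
  have [||h [hi hm hg]] := IH g; first exact: leq_trans gs _.
    by rewrite ltn_neqAle eq_sym g1 size_poly_gt0.
  by exists h; split=> //; apply: dvdp_trans gf.
have f0 : f != 0 by rewrite -size_poly_gt0 (ltn_trans _ f1).
have l0 : lead_coef f != 0 by rewrite lead_coef_eq0.
exists ((lead_coef f)^-1 *: f); split; last by rewrite dvdpZl ?invr_eq0.
- split=> [|g g1]; first by rewrite size_scale // invr_eq0.
  rewrite dvdpZr ?invr_eq0 // => gf.
  suff gEf : g %= f by rewrite (eqp_trans gEf) // eqp_sym eqp_scale // invr_eq0.
  by apply/negPn/negP => gNf; apply: fi; exists g.
- by rewrite monicE lead_coefZ mulVf.
Qed.

Definition sqfree f := forall g, g ^+ 2 %| f -> (size g <= 1)%N.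

Lemma sqfree_neq0 f : sqfree f -> f != 0.
Proof.
move=> fs; apply/eqP => f0; have := fs 'X.
by rewrite f0 dvdp0 size_polyX => /(_ isT).
Qed.

Lemma sqfree_coprime f g : sqfree (f * g) -> coprimep f g.
Proof.
move=> fs; have := sqfree_neq0 fs; rewrite mulf_eq0 negb_or => /andP[f0 g0].
rewrite /coprimep eqn_leq size_poly_gt0 gcdp_eq0 negb_and f0 andbT.
by apply: fs; rewrite expr2 dvdp_mul ?dvdp_gcdl ?dvdp_gcdr.
Qed.

(** Write [r = q d] with [d = gcdp r f]. A common factor of [q] and [f] would also divide [d],
    against squarefreeness; so [q] is coprime to [f^n], yet divides it, and is constant. *)
Lemma sqfree_dvd_exp r f n : sqfree r -> r %| f ^+ n -> r %| f.
Proof.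
move=> rs rf; have r0 := sqfree_neq0 rs.
have /dvdpP[q rE] := dvdp_gcdl r f; rewrite {1}rE in rs.
have qd := sqfree_coprime rs.
have qf : coprimep q f.
  apply/coprimepP => d dq df; move/coprimepP: qd; apply=> //.
  by rewrite dvdp_gcd df andbT rE dvdp_mulr.
have q1 : q %= 1.
  have /coprimepP := coprimep_expr n qf; apply=> //.
  by apply: dvdp_trans rf; rewrite rE dvdp_mulr.
rewrite rE (eqp_dvdl _ (eqp_mulr (gcdp r f) q1)) mul1r; exact: dvdp_gcdr.
Qed.

(** If [f = q g^2] with [g] not constant, a radical of the smaller polynomial [q g] serves for [f]
    with the exponent doubled. *)
Lemma radical_exists f : f != 0 ->
  exists r n, [/\ sqfree r, r %| f & f %| r ^+ n].
Proof.
have [m] := ubnP (size f); elim: m f => // m IH f fm f0.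
have [fs|] := pselect (sqfree f); first by exists f, 1%N; rewrite expr1.
move/existsNP => [g /not_implyP[/dvdpP[q fE] /negP]]; rewrite -ltnNge => g1.
have [q0 g0] : q != 0 /\ g != 0.
  move: f0; rewrite fE mulf_eq0 negb_or => /andP[q0].
  by rewrite expf_eq0.
have [||r [n [rs rqg qgr]]] := IH (q * g).
- have : (size (q * g)%R < size f)%N; last by lia.
  rewrite fE expr2 mulrA [size (q * g * g)%R]size_mul ?mulf_neq0 //.
  have : (0 < size (q * g)%R)%N by rewrite size_poly_gt0 mulf_neq0.
  move: (size (q * g)%R) (size g) g1 => a b; lia.
- by rewrite mulf_neq0.
exists r, (n + n)%N; split=> //.
  by rewrite fE expr2 mulrA; apply: dvdp_mulr.
rewrite fE expr2 mulrA exprD dvdp_mul //.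
by apply: dvdp_trans qgr; apply: dvdp_mull.
Qed.

(* [h W = r A] says that [W] is the cofactor of [f = r h] in [r^2 A]; at a prime
   dividing [h / gcd(h, A)], the valuation of [W] vanishes. *)
Lemma coprime_cofactor r h A W : sqfree r -> h != 0 ->
  h * W = r * A -> ~~ (h %| A) ->
  exists g, [/\ irreducible_poly g, g \is monic, g %| r & coprimep W g].
Proof.
move=> rs h0 hW hA.
have d0 : gcdp h A != 0 by rewrite gcdp_eq0 negb_and h0.
have /dvdpP[h' hE] := dvdp_gcdl h A; have /dvdpP[A' AE] := dvdp_gcdr h A.
set d := gcdp h A in d0 hE AE.
have cop : coprimep h' A'.
  have -> : h' = h %/ d by rewrite hE mulpK.
  have -> : A' = A %/ d by rewrite AE mulpK.
  by apply: coprimep_div_gcd; rewrite h0.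
have h'W : h' * W = r * A'.
  by apply: (mulfI d0); rewrite mulrA [d * h']mulrC -hE hW [RHS]mulrCA [d * A']mulrC -AE.
have h'r : h' %| r by rewrite -(Gauss_dvdpl _ cop) -h'W dvdp_mulr.
have h'1 : (1 < size h')%N.
  rewrite ltnNge; apply: contra hA => h's.
  have h'0 : h' != 0 by apply: contraNneq h0 => h'0; rewrite hE h'0 mul0r.
  have : h' %= 1 by rewrite -size_poly_eq1 eqn_leq h's size_poly_gt0.
  move=> h'1; rewrite hE (eqp_dvdl _ (eqp_mulr d h'1)) mul1r AE dvdp_mull //.
have [g [gi gm gh']] := irred_factor h'1.
exists g; split=> //; first exact: dvdp_trans h'r.
have /dvdpP[q rE] := h'r.
have h'0 : h' != 0 by rewrite -size_poly_gt0 (ltn_trans _ h'1).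
have -> : W = q * A'.
  by apply: (mulfI h'0); rewrite h'W rE mulrCA mulrA.
suff cop' : coprimep (q * A') h'.
  by apply/coprimepP => d1 d1W d1g; have /coprimepP := cop'; apply=> //; apply: dvdp_trans gh'.
by rewrite coprimepMl [coprimep A' _]coprimep_sym cop sqfree_coprime // -rE.
Qed.

End Squarefree.

(** * Dedekind's criterion for the maximality of the image of [Z_p[x]] *)

Section Dedekind.
Variables (p : nat) (p_pr : prime p).
Local Notation Zp := (padic_int p_pr).
Local Notation K := {fraction Zp}.
Local Notation fp := (map_poly (@red p p_pr)).
Variable f : {poly Zp}.
Hypotheses (f_monic : f \is monic) (f_size : (1 < size f)%N).
Local Notation fK := (map_poly (@tofrac Zp) f).
Local Notation A := {poly %/ fK}.

Definition qpol (h : {poly Zp}) : A := in_qpoly fK (map_poly (@tofrac Zp) h).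

Lemma qpol_zmod : zmod_morphism qpol.
Proof. by move=> x y; rewrite /qpol !rmorphB. Qed.

Lemma qpol_monoid : monoid_morphism qpol.
Proof. by split=> [|x y]; rewrite /qpol ?rmorph1 // !rmorphM. Qed.

HB.instance Definition _ := GRing.isZmodMorphism.Build {poly Zp} A qpol qpol_zmod.
HB.instance Definition _ :=
  GRing.isMonoidMorphism.Build {poly Zp} A qpol qpol_monoid.

Let tofrac_inj : injective (@tofrac Zp).
Proof. by move=> x y /eqP; rewrite tofrac_eq => /eqP. Qed.

Lemma mk_monic_fK : mk_monic fK = fK.
Proof.
rewrite /mk_monic size_map_inj_poly ?tofrac0 // f_size.
by rewrite monic_map.
Qed.

Lemma qpol_rmod h : qpol h = qpol (Pdiv.Ring.rmodp h f).
Proof.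
rewrite {1}(Pdiv.RingMonic.rdivp_eq f_monic h) rmorphD rmorphM /=.
have -> : qpol f = 0; last by rewrite mulr0 add0r.
apply: val_inj; rewrite /= mk_monic_fK Pdiv.RingMonic.rmodpp //.
exact: monic_map.
Qed.

Let map_tofrac_inj : injective (map_poly (@tofrac Zp)).
Proof. exact: (map_inj_poly tofrac_inj (tofrac0 _)). Qed.

Lemma qpol_eq0 (h : {poly Zp}) : qpol h = 0 <-> exists z, h = f * z.
Proof.
split=> [h0|[z ->]]; last first.
  rewrite mulrC qpol_rmod Pdiv.RingMonic.rmodp_mull //.
  exact: (rmorph0 qpol).
rewrite qpol_rmod in h0.
have r0 : Pdiv.Ring.rmodp h f = 0.
  apply: map_tofrac_inj; rewrite rmorph0; have /(congr1 val) /= := h0.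
  rewrite mk_monic_fK Pdiv.CommonRing.rmodp_small //.
  by rewrite !size_map_inj_poly ?tofrac0 // Pdiv.CommonRing.ltn_rmodpN0 // monic_neq0.
exists (Pdiv.Ring.rdivp h f).
by rewrite {1}(Pdiv.RingMonic.rdivp_eq f_monic h) r0 addr0 mulrC.
Qed.

Lemma fraction_common_den (x : K) : exists k a,
  tofrac (p%:R ^+ k) * x = tofrac a.
Proof.
elim/quotW: x => r.
have [k [u dk]] := padic_dvd_pow (denom_ratioP r).
exists k, (u * r.1); rewrite dk [r.2 * u]mulrC !rmorphM /= -mulrA; congr (_ * _).
rewrite -[LHS]/(FracField.mul _ _).
rewrite !piE /FracField.mulf; apply/eqmodP.
rewrite /= FracField.equivfE !numden_Ratio ?oner_eq0 ?mulf_neq0 ?denom_ratioP ?oner_neq0 //.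
by rewrite mul1r mulr1.
Qed.

Lemma poly_common_den (x : {poly K}) : exists k h,
  tofrac (p%:R ^+ k) *: x = map_poly (@tofrac Zp) h.
Proof.
elim/poly_ind: x => [|x c [k [h xh]]].
  by exists 0%N, 0; rewrite scaler0 rmorph0.
have [l [a ca]] := fraction_common_den c.
exists (k + l)%N, (p%:R ^+ l *: h * 'X + (p%:R ^+ k * a)%:P).
have mapE (b c' : Zp) : map_poly (@tofrac Zp) (b *: h * 'X + c'%:P) =
    tofrac b *: map_poly (@tofrac Zp) h * 'X + (tofrac c')%:P.
  by rewrite rmorphD rmorphM /= map_polyX map_polyC map_polyZ.
rewrite mapE -xh exprD !tofracM -ca scalerDr scalerA -scalerAl.
rewrite -[_ *: c%:P]mul_polyC -polyCM [tofrac (p%:R ^+ k) * _]mulrC.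
by congr (_ + _%:P); rewrite -mulrA mulrCA.
Qed.

Lemma scale_pow k (x : A) : tofrac (p%:R ^+ k : Zp) *: x = p%:R ^+ k * x.
Proof.
rewrite -[RHS]mul1r -!natrX mulrA mul1r mulr_natl -scaler_nat; congr (_ *: _).
by rewrite rmorph_nat.
Qed.

Lemma qpol_common_den (x : A) : exists k h, p%:R ^+ k * x = qpol h.
Proof.
have [k [h xh]] := poly_common_den (val x).
exists k, h; rewrite /qpol -xh linearZ /= -scale_pow; congr (_ *: _).
by apply: val_inj; rewrite /= Pdiv.CommonRing.rmodp_small // size_mk_monic.
Qed.

Lemma qpolZ (c : Zp) h : qpol (c *: h) = tofrac c *: qpol h.
Proof. by rewrite /qpol map_polyZ linearZ. Qed.

Lemma qp_neq0 : p%:R != 0 :> K.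
Proof. by rewrite -(rmorph_nat (@tofrac Zp)) tofrac_eq0 padic_p_neq0. Qed.

Lemma mulpI : injective (fun x : A => p%:R * x).
Proof.
move=> x y /eqP; rewrite -subr_eq0 -mulrBr mulr_natl -scaler_nat scaler_eq0.
by rewrite (negPf qp_neq0) /= subr_eq0 => /eqP.
Qed.

Lemma mulpV (x : A) : exists y : A, p%:R * y = x.
Proof.
exists (p%:R^-1 *: x); rewrite mulr_natl -scaler_nat scalerA mulfV ?scale1r //.
exact: qp_neq0.
Qed.

Local Notation O := (@poly_order Zp f).

Lemma poly_orderE (x : A) : O x <-> exists h, x = qpol h.
Proof. by split=> [[h _ <-]|[h ->]]; exists h. Qed.

Definition adjoin (b : A) : set A :=
  [set x | exists h1 h2, x = qpol h1 + qpol h2 * b].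

Lemma adjoin0 : adjoin 0 = O.
Proof.
apply/seteqP; split=> x [h1]; first by case=> h2 ->; exists h1; rewrite ?mulr0 ?addr0.
by move=> _ <-; exists h1, 0; rewrite mulr0 addr0.
Qed.

Lemma qpol_sum h : exists c : nat -> Zp,
  qpol h = \sum_(i < (size f).-1) tofrac (c i) *: qpol 'X^i.
Proof.
pose r := Pdiv.Ring.rmodp h f.
exists (fun i => r`_i); rewrite qpol_rmod -/r.
have {1}-> : r = \poly_(i < (size f).-1) r`_i.
  apply/polyP => i; rewrite coef_poly; case: ltnP => // fi.
  have rs : (size r < size f)%N.
    by rewrite Pdiv.CommonRing.ltn_rmodpN0 // monic_neq0.
  by rewrite nth_default // (leq_trans _ fi) // -ltnS prednK // (ltn_trans _ f_size).
rewrite poly_def rmorph_sum; apply: eq_bigr => i _.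
exact: qpolZ.
Qed.

Lemma adjoin_fg b : exists s : seq A, adjoin b =
  [set x | exists c : nat -> Zp, x = \sum_(i < size s) tofrac (c i) *: s`_i].
Proof.
pose n := (size f).-1.
pose F i := if (i < n)%N then qpol 'X^i else qpol 'X^(i - n) * b.
have sumF (c : nat -> Zp) :
    \sum_(i < size (mkseq F (n + n))) tofrac (c i) *: (mkseq F (n + n))`_i =
    qpol (\sum_(i < n) c i *: 'X^i) + qpol (\sum_(i < n) c (n + i)%N *: 'X^i) * b.
  rewrite size_mkseq (eq_bigr (fun i : 'I_(n + n) => tofrac (c i) *: F i)); last first.
    by move=> i _; rewrite nth_mkseq.
  rewrite big_split_ord !rmorph_sum mulr_suml; congr (_ + _); apply: eq_bigr => i _ /=.
    by rewrite /F ltn_ord qpolZ.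
  by rewrite /F ltnNge leq_addr /= addKn qpolZ scalerAl.
exists (mkseq F (n + n)); apply/seteqP; split=> x.
  move=> [h1 [h2 ->]]; have [c1 c1E] := qpol_sum h1; have [c2 c2E] := qpol_sum h2.
  exists (fun i => if (i < n)%N then c1 i else c2 (i - n)%N).
  rewrite (sumF (fun i => if (i < n)%N then c1 i else c2 (i - n)%N)) c1E c2E !rmorph_sum; congr (_ + _ * b); apply: eq_bigr => i _ /=.
    by rewrite ltn_ord qpolZ.
  by rewrite ltnNge leq_addr /= addKn qpolZ.
by move=> [c ->]; rewrite sumF; eexists; eexists.
Qed.

(** The quadratic relation closes the module [O + O b] under products, where [O] is the image of
    [Z_p[x]]; it spans because [O] already does. *)
Lemma adjoin_order b u v : b * b = qpol u + qpol v * b -> @is_order Zp A (adjoin b).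
Proof.
move=> bb; split.
- by exists 1, 0; rewrite rmorph1 rmorph0 mul0r addr0.
- move=> _ _ [h1 [h2 ->]] [k1 [k2 ->]]; split.
    exists (h1 - k1), (h2 - k2); rewrite !rmorphB /=; ring.
  exists (h1 * k1 + h2 * k2 * u), (h1 * k2 + h2 * k1 + h2 * k2 * v).
  rewrite !(rmorphD, rmorphM) /=.
  transitivity (qpol h1 * qpol k1 + (qpol h1 * qpol k2 + qpol h2 * qpol k1) * b +
    qpol h2 * qpol k2 * (b * b)); first by ring.
  by rewrite bb; ring.
- exact: adjoin_fg.
- move=> x; have [k [h xh]] := qpol_common_den x.
  exists (p%:R ^+ k); first by rewrite expf_neq0 // padic_p_neq0.
  by exists h, 0; rewrite scale_pow xh rmorph0 mul0r addr0.
Qed.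

Lemma poly_order_is_order : @is_order Zp A O.
Proof.
by rewrite -adjoin0; apply: (@adjoin_order 0 0 0); rewrite rmorph0 !mulr0 addr0.
Qed.

(* [b = (G C + p H) / p] satisfies [G b = - p K] in [Q_p[x]/(f)], hence
   [b^2 = H b - C K], so that adjoining [b] gives a larger order. *)
Lemma maximal_not_bad g : irreducible_poly g ->
  @is_maximal_order Zp A O -> ~ dedekind_bad f g.
Proof.
move=> [g1 _] [_ Omax] /dedekind_badE[C [H [K fE]]].
set G := liftp p_pr g in fE.
have [b pb] := mulpV (qpol (G * C + p%:R * H)).
have natp : qpol p%:R = p%:R by rewrite rmorph_nat.
have bb : b * b = qpol (- (C * K)) + qpol H * b.
  apply: mulpI; apply: mulpI => /=.
  transitivity ((p%:R * b) * (p%:R * b)); first by ring.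
  rewrite pb mulrDr mulrDr [X in _ = _ + X](_ : _ =
    p%:R * qpol H * (p%:R * b)); last by ring.
  rewrite pb -natp -!(rmorphM qpol) -!(rmorphD qpol).
  apply/eqP; rewrite -subr_eq0 -(rmorphB qpol); apply/eqP/qpol_eq0; exists C.
  by rewrite [in RHS]fE; ring.
have OE : adjoin b = O.
  apply: Omax; first exact: adjoin_order bb.
  by move=> _ [h _ <-]; exists h, 0; rewrite rmorph0 mul0r addr0.
have : O b by rewrite -OE; exists 0, 1; rewrite rmorph0 rmorph1 mul1r add0r.
move=> /poly_orderE[q bE]; move: pb; rewrite bE -natp -(rmorphM qpol) => /eqP.
rewrite -subr_eq0 -(rmorphB qpol) => /eqP /qpol_eq0[z] /(congr1 fp).
have fp_p : fp p%:R = 0 by rewrite rmorph_nat -polyC_natr pchar_Fp_0.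
rewrite !(rmorphB, rmorphD, rmorphM) /= fp_p !mul0r addr0 sub0r => gz.
have := congr1 fp fE; rewrite !(rmorphD, rmorphM, rmorphXn) /= fp_p !mul0r addr0.
rewrite /G liftpK in gz * => fgC.
have C0 : g * fp C != 0.
  apply: contraTneq f_monic => gC0; move: fgC; rewrite -mulrA gC0 mulr0.
  by move=> f0; apply/negP => fm; have := monic_neq0 (monic_map (@red p p_pr) fm); rewrite f0 eqxx.
(* If [b] were in the image of [Z_p[x]], then [g C = - f z] modulo [p], while [f = g^2 C] there;
   cancelling [g C] makes [g] a unit. *)
have : (1 + g * fp z) * (g * fp C) = 0.
  have -> : (1 + g * fp z) * (g * fp C) = g * fp C + g * g * fp C * fp z by ring.
  by rewrite -fgC -gz subrr.
move/eqP; rewrite mulf_eq0 (negPf C0) orbF addr_eq0 => /eqP gz1.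
have : g %| 1 by rewrite gz1 dvdpNr dvdp_mulr.
by rewrite dvdp1 => /eqP gs; rewrite gs in g1.
Qed.

(* The witnesses [B] and [Z] come from [P y] lying in the radical of [p O]. *)
Lemma bad_of_radical (P a B Z W : {poly Zp}) :
  sqfree (fp P) -> fp P %| fp f -> ~~ (fp f %| fp (P * a)) ->
  P ^+ 2 * a + p%:R * (P * B) + p%:R ^+ 2 * Z = f * W ->
  exists g, [/\ irreducible_poly g, g \is monic & dedekind_bad f g].
Proof.
move=> Ps /dvdpP[h fh] Pa fW.
have fp_p : fp p%:R = 0 by rewrite rmorph_nat -polyC_natr pchar_Fp_0.
have P0 := sqfree_neq0 Ps.
have f0 : fp f != 0 by rewrite monic_neq0 // monic_map.
have h0 : h != 0 by apply: contraNneq f0 => h0; rewrite fh h0 mul0r.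
have [||g [gi gm gP gW]] := @coprime_cofactor _ (fp P) h (fp a) (fp W) Ps h0.
- have := congr1 fp fW; rewrite !(rmorphD, rmorphM, rmorphXn) /= fp_p ?expr0n /=.
  rewrite !mul0r !addr0 fh => PW; apply: (mulfI P0).
  transitivity (h * fp P * fp W); first by ring.
  by rewrite -PW; ring.
- by move: Pa; rewrite rmorphM /= fh mulrC dvdp_mul2l.
exists g; split=> //; apply/dedekind_badE.
set G := liftp p_pr g.
have fpG : fp G = g by rewrite /G liftpK.
have [Q [T PE]] : exists Q T, P = G * Q + p%:R * T by apply: redp_dvd; rewrite fpG.
have [f1 [f2 fE]] : exists f1 f2, f = G * f1 + p%:R * f2.
  by apply: redp_dvd; rewrite fpG fh dvdp_mull.
have [U [V [V' UV]]] : exists U V V', 1 = U * W + V * G + p%:R * V'.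
  have [[u v] /= uv] := Bezout_eq1_coprimepP _ _ gW.
  have : fp 1 = fp (liftp p_pr u * W + liftp p_pr v * G).
    by rewrite rmorph1 rmorphD !rmorphM /= fpG !liftpK uv.
  by move=> /redp_eq[V' UV]; exists (liftp p_pr u), (liftp p_pr v), V'.
(* From [1 = U W + V G + p V'] follows [f = U (f W) + f (V G + p V')]. Both [P] and [f] lie in the
   ideal [(G, p)], so both summands lie in its square; the witnesses collect the coefficients of
   [G^2], [p G] and [p^2]. *)
exists (U * Q ^+ 2 * a + f1 * V), (U * (2 * Q * T * a + Q * B) + f2 * V + f1 * V'),
  (U * (T ^+ 2 * a + T * B + Z) + f2 * V').
have -> : f = U * (f * W) + f * (V * G + p%:R * V').
  by rewrite -{1}[f]mulr1 {1}UV; ring.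
by rewrite -fW {1}PE {1}fE PE; ring.
Qed.

(** A larger order [M] satisfies [p^k M <= O] for some [k], so it contains some [y] outside [O] with
    [p y] and [P y] in [O], where [P] lifts the radical of [f] modulo [p]. As all powers of [y] stay
    in [M], high powers of [p y] and [P y] fall into [p O], so both are multiples of [P] modulo [p].
    Comparing [P (p y)] with [p (P y)] gives the relation that [bad_of_radical] turns into a bad
    prime. *)
Lemma not_bad_maximal :
  (forall g, irreducible_poly g -> g \is monic -> ~ dedekind_bad f g) ->
  @is_maximal_order Zp A O.
Proof.
move=> fgood; split=> [|M [M1 MR [s Ms] _] sOM]; first exact: poly_order_is_order.
apply/seteqP; split=> // y0 My0; apply: contrapT => Oy0.
have natp : qpol p%:R = p%:R by rewrite rmorph_nat.
have MM x y : M x -> M y -> M (x * y) by move=> O'x My; case: (MR _ _ O'x My).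
have MX x k : M x -> M (x ^+ k).
  by move=> O'x; elim: k => [|k IH]; rewrite ?expr0 // exprS; apply: MM.
have Mq h : M (qpol h) by apply: sOM; exists h.
have Oq h : O (qpol h) by exists h.
have OM x y : O x -> O y -> O (x * y).
  by move=> /poly_orderE[h ->] /poly_orderE[h' ->]; rewrite -rmorphM; apply: Oq.
have [k kM] : exists k, forall x, M x -> O (p%:R ^+ k * x).
  have [k sk] : exists k, forall i : 'I_(size s), O (p%:R ^+ k * s`_i).
    have [e eP] := choice (fun i : 'I_(size s) => qpol_common_den s`_i).
    exists (\sum_i e i)%N => i; have [h ih] := eP i.
    rewrite (bigD1 i) //= exprD mulrAC ih -natp -rmorphXn -rmorphM; exact: Oq.
  exists k => x; rewrite Ms => -[c ->].
  rewrite mulr_sumr; elim/big_rec: _ => [|i x' _ /poly_orderE[h ->]].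
    by exists 0 => //; exact: (rmorph0 qpol).
  have /poly_orderE[h' hE] := sk i.
  by rewrite -scalerAr hE -qpolZ -rmorphD; apply: Oq.
have [y1 [My1 Oy1 Opy1]] : exists y, [/\ M y, ~ O y & O (p%:R * y)].
  have := kM _ My0; elim: k {kM} => [|k IH] Ok; first by rewrite mul1r in Ok.
  have [/IH//|Opk] := pselect (O (p%:R ^+ k * y0)).
  exists (p%:R ^+ k * y0); split=> //; last by rewrite mulrA -exprS.
  by rewrite -natp -rmorphXn; apply: MM.
have f0 : fp f != 0 by rewrite monic_neq0 // monic_map.
have [r [n [rs rf fr]]] := radical_exists f0.
pose P := liftp p_pr r; have fpP : fp P = r by rewrite /P liftpK.
have [b Pn] : exists b, qpol P ^+ n = p%:R * qpol b.
  have [|w [b Pn]] := @redp_dvd _ p_pr (P ^+ n) f; first by rewrite rmorphXn /= fpP.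
  exists b; rewrite -rmorphXn /= Pn rmorphD !rmorphM /= natp.
  by have /qpol_eq0 -> : exists z, f = f * z; [exists 1; rewrite mulr1 | rewrite mul0r add0r].
have [y [My Oy Opy OPy]] : exists y, [/\ M y, ~ O y, O (p%:R * y) & O (qpol P * y)].
  have : O (qpol P ^+ n * y1) by rewrite Pn mulrAC; apply: OM.
  elim: n {fr Pn} => [|n IH] On; first by rewrite mul1r in On.
  have [/IH//|ON] := pselect (O (qpol P ^+ n * y1)).
  exists (qpol P ^+ n * y1); split=> //; last by rewrite mulrA -exprS.
    by rewrite -rmorphXn; apply: MM.
  by rewrite mulrCA -rmorphXn; apply: OM.
(* An element of [O] with a power in [p O] is represented by a multiple of [P] modulo [p]. *)
have radP h m (x : A) : qpol h ^+ m = p%:R * x -> O x ->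
    exists a c, h = P * a + p%:R * c.
  move=> hm /poly_orderE[h' xE]; move: hm; rewrite xE -natp -rmorphM -rmorphXn => /eqP.
  rewrite -subr_eq0 -(rmorphB qpol) => /eqP /qpol_eq0[z] /(congr1 fp).
  rewrite rmorphB !rmorphM rmorphXn /= [fp p%:R]rmorph_nat -polyC_natr pchar_Fp_0 //.
  rewrite mul0r subr0 => hm; apply: redp_dvd; rewrite fpP.
  by apply: (@sqfree_dvd_exp _ _ _ m) => //; rewrite hm; apply: dvdp_mulr.
have [Y pyE] := (poly_orderE _).1 Opy; have [Z PyE] := (poly_orderE _).1 OPy.
have [a [B YE]] : exists a c, Y = P * a + p%:R * c.
  apply: (@radP _ k.+1 (p%:R ^+ k * y ^+ k.+1)); last by apply: kM; apply: MX.
  by rewrite -pyE exprMn exprS mulrA.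
have [Z1 [Z2 ZE]] : exists a c, Z = P * a + p%:R * c.
  apply: (@radP _ (n * k.+1)%N (qpol b ^+ k.+1 * (p%:R ^+ k * y ^+ (n * k.+1)))).
    rewrite -PyE exprMn exprM Pn [(_ * qpol b) ^+ _]exprMn exprS.
    by rewrite -!mulrA; congr (_ * _); rewrite mulrCA.
  by apply: OM; [rewrite -rmorphXn|apply: kM; apply: MX].
have [W fW] : exists W, P * Y - p%:R * Z = f * W.
  by apply/qpol_eq0; rewrite rmorphB !rmorphM /= natp -PyE -pyE mulrCA subrr.
have [] := @bad_of_radical P a (B - Z1) (- Z2) W; rewrite ?fpP //.
(* If [f] divided [P a] modulo [p], then [p y] would be [p] times an element of [O], hence [y] would
   be in [O]. *)
- apply/negP => /redp_dvd[u [v Pau]]; apply: Oy.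
  suff -> : y = qpol (v + B) by [].
  apply: mulpI; rewrite /= pyE YE Pau -addrA -mulrDr rmorphD !rmorphM /= natp.
  by have /qpol_eq0 -> : exists z, f = f * z; [exists 1; rewrite mulr1 | rewrite mul0r add0r].
- by rewrite -fW YE ZE; ring.
- by move=> g [gi gm gb]; apply: fgood gb.
Qed.

Lemma maximal_orderP : @is_maximal_order Zp A O <->
  forall g, irreducible_poly g -> g \is monic -> ~ dedekind_bad f g.
Proof.
split=> [Omax g gi _|]; last exact: not_bad_maximal.
exact: maximal_not_bad.
Qed.

End Dedekind.

(** * Haar measure of sets defined by congruences modulo [p^2] *)

Section HaarCount.
Variables (p : nat) (p_pr : prime p) (m : nat).
Local Notation Zp := (padic_int p_pr).
Local Notation digits := ('rV['F_p]_m * 'rV['F_p]_m)%type.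

Definition cong2 (a a' : 'rV[Zp]_m) := forall i, a 0 i 2%N = a' 0 i 2%N.

Lemma cong2P (a a' : 'rV[Zp]_m) : cong2 a a' <->
  exists z : 'rV[Zp]_m, a = a' + p%:R ^+ 2 *: z.
Proof.
split=> [aa'|[z ->] i]; last first.
  by apply/padic_res_eq; exists (z 0 i); rewrite !mxE addrAC subrr add0r.
have /choice[z zE] : forall i, exists z, a 0 i - a' 0 i = p%:R ^+ 2 * z.
  by move=> i; apply/padic_res_eq/aa'.
exists (\row_i z i); apply/rowP => i; rewrite !mxE -zE addrCA subrr addr0 //.
Qed.

Definition of_digits (x : digits) : 'rV[Zp]_m :=
  map_mx (@lift p p_pr) x.1 + p%:R *: map_mx (@lift p p_pr) x.2.

Lemma of_digits_ex (a : 'rV[Zp]_m) : exists x, cong2 a (of_digits x).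
Proof.
have /choice[b bE] : forall i, exists b, a 0 i - lift p_pr (red (a 0 i)) = p%:R * b.
  by move=> i; apply/red_eq0; rewrite rmorphB /= liftK subrr.
have /choice[c cE] : forall i, exists c, b i - lift p_pr (red (b i)) = p%:R * c.
  by move=> i; apply/red_eq0; rewrite rmorphB /= liftK subrr.
exists (\row_i red (a 0 i), \row_i red (b i)); apply/cong2P.
exists (\row_i c i); apply/rowP => i; rewrite !mxE expr2 -mulrA -cE -addrA -mulrDr.
by rewrite [lift _ (red (b i)) + _]addrC subrK -bE addrC subrK.
Qed.

Lemma of_digits_inj x y : cong2 (of_digits x) (of_digits y) -> x = y.
Proof.
case: x y => [u r] [u' r'] /cong2P[z /rowP E].
have uu' : u = u'.
  apply/rowP => i; have /(congr1 (@red p p_pr)) := E i.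
  rewrite /of_digits !mxE !(rmorphD, rmorphM, rmorphXn) /= !liftK red_p ?expr0n.
  by rewrite !mul0r !addr0.
congr pair => //; apply/rowP => i; have := E i.
rewrite /of_digits uu' !mxE -addrA => /addrI; rewrite expr2 -mulrA -mulrDr.
move=> /(mulfI (padic_p_neq0 p_pr)) /(congr1 (@red p p_pr)).
by rewrite rmorphD rmorphM /= red_p mul0r addr0 !liftK.
Qed.

Lemma of_digits0 : of_digits (0, 0) = 0.
Proof. by apply/rowP => i; rewrite !mxE lift0 mulr0 addr0. Qed.

Definition cong2_closed (A : set 'rV[Zp]_m) :=
  forall a a', cong2 a a' -> A a -> A a'.

Lemma cong2_closed_open (A : set 'rV[Zp]_m) : cong2_closed A -> open A.
Proof.
move=> Ac; rewrite openE => a Aa.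
exists (fun i j => [set y : Zp | y 2%N = a i j 2%N]) => [i j|a' aa'].
  rewrite nbhsE; exists [set y : Zp | y 2%N = a i j 2%N] => //; split=> //.
  by move=> y /= yE; exists 2%N => z /= ->.
by apply: (Ac a) => // i; rewrite (aa' 0 i).
Qed.

Variables (R : realType) (mu : probability (borel_space p_pr m) R).
Hypothesis mu_haar : is_haar mu.

Let cell x : set 'rV[Zp]_m := [set a | cong2 a (of_digits x)].

Lemma cong2_closed_measurable (A : set 'rV[Zp]_m) :
  cong2_closed A -> measurable (A : set (borel_space p_pr m)).
Proof. by move=> /cong2_closed_open oA; apply: sub_sigma_algebra. Qed.

Let cell_measurable x : measurable (cell x : set (borel_space p_pr m)).
Proof. by apply: cong2_closed_measurable => a a' aa' /= ax i; rewrite -aa'. Qed.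

Let mu_cell x : mu (cell x) = mu (cell (0, 0)).
Proof.
transitivity (mu [set of_digits x + a | a in cell (0, 0)]); last first.
  exact: (mu_haar _ (cell_measurable (0, 0))).
congr (mu _); apply/seteqP; split=> a /=.
  move=> /cong2P[z ->]; exists (p%:R ^+ 2 *: z) => //; apply/cong2P; exists z.
  by rewrite of_digits0 add0r.
move=> [b /cong2P[z zE] <-]; apply/cong2P; exists z.
by rewrite zE of_digits0 add0r.
Qed.

Let mu_cells (A : set 'rV[Zp]_m) : cong2_closed A ->
  mu A = (fine (mu (cell (0, 0))) *+ #|[pred x | `[< A (of_digits x) >]]|)%:E.
Proof.
move=> Ac; set P := [pred x | _].
have -> : A = \bigcup_(x in [set` enum P]) cell x.
  apply/seteqP; split=> a.
    move=> Aa; have [x ax] := of_digits_ex a; exists x => //=.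
    by rewrite mem_enum; apply/asboolP; apply: Ac Aa.
  move=> [x /=]; rewrite mem_enum => /asboolP Ax ax; apply: Ac Ax => i.
  by rewrite ax.
rewrite measure_fin_bigcup //; last first.
  by move=> x y _ _ [a [ax ay]]; apply: of_digits_inj => i; rewrite -ax -ay.
rewrite -fsbig_seq ?enum_uniq // big_enum /=.
rewrite (eq_bigr (fun _ => (fine (mu (cell (0, 0))))%:E)); last first.
  move=> x _; rewrite mu_cell fineK // fin_num_measure //.
by rewrite sumEFin sumr_const.
Qed.

(** The residue classes modulo [p^2] are translates of one another, so they have equal measure. They
    are disjoint, [p^(2 m)] in number, and cover a space of total mass one, which fixes the common
    value. *)
Lemma haar_count (A : set 'rV[Zp]_m) : cong2_closed A ->
  fine (mu A) = #|[pred x | `[< A (of_digits x) >]]|%:R / (p ^ m)%:R ^+ 2.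
Proof.
move=> Ac; rewrite mu_cells //=.
have := @mu_cells setT (fun _ _ _ _ => I); rewrite probability_setT => -[].
set c := fine _; have -> : #|[pred x : digits | `[< setT (of_digits x) >]]| = ((p ^ m) ^ 2)%N.
  rewrite (eq_card (B := predT)) => [|x]; last by rewrite !inE; apply/asboolP.
  by rewrite card_prod card_mx mul1n card_Fp // expnS expn1.
move=> c1; have pm0 : (p ^ m)%:R ^+ 2 != 0 :> R.
  by rewrite expf_neq0 // pnatr_eq0 -lt0n expn_gt0 prime_gt0.
apply: (mulIf pm0); rewrite divfK // mulrnAl -natrX.
by rewrite [c * _]mulr_natr -c1.
Qed.

End HaarCount.

(** * Divisibility of determinants by [p] and [p^2] *)

Section DeterminantModP.
Variables (p : nat) (p_pr : prime p).
Local Notation Zp := (padic_int p_pr).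
Local Notation rd := (@red p p_pr).

Lemma det_two_rows N (M : 'M[Zp]_N) (i0 i1 : 'I_N) : i0 != i1 ->
  (forall j, red (M i0 j) = 0) -> (forall j, red (M i1 j) = 0) ->
  exists z, \det M = p%:R ^+ 2 * z.
Proof.
move=> i01 M0 M1.
pose d := \row_(i < N) (if i \in [:: i0; i1] then p%:R else 1 : Zp).
have /choice[M' M'E] : forall ij, exists z, M ij.1 ij.2 = d 0 ij.1 * z.
  case=> i j /=; rewrite mxE !inE; case: eqVneq => [->|_] /=.
    exact/red_eq0.
  case: eqVneq => [->|_] /=; first exact/red_eq0.
  by exists (M i j); rewrite mul1r.
have -> : M = diag_mx d *m \matrix_(i, j) M' (i, j).
  apply/matrixP => i j; rewrite mul_diag_mx !mxE.
  by have := M'E (i, j); rewrite /= mxE.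
rewrite det_mulmx det_diag (bigD1 i0) //= (bigD1 i1) 1?eq_sym //=.
rewrite !mxE !inE !eqxx orbT mulrA -!mulrA; eexists; rewrite expr2 -mulrA; reflexivity.
Qed.

(** Row operations that are invertible modulo [p] lift to a matrix of unit determinant, and they
    make at least two rows divisible by [p]. *)
Lemma det_corank2 N (S : 'M[Zp]_N) : (\rank (map_mx rd S) + 2 <= N)%N ->
  exists z, \det S = p%:R ^+ 2 * z.
Proof.
set Sb := map_mx rd S => rS.
pose L := map_mx (@lift p p_pr) (invmx (col_ebase Sb)).
have rL : map_mx rd L = invmx (col_ebase Sb).
  by apply/matrixP => i j; rewrite !mxE liftK.
have Lu : \det L \is a GRing.unit.
  rewrite padic_unitE -det_map_mx rL det_inv invr_eq0 -unitfE -unitmxE.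
  exact: col_ebase_unit.
have rLS : map_mx rd (L *m S) = pid_mx (\rank Sb) *m row_ebase Sb.
  rewrite map_mxM rL -/Sb -{2}(mulmx_ebase Sb) mulmxA mulmxA mulVmx ?mul1mx //.
  exact: col_ebase_unit.
have row0 (i : 'I_N) : (\rank Sb <= i)%N -> forall j, red ((L *m S) i j) = 0.
  move=> ri j; have /matrixP/(_ i j) := rLS; rewrite mxE => ->; rewrite mxE.
  by rewrite big1 // => k _; rewrite !mxE ltnNge ri andbF mul0r.
have h0 : (\rank Sb < N)%N by lia.
have h1 : ((\rank Sb).+1 < N)%N by lia.
have [|||z] := @det_two_rows _ (L *m S) (Ordinal h0) (Ordinal h1).
- by rewrite -val_eqE /= neq_ltn ltnSn.
- exact: row0.
- exact: row0.
rewrite det_mulmx => zE; exists ((\det L)^-1 * z).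
by rewrite mulrCA -zE mulrA mulVr // mul1r.
Qed.

(** Right multiplication by the identity matrix with first column replaced by [w] turns the first
    column of [S] into [p y]. This matrix is triangular with unit diagonal because [w] starts with
    [1], so the determinant is unchanged. *)
Lemma det_scaled_column N (S : 'M[Zp]_N) (j0 : 'I_N) (w y : 'cV[Zp]_N) :
  val j0 = 0%N -> w j0 0 = 1 -> S *m w = p%:R *: y ->
  \det S = p%:R * \det (\matrix_(i, j) (if j == j0 then y i 0 else S i j)).
Proof.
move=> j00 w1 Sw; set S2 := \matrix_(i, j) _.
pose P := \matrix_(i, j) (if j == j0 then w i 0 else (i == j)%:R : Zp).
pose d := \row_j (if j == j0 then p%:R else 1 : Zp).
have SP : S *m P = S2 *m diag_mx d.
  apply/matrixP => i j; rewrite mul_mx_diag [RHS]mxE [LHS]mxE !mxE.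
  case: (eqVneq j j0) => [->|jj0].
    have := congr1 (fun A : 'cV_N => A i 0) Sw; rewrite !mxE => Swi.
    rewrite mulrC -Swi; apply: eq_bigr => k _; by rewrite !mxE eqxx.
  rewrite mulr1 (bigD1 j) //= !mxE (negPf jj0) eqxx mulr1 big1 ?addr0 // => k kj.
  by rewrite !mxE (negPf jj0) (negPf kj) mulr0.
have detP : \det P = 1.
  rewrite det_trig; last first.
    apply/is_trig_mxP => i j ij; rewrite mxE; case: eqVneq => [jj0|_].
      by rewrite jj0 j00 in ij.
    by rewrite -val_eqE /= ltn_eqF.
  apply: big1 => i _; rewrite mxE; case: eqVneq => [->//|_]; by rewrite eqxx.
have := congr1 determinant SP; rewrite !det_mulmx detP mulr1 det_diag => ->.
rewrite mulrC (bigD1 j0) //= mxE eqxx big1 ?mulr1 // => i ij.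
by rewrite mxE (negPf ij).
Qed.

End DeterminantModP.

(** * The discriminant modulo [p^2] through the Sylvester matrix *)

Section Discriminant.
Variables (p : nat) (p_pr : prime p).
Local Notation Zp := (padic_int p_pr).
Local Notation rd := (@red p p_pr).
Local Notation fp := (map_poly rd).
Variable f : {poly Zp}.
Hypotheses (f_monic : f \is monic) (f_size : (1 < size f)%N).

(** Characteristic zero keeps the degree of [f'] at [n - 1] even when [p] divides [n]. The Sylvester
    matrix is thus formed in these degrees before reduction, although the derivative of [fp f] may
    have smaller degree. *)
Let size_f' : size f^`() = (size f).-1.
Proof.
apply/eqP; rewrite eqn_leq; apply/andP; split.
  by rewrite -ltnS prednK ?lt_size_deriv ?monic_neq0 // (ltn_trans _ f_size).
have [m fm] : exists m, size f = m.+2 by case: (size f) f_size => [|[|m]] //; exists m.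
rewrite fm /= ltnNge; apply/negP => /leq_sizeP /(_ m (leqnn m)).
rewrite coef_deriv -[m.+1]/(m.+2.-1) -fm -lead_coefE (monicP f_monic).
by move/eqP; apply/negP; apply: padic_natr_neq0; rewrite fm.
Qed.

Let d1 := (size f^`()).-1.
Let d2 := (size f).-1.
Local Notation S := (Sylvester_mx f f^`()).

Let fp_size : size (fp f) = size f.
Proof. by rewrite size_map_poly_id0 // (monicP f_monic) rmorph1 oner_neq0. Qed.

(** A row vector is a pair of polynomials [(A, B)], so the left kernel modulo [p] consists of the
    relations [A f + B f' = 0] with bounded degrees. *)
Let Sb_mul (v : 'rV['F_p]_(d1 + d2)) : v *m map_mx rd S =
  poly_rV (rVpoly (lsubmx v) * fp f + rVpoly (rsubmx v) * (fp f)^`()).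
Proof.
have -> : map_mx rd S = col_mx (lin1_mx (poly_rV \o fp f \o* rVpoly))
    (lin1_mx (poly_rV \o (fp f)^`() \o* rVpoly)).
  rewrite /Sylvester_mx map_col_mx; congr (col_mx _ _).
    by apply: map_lin1_mx => u; rewrite map_poly_rV rmorphM /= map_rVpoly.
  by apply: map_lin1_mx => u; rewrite map_poly_rV rmorphM /= map_rVpoly deriv_map.
by rewrite -{1}[v]hsubmxK mul_row_col !mul_rV_lin1 /= -linearD.
Qed.

Let S_mul (v : 'rV[Zp]_(d1 + d2)) : v *m S =
  poly_rV (rVpoly (lsubmx v) * f + rVpoly (rsubmx v) * f^`()).
Proof.
by rewrite /Sylvester_mx -{1}[v]hsubmxK mul_row_col !mul_rV_lin1 /= -linearD.
Qed.

Let comb_size (R : comNzRingType) (v : 'rV[R]_(d1 + d2)) (g h : {poly R}) :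
  (size g <= size f)%N -> (size h <= (size f).-1)%N ->
  (size (rVpoly (lsubmx v) * g + rVpoly (rsubmx v) * h)%R <= d1 + d2)%N.
Proof.
move=> sg sh; apply: leq_trans (size_polyD _ _) _; rewrite geq_max.
have sl := size_poly d1 (fun k => if insub k is Some i then lsubmx v 0 i else 0).
have sr := size_poly d2 (fun k => if insub k is Some i then rsubmx v 0 i else 0).
rewrite -/(rVpoly _) in sl; rewrite -/(rVpoly _) in sr.
have d1E : d1 = (size f).-2 by rewrite /d1 size_f'.
have sl' : (size (rVpoly (lsubmx v)) <= (size f).-2)%N by rewrite -d1E.
have sr' : (size (rVpoly (rsubmx v)) <= (size f).-1)%N := sr.
have le_d : ((size f).-2 + (size f).-1 <= d1 + d2)%N by rewrite -d1E.
apply/andP; split; apply: leq_trans (size_polyMleq _ _) (leq_trans _ le_d).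
  by move: (size (rVpoly (lsubmx v))) (size (f : seq _)) (size (g : seq _)) f_size sg sl' => m n' mg; lia.
by move: (size (rVpoly (rsubmx v))) (size (f : seq _)) (size (h : seq _)) f_size sh sr' => m n' mg; lia.
Qed.

Lemma sqf_discE : sqf_disc f <-> ~ exists z, \det S = p%:R ^+ 2 * z.
Proof.
rewrite /sqf_disc /padic_dvd /discriminant /resultant.
have e2 : (-1 : Zp) ^+ 'C((size f).-1, 2) * (-1) ^+ 'C((size f).-1, 2) = 1.
  by rewrite -expr2 sqrr_sign.
split=> nd [z zE]; apply: nd; exists ((-1) ^+ 'C((size f).-1, 2) * z).
  by rewrite zE mulrCA.
by rewrite mulrCA -zE mulrA e2 mul1r.
Qed.

(** The discriminant is even nonzero modulo [p]: a relation [A f = - B f'] would make [fp f] divide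
    [B], whose degree is smaller. *)
Lemma sqf_disc_coprime : coprimep (fp f) (fp f)^`() -> sqf_disc f.
Proof.
move=> cop; apply/sqf_discE => -[z Sz].
have : \det (map_mx rd S) == 0.
  by rewrite det_map_mx Sz expr2 -mulrA rmorphM /= red_p mul0r.
move=> /det0P[v v0]; rewrite Sb_mul => /(congr1 rVpoly).
rewrite poly_rV_K ?linear0; last first.
  apply: comb_size; first by rewrite fp_size.
  by rewrite -fp_size -ltnS prednK ?lt_size_deriv ?fp_size ?monic_neq0 ?monic_map // (ltn_trans _ f_size).
set A := rVpoly _; set B := rVpoly _ => /eqP; rewrite addr_eq0 => /eqP AB.
have fB : fp f %| B.
  by rewrite -(Gauss_dvdpl _ cop) -dvdpNr -mulNr mulNr -AB dvdp_mull.
have B0 : B = 0.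
  apply: contraTeq fB => B0; apply/negP => /(dvdp_leq B0); apply/negP.
  rewrite -ltnNge fp_size; apply: leq_ltn_trans (size_poly _ _) _.
  by rewrite /d2 prednK // (ltn_trans _ f_size).
have A0 : A = 0.
  move/eqP: AB; rewrite B0 mul0r oppr0 mulf_eq0 orbC.
  by rewrite (negPf (monic_neq0 (monic_map rd f_monic))) => /eqP.
have : v = 0.
  rewrite -[v]hsubmxK -[lsubmx v]rVpolyK -[rsubmx v]rVpolyK -/A -/B A0 B0.
  by rewrite !linear0 row_mx0.
by move/eqP; rewrite (negPf v0).
Qed.

(** The relation between the cofactors of [D] in [f'] and [f], multiplied by [1] and by ['X], gives
    two independent vectors in the left kernel modulo [p]; the degree of [D] leaves room for the
    factor ['X]. *)
Lemma not_sqf_disc_common D :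
  D %| fp f -> D %| (fp f)^`() -> (2 < size D)%N -> ~ sqf_disc f.
Proof.
move=> /dvdpP[f1 fE] /dvdpP[q1 qE] sD /sqf_discE; apply.
have f0 : fp f != 0 by rewrite monic_neq0 // monic_map.
have D0 : D != 0 by apply: contraTneq sD => ->; rewrite size_poly0.
have f10 : f1 != 0 by apply: contraNneq f0 => f10; rewrite fE f10 mul0r.
have sf1 : size f = (size f1 + size D).-1 by rewrite -fp_size fE size_mul.
have sq1 : (size q1 + size D <= size f)%N \/ q1 = 0.
  have [->|q10] := eqVneq q1 0; [by right | left].
  have := @lt_size_deriv _ (fp f) f0; rewrite qE size_mul // fp_size.
  have : (0 < size q1)%N by rewrite size_poly_gt0.
  move: (size q1) (size D) => m1 m2; lia.
have sf1_gt0 : (0 < size f1)%N by rewrite size_poly_gt0.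
apply: det_corank2.
pose vec (t : {poly 'F_p}) : 'rV['F_p]_(d1 + d2) := row_mx (poly_rV (t * q1)) (poly_rV (- (t * f1))).
have sA (t : {poly 'F_p}) : (size t < size D)%N -> (size (t * q1)%R <= d1)%N.
  move=> st; case: sq1 => [sq1|->]; last by rewrite mulr0 size_poly0.
  apply: leq_trans (size_polyMleq _ _) _; rewrite /d1 size_f' sf1.
  by move: (size t) (size q1) (size D) (size f1) st sq1 sf1_gt0 sf1 f_size => a1 a2 a3 a4; lia.
have sB (t : {poly 'F_p}) : (size t < size D)%N -> (size (- (t * f1))%R <= d2)%N.
  move=> st; rewrite size_polyN.
  apply: leq_trans (size_polyMleq _ _) _; rewrite /d2 sf1.
  by move: (size t) (size D) (size f1) st sf1_gt0 => a1 a2 a3; lia.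
have vec0 (t : {poly 'F_p}) : (size t < size D)%N -> vec t *m map_mx rd S = 0.
  move=> st; rewrite Sb_mul row_mxKl row_mxKr !poly_rV_K ?sA ?sB //.
  have -> : t * q1 * fp f + - (t * f1) * (fp f)^`() = 0; last exact: linear0.
  by rewrite qE fE; ring.
pose V := col_mx (vec 1) (vec 'X).
have VS : V *m map_mx rd S = 0.
  rewrite mul_col_mx !vec0 ?col_mx0 ?size_polyX // size_poly1.
  by rewrite (ltn_trans _ sD).
have Vfree : row_free V.
  rewrite -kermx_eq0; apply/rowV0P => u /sub_kermxP.
  rewrite -[u]hsubmxK mul_row_col [lsubmx u]mx11_scalar [rsubmx u]mx11_scalar !mul_scalar_mx.
  set l := lsubmx u 0 0; set r := rsubmx u 0 0 => uV.
  have vecD : l *: vec 1 + r *: vec 'X = vec (l%:P + r *: 'X).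
    rewrite /vec !scale_row_mx add_row_mx -!linearZ -!linearD.
    by congr (row_mx (poly_rV _) (poly_rV _)); rewrite /= -!mul_polyC; ring.
  have := congr1 (fun v' => rVpoly (rsubmx v')) uV.
  rewrite vecD row_mxKr linear0.
  have ht : (size (l%:P + r *: 'X)%R < size D)%N.
    rewrite addrC -mul_polyC size_MXaddC; case: ifP => _; first by rewrite (ltn_trans _ sD).
    by apply: leq_ltn_trans sD; rewrite size_polyC; case: (r != 0).
  rewrite poly_rV_K ?sB // linear0 => /eqP.
  rewrite oppr_eq0 mulf_eq0 (negPf f10) orbF => /eqP lr.
  have -> : l = 0 by have := congr1 (fun g : {poly 'F_p} => g`_0) lr; rewrite coefD coefC coefZ coefX mulr0 addr0 coef0.
  have -> : r = 0 by have := congr1 (fun g : {poly 'F_p} => g`_1) lr; rewrite coefD coefC coefZ coefX mulr1 add0r coef0.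
  by rewrite !raddf0 row_mx0.
have := mulmx0_rank_max VS; by rewrite (eqP Vfree) addnC.
Qed.

Let horner_rV (R : comNzRingType) d (v : 'rV[R]_d) (x : R) :
  \sum_i v 0 i * x ^+ i = (rVpoly v).[x].
Proof.
rewrite (@horner_coef_wide _ d) ?size_poly //.
by apply: eq_bigr => i _; rewrite coef_rVpoly_ord.
Qed.

Definition value_col (R : comNzRingType) (x e0 e1 : R) : 'cV[R]_(d1 + d2) :=
  col_mx (\col_i (x ^+ i * e0)) (\col_i (x ^+ i * e1)).

Let value_colE (R : comNzRingType) (x e0 e1 : R) (v : 'rV[R]_(d1 + d2)) :
  (v *m value_col x e0 e1) 0 0 =
    (rVpoly (lsubmx v)).[x] * e0 + (rVpoly (rsubmx v)).[x] * e1.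
Proof.
rewrite -{1}[v]hsubmxK mul_row_col mxE -!horner_rV !mulr_suml.
congr (_ + _); rewrite mxE; apply: eq_bigr => i _; by rewrite !mxE mulrA.
Qed.

(* When [f = (x - a)^2 h] modulo [p], evaluating at [a] replaces a column of the
   Sylvester matrix by [p] times the vector of values of [(f / p, f' / p)] at
   [a]; the kernel of the new matrix modulo [p] is spanned by the cofactors of
   [x - a] in [f'] and [f]. *)
Lemma sqf_disc_double a h : let k := 2%:R *: h + ('X - a%:P) * h^`() in
  fp f = ('X - a%:P) ^+ 2 * h -> coprimep (('X - a%:P) * h) k ->
  sqf_disc f <-> ~ dedekind_bad f ('X - a%:P).
Proof.
move=> k fE cop.
(* The two signs make ['X - b] exactly the coefficientwise lift of ['X - a]. *)
pose b := - lift p_pr (- a); have rb : red b = a by rewrite rmorphN /= liftK opprK.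
set G := liftp p_pr ('X - a%:P).
have GE : G = 'X - b%:P.
  apply/polyP => i; rewrite coef_map_id0 // !coefB !coefX !coefC.
  by case: i => [|[|i]] /=; rewrite ?sub0r ?subr0 ?opprK ?mulr0n ?mulr1n ?sub0r ?subr0 ?opprK ?lift1 ?oppr0 ?lift0.
have [E fGE] : exists E, f = G ^+ 2 * liftp p_pr h + p%:R * E.
  by apply/redp_eq; rewrite rmorphM rmorphXn /= !liftpK.
have Gb : G.[b] = 0 by rewrite GE hornerXsubC subrr.
have fb : f.[b] = p%:R * E.[b].
  by rewrite fGE !hornerE Gb -polyC_natr hornerC; ring.
have f'b : f^`().[b] = p%:R * E^`().[b].
  rewrite fGE expr2 derivD !derivM -polyC_natr derivC mul0r add0r !hornerD !hornerM ?hornerD ?hornerM Gb ?hornerC; ring.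
pose y := value_col b E.[b] E^`().[b].
pose w : 'cV[Zp]_(d1 + d2) := \col_j b ^+ j.
have Sw : S *m w = p%:R *: y.
  apply/colP => i.
  have rowE' (M : 'cV[Zp]_(d1 + d2)) : M i 0 = ((delta_mx 0 i : 'rV[Zp]_(d1 + d2)) *m M) 0 0.
    rewrite mxE (bigD1 i) //= mxE !eqxx mul1r big1 ?addr0 // => l li.
    by rewrite mxE (negPf li) andbF mul0r.
  rewrite rowE' [RHS]rowE' mulmxA S_mul -scalemxAr [RHS]mxE value_colE.
  rewrite mxE (eq_bigr (fun j : 'I__ => (poly_rV (rVpoly (lsubmx (delta_mx 0 i)) * f +
    rVpoly (rsubmx (delta_mx 0 i)) * f^`())) 0 j * b ^+ j)); last by move=> j _; rewrite [w _ _]mxE.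
  rewrite horner_rV poly_rV_K; last by apply: comb_size; rewrite ?size_f'.
  by rewrite hornerD !hornerM fb f'b; ring.
have d_gt0 : (0 < d1 + d2)%N by rewrite addn_gt0 /d2 orbC -subn1 subn_gt0 f_size.
pose j0 := Ordinal d_gt0.
have detS := @det_scaled_column p p_pr _ S j0 w y erefl _ Sw.
have w1 : w j0 0 = 1 by rewrite mxE expr0.
move/(_ w1) in detS.
set S2 := \matrix_(i, j) _ in detS.
have -> : sqf_disc f <-> red (\det S2) != 0.
  rewrite sqf_discE detS; split=> [nz|/eqP r0 [z]].
    apply/eqP => /red_eq0[z zE]; apply: nz; exists z.
    by rewrite zE mulrA expr2.
  rewrite expr2 -mulrA => /(mulfI (padic_p_neq0 p_pr)) zE.
  by apply: r0; apply/red_eq0; exists z.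
have ka : k.[a] != 0.
  move: cop; rewrite coprimepMl => /andP[cop _]; move: cop.
  by rewrite coprimep_sym coprimep_XsubC /root.
have h0 : h != 0.
  apply: contraTneq f_monic => h0; move: fE; rewrite h0 mulr0 => fp0.
  by apply/negP => fm; have := monic_neq0 (monic_map rd fm); rewrite fp0 eqxx.
have X0 : 'X - a%:P != 0 by rewrite polyXsubC_eq0.
have f'E : (fp f)^`() = ('X - a%:P) * k.
  rewrite fE expr2 !derivM derivXsubC /k scaler_nat -mulr_natl; ring.
have badE : dedekind_bad f ('X - a%:P) <-> (fp E).[a] = 0.
  rewrite fGE dedekind_bad_dvdE // dvdp_XsubCl /root.
  by split=> /eqP.
have S2_mul (v : 'rV['F_p]_(d1 + d2)) j : (v *m map_mx rd S2) 0 j =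
    if j == j0 then (rVpoly (lsubmx v)).[a] * (fp E).[a] +
      (rVpoly (rsubmx v)).[a] * (fp E^`()).[a]
    else (rVpoly (lsubmx v) * fp f + rVpoly (rsubmx v) * (fp f)^`())`_j.
  rewrite -value_colE mxE; case: (eqVneq j j0) => jj0.
    rewrite [RHS]mxE; apply: eq_bigr => i _; rewrite !mxE jj0 eqxx; congr (_ * _).
    rewrite /y /value_col ?mxE.
    by case: (fintype.split i) => k0; rewrite !mxE rmorphM rmorphXn /= -horner_map /= rb.
  transitivity ((v *m map_mx rd S) 0 j); last by rewrite Sb_mul mxE.
  by rewrite [RHS]mxE; apply: eq_bigr => i _; rewrite !mxE (negPf jj0).
have sk : (size k <= d1)%N.
  have : size (fp f)^`() = size (('X - a%:P) * k)%R by rewrite f'E.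
  have k0 : k != 0 by apply: contraNneq ka => ->; rewrite horner0.
  rewrite size_mul // size_XsubC /=; rewrite -/k => e.
  have := @lt_size_deriv _ (fp f); rewrite monic_neq0 ?monic_map // => /(_ isT).
  rewrite e fp_size /d1 size_f' /=.
  by move: (size (k : seq _)) (size (f : seq _)) => m1 m2; lia.
have sXh : size (('X - a%:P) * h)%R = d2.
  have := fp_size; rewrite fE expr2 -mulrA size_mul ?mulf_neq0 // size_XsubC /d2 => <-.
  by rewrite addSn add1n.
have hornerX : ('X - a%:P).[a] = 0 by rewrite hornerXsubC subrr.
rewrite badE -det_map_mx.
have -> : (\det (map_mx rd S2) != 0) <-> ~ (\det (map_mx rd S2) == 0).
  by split=> [/negP|/negP].
have iffN (P Q : Prop) : (P <-> Q) -> (~ P <-> ~ Q).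
  by move=> [pq qp]; split=> nP x; apply: nP; auto.
apply: iffN; split=> [/det0P[v v0 vS]|Ea].
  set A := rVpoly (lsubmx v) in S2_mul; set B := rVpoly (rsubmx v) in S2_mul.
  have vSj j : (v *m map_mx rd S2) 0 j = 0 by rewrite vS mxE.
  have AB0 : A * fp f + B * (fp f)^`() = 0.
    (* Only the constant coefficient of [W] was lost with the replaced column, and it is recovered
       from [W(a) = 0]. *)
    set W := _ + _; have WC : W = (W`_0)%:P.
      apply/polyP => j; rewrite coefC; case: eqP => [->//|/eqP j1].
      have [jd|dj] := ltnP j (d1 + d2).
        have := vSj (Ordinal jd); rewrite S2_mul -val_eqE /= (negPf j1).
        by rewrite -/A -/B -/W.
      rewrite nth_default // (leq_trans _ dj) //; apply: comb_size; rewrite ?fp_size //.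
      by rewrite -fp_size -ltnS prednK ?lt_size_deriv ?fp_size ?monic_neq0 ?monic_map // (ltn_trans _ f_size).
    have : W.[a] = 0.
      have -> : W = ('X - a%:P) * (A * (('X - a%:P) * h) + B * k).
        by rewrite /W f'E fE; ring.
      by rewrite hornerM hornerX mul0r.
    by rewrite WC hornerC => ->.
  have AB : A * (('X - a%:P) * h) = - (B * k).
    apply: (mulfI X0); apply/eqP; rewrite -subr_eq0 -mulrBr opprK; apply/eqP.
    by rewrite -AB0 f'E fE; ring.
  have /dvdpP[s Bs] : ('X - a%:P) * h %| B.
    by rewrite -(Gauss_dvdpl _ cop) -dvdpNr -AB dvdp_mull.
  have Xh0 : ('X - a%:P) * h != 0 by rewrite mulf_neq0.
  have sC : s = (s`_0)%:P.
    have [->|s0] := eqVneq s 0; first by rewrite coef0.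
    apply: size1_polyC.
    have := size_poly d2 (fun k0 => if insub k0 is Some i then rsubmx v 0 i else 0).
    rewrite -/(rVpoly _) -/B Bs size_mul // sXh.
    have : (0 < d2)%N by rewrite -sXh size_poly_gt0.
    by move: (size s) d2 => m1 [//|m2] _; rewrite addnS /= -[m2.+1]add1n leq_add2r.
  have As : A = - (s * k).
    by apply: (mulIf Xh0); rewrite AB Bs; ring.
  have := vSj j0; rewrite S2_mul eqxx -/A -/B As Bs sC.
  rewrite !(hornerN, hornerM, hornerC, hornerX) !(mul0r, mulr0, addr0) => /eqP.
  rewrite mulf_eq0 oppr_eq0 mulf_eq0 (negPf ka) orbF => /orP[/eqP s0|/eqP//].
  have : v = 0.
    rewrite -[v]hsubmxK -[lsubmx v]rVpolyK -[rsubmx v]rVpolyK -/A -/B As Bs sC s0.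
    by rewrite !mul0r oppr0 !linear0 row_mx0.
  by move/eqP; rewrite (negPf v0).
pose v : 'rV['F_p]_(d1 + d2) := row_mx (poly_rV k) (poly_rV (- (('X - a%:P) * h))).
have vr : rVpoly (rsubmx v) = - (('X - a%:P) * h).
  by rewrite row_mxKr poly_rV_K // size_polyN sXh.
have vl : rVpoly (lsubmx v) = k by rewrite row_mxKl poly_rV_K.
apply/det0P; exists v.
  apply/eqP => v0; move/eqP: vr; rewrite v0 !linear0 eq_sym oppr_eq0 mulf_eq0.
  by rewrite (negPf X0) (negPf h0).
apply/rowP => j; rewrite S2_mul vl vr mxE; case: eqP => _.
  by rewrite Ea mulr0 add0r hornerN hornerM hornerX mul0r oppr0 mul0r.
have -> : k * fp f + - (('X - a%:P) * h) * (fp f)^`() = 0; last by rewrite coef0.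
by rewrite f'E fE; ring.
Qed.

End Discriminant.

(** * Monic polynomials over a finite field and their repeated primes *)

Section MonicPolynomials.
Variable F : finFieldType.
Implicit Types f g h : {poly F}.

Definition monics n : seq {poly F} := [seq 'X^n + rVpoly v | v : 'rV[F]_n].

Lemma mem_monics n f : (f \in monics n) = (f \is monic) && (size f == n.+1).
Proof.
have srV (v : 'rV[F]_n) : (size (rVpoly v) < n.+1)%N by rewrite ltnS size_poly.
apply/mapP/andP => [[v _ ->]|[fm /eqP sf]].
  rewrite monicE lead_coefDl ?size_polyXn // lead_coefXn eqxx.
  by rewrite size_polyDl ?size_polyXn.
exists (poly_rV f); first by rewrite mem_enum.
apply/polyP => i; rewrite coefD coefXn coef_rVpoly.
case: insubP => [j _ <-|]; first by rewrite mxE ltn_eqF /= ?mulr0n ?add0r.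
rewrite -leqNgt addr0 leq_eqVlt => /orP[/eqP<-|ni].
  by move: fm; rewrite monicE /lead_coef sf eqxx => /eqP.
by rewrite gtn_eqF // nth_default // sf.
Qed.

Lemma monicsP n f : reflect (f \is monic /\ size f = n.+1) (f \in monics n).
Proof. by rewrite mem_monics; apply: (iffP andP) => -[fm /eqP]. Qed.

Lemma monics_uniq n : uniq (monics n).
Proof.
rewrite map_inj_uniq ?enum_uniq // => u v /addrI.
by move=> /(congr1 (@poly_rV _ n)); rewrite !rVpolyK.
Qed.

Lemma size_monics n : size (monics n) = (#|F| ^ n)%N.
Proof. by rewrite size_map -cardE card_mx mul1n. Qed.

Fixpoint monics_lt N : seq {poly F} :=
  if N is n.+1 then monics_lt n ++ monics n else [::].

Lemma mem_monics_lt N f : (f \in monics_lt N) = (f \is monic) && (size f <= N)%N.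
Proof.
elim: N => [|N IH] /=.
  by rewrite in_nil; apply/esym/negP => /andP[/monic_neq0]; rewrite -size_poly_gt0 ltnNge => /negP.
rewrite mem_cat IH mem_monics -andb_orr; congr (_ && _).
by rewrite orbC -leq_eqVlt.
Qed.

Lemma monics_lt_uniq N : uniq (monics_lt N).
Proof.
elim: N => //= N IH; rewrite cat_uniq IH monics_uniq andbT /=.
apply/hasPn => f /monicsP[_ sf]; rewrite mem_monics_lt sf ltnn andbF //.
Qed.

Lemma big_monics_lt (R : nmodType) N (P : pred {poly F}) (E : {poly F} -> R) :
  \sum_(g <- monics_lt N | P g) E g = \sum_(k < N) \sum_(g <- monics k | P g) E g.
Proof.
by elim: N => [|N IH] /=; rewrite ?big_nil ?big_ord0 // big_cat big_ord_recr IH.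
Qed.

Lemma big_seq_bij (R : nmodType) (I J : eqType) (s : seq I) (t : seq J)
    (P : pred I) (Q : pred J) (h : I -> J) (E : J -> R) :
  uniq s -> uniq t -> {in s &, injective h} ->
  (forall x, x \in s -> P x -> (h x \in t) && Q (h x)) ->
  (forall y, y \in t -> Q y -> exists x, [/\ x \in s, P x & h x = y]) ->
  \sum_(y <- t | Q y) E y = \sum_(x <- s | P x) E (h x).
Proof.
move=> us ut hI hP hQ; rewrite -big_filter -[RHS]big_filter -(big_map h predT E).
apply: perm_big; apply: uniq_perm; rewrite ?filter_uniq //.
  rewrite map_inj_in_uniq ?filter_uniq // => x y; rewrite !mem_filter.
  by move=> /andP[_ xs] /andP[_ ys]; apply: hI.
move=> y; rewrite mem_filter; apply/andP/mapP => [[Qy yt]|[x]].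
  by have [x [xs Px <-]] := hQ y yt Qy; exists x; rewrite // mem_filter Px.
by rewrite mem_filter => /andP[Px xs] ->; have /andP[] := hP x xs Px.
Qed.

(** The list is empty at [f = 0], which explains the recurring hypothesis [f != 0]. *)
Definition sq_primes f : seq {poly F} :=
  [seq g <- monics_lt (size f) | irreducibleb g && (g ^+ 2 %| f)].

Lemma sq_dvd_size f g : f != 0 -> g ^+ 2 %| f -> (size g <= size f)%N.
Proof.
by move=> f0 gf; apply: dvdp_leq f0 (dvdp_trans _ gf); rewrite expr2 dvdp_mulr.
Qed.

Lemma mem_sq_primes f g : f != 0 ->
  reflect [/\ g \is monic, irreducible_poly g & g ^+ 2 %| f] (g \in sq_primes f).
Proof.
move=> f0; rewrite mem_filter mem_monics_lt.
apply: (iffP idP) => [/andP[/andP[/irreducibleP gi gf] /andP[gm _]]|[gm /irreducibleP-> gf]] //.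
by rewrite gf gm /= sq_dvd_size.
Qed.

Lemma sq_primes_uniq f : uniq (sq_primes f).
Proof. by rewrite filter_uniq // monics_lt_uniq. Qed.

Lemma sq_primes_nil f : f != 0 -> sq_primes f = [::] <-> sqfree f.
Proof.
move=> f0; split=> [f_nil g gf|fs].
  rewrite leqNgt; apply/negP => /irred_factor[h [hi hm hg]].
  suff : h \in sq_primes f by rewrite f_nil.
  by apply/mem_sq_primes => //; split=> //; apply: dvdp_trans gf; rewrite dvdp_exp2r.
case sE : (sq_primes f) => [//|g s].
have /mem_sq_primes-/(_ f0)[_ [g1 _] /fs] : g \in sq_primes f by rewrite sE mem_head.
by rewrite leqNgt g1.
Qed.

Lemma irred_dvd_monic g h : irreducible_poly g -> g \is monic -> h \is monic ->
  (1 < size h)%N -> h %| g -> h = g.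
Proof.
move=> [g1 gi] gm hm h1 hg; apply/eqP; rewrite -eqp_monic //.
by apply: gi => //; rewrite gtn_eqF.
Qed.

Lemma irred_coprime g h : irreducible_poly g -> coprimep g h = ~~ (g %| h).
Proof.
move=> [g1 gi]; have g0 : g != 0 by rewrite -size_poly_gt0 (ltn_trans _ g1).
apply/idP/idP => [cop|gh].
  apply: contraL cop => gh; rewrite /coprimep.
  have /eqp_size -> : gcdp g h %= g by rewrite /eqp dvdp_gcdl dvdp_gcd dvdpp gh.
  by rewrite gtn_eqF.
rewrite /coprimep; apply: contraNT gh => /gi /(_ (dvdp_gcdl _ _)) gg.
by rewrite -(eqp_dvdl _ gg) dvdp_gcdr.
Qed.

Lemma sq_primes_mul_pow g m k : irreducible_poly g -> g \is monic -> m != 0 ->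
  ~~ (g %| m) -> (1 < k)%N -> perm_eq (sq_primes (g ^+ k * m)) (g :: sq_primes m).
Proof.
move=> gi gm m0 gNm k1; have g0 := monic_neq0 gm.
have f0 : g ^+ k * m != 0 by rewrite mulf_neq0 // expf_neq0.
have gN : g \notin sq_primes m.
  apply: contra gNm => /mem_sq_primes-/(_ m0)[_ _]; apply: dvdp_trans.
  by rewrite expr2 dvdp_mulr.
apply: uniq_perm; rewrite ?sq_primes_uniq //= ?gN ?sq_primes_uniq // => h.
rewrite inE; apply/mem_sq_primes/orP => // [[hm hi hf]|[/eqP->|]].
- have [hg|hg] := boolP (h %| g ^+ k).
    left; rewrite (irred_dvd_monic gi gm hm) //; first by case: hi.
    move: hg; apply: contraLR => hg; rewrite -irred_coprime //.
    by apply: coprimep_expr; rewrite irred_coprime.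
  right; apply/mem_sq_primes => //; split=> //.
  by rewrite -(Gauss_dvdpr _ (_ : coprimep _ (g ^+ k))) // coprimep_expl // irred_coprime.
- by split=> //; apply: dvdp_mulr; apply: dvdp_exp2l.
- by move=> /mem_sq_primes-/(_ m0)[hm hi hf]; split=> //; apply: dvdp_mull.
Qed.

Lemma irred_pow_split g f : irreducible_poly g -> f != 0 ->
  exists k m, f = g ^+ k * m /\ ~~ (g %| m).
Proof.
move=> gi; have [n] := ubnP (size f); elim: n f => // n IH f fn f0.
have [/dvdpP[q fE]|gf] := boolP (g %| f); last first.
  by exists 0%N, f; rewrite mul1r.
have q0 : q != 0 by apply: contraNneq f0 => q0; rewrite fE q0 mul0r.
have g0 : g != 0 by apply: contraNneq f0 => g0; rewrite fE g0 mulr0.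
have [||k [m [qE gm]]] := IH q; rewrite //.
  have [g1 _] := gi; rewrite fE size_mul // in fn.
  by move: (size g) (size q) g1 fn => a b; lia.
by exists k.+1, m; rewrite fE qE exprS mulrC mulrA.
Qed.

End MonicPolynomials.

(** * The weight and its convolution identity *)

Section SquareWeights.
Variables (F : finFieldType) (R : comNzRingType) (x : R).
Implicit Types f g h : {poly F}.

(* At [x = 1 / #|F|], the proportion of the lifts of [f] modulo [p^2] that are not
   [dedekind_bad] at any prime; at [x = 1], the indicator of squarefreeness. *)
Definition wt f : R := \prod_(g <- sq_primes f) (1 - x ^+ (size g).-1).

Definition sq_divs f : seq {poly F} :=
  [seq g <- monics_lt F (size f) | g ^+ 2 %| f].

Lemma mem_sq_divs f g : f != 0 ->
  (g \in sq_divs f) = (g \is monic) && (g ^+ 2 %| f).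
Proof.
move=> f0; rewrite mem_filter mem_monics_lt andbC -andbA; congr (_ && _).
by apply: andb_idl => /(sq_dvd_size f0).
Qed.

Lemma sq_divs_uniq f : uniq (sq_divs f).
Proof. by rewrite filter_uniq // monics_lt_uniq. Qed.

Lemma wt_mul_pow g m k : irreducible_poly g -> g \is monic -> m != 0 ->
  ~~ (g %| m) -> (1 < k)%N -> wt (g ^+ k * m) = (1 - x ^+ (size g).-1) * wt m.
Proof.
move=> gi gm m0 gNm k1; rewrite /wt (perm_big _ (sq_primes_mul_pow gi gm m0 gNm k1)).
by rewrite big_cons.
Qed.

Lemma size_monic_mulD g h : g \is monic -> h \is monic ->
  ((size (g * h)%R).-1 = (size g).-1 + (size h).-1)%N.
Proof.
move=> gm hm; have g0 : (0 < size g)%N by rewrite size_poly_gt0 monic_neq0.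
have h0 : (0 < size h)%N by rewrite size_poly_gt0 monic_neq0.
rewrite size_mul ?monic_neq0 //.
by move: (size g) (size h) g0 h0 => [|a] [|b] //= _ _; rewrite addnS.
Qed.

(** Take a prime [pi] with [pi^2 | f], of degree [d], and write [f = pi^k m] with [pi] not dividing
    [m]. The [g] prime to [pi] contribute [1 - x^d] times the sum for [m], since every [f / g^2]
    keeps the factor [pi^k]; the [g = pi h] contribute [x^d] times the sum for [f / pi^2]. By
    induction the total is [(1 - x^d) + x^d]. *)
Lemma wt_convolution f : f \is monic ->
  \sum_(g <- sq_divs f) x ^+ (size g).-1 * wt (f %/ g ^+ 2) = 1.
Proof.
have [n] := ubnP (size f); elim: n f => // n IH f fn fm.
have f0 := monic_neq0 fm.
have [f_nil|[pi pif]] : sq_primes f = [::] \/ exists g, g \in sq_primes f.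
- by case: (sq_primes f) => [|g s]; [left|right; exists g; rewrite mem_head].
- have -> : \sum_(g <- sq_divs f) x ^+ (size g).-1 * wt (f %/ g ^+ 2) =
      \sum_(g <- [:: 1 : {poly F}]) x ^+ (size g).-1 * wt (f %/ g ^+ 2).
    apply: perm_big; apply: uniq_perm; rewrite ?sq_divs_uniq // => g.
    rewrite mem_sq_divs // inE; apply/andP/eqP => [[gm gf]|->]; last first.
      by rewrite monic1 expr1n dvd1p.
    move/(sq_primes_nil f0): f_nil => /(_ g gf) g1.
    by apply/eqP; rewrite -eqp_monic ?monic1 // -size_poly_eq1 eqn_leq g1 size_poly_gt0 monic_neq0.
  by rewrite big_seq1 expr1n divp1 size_poly1 expr0 mul1r /wt f_nil big_nil.
have /mem_sq_primes-/(_ f0)[pm pi_irr pf] := pif.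
have p0 := monic_neq0 pm.
have [k [m [fE pNm]]] := irred_pow_split pi_irr f0.
have m0 : m != 0 by apply: contraNneq f0 => m0; rewrite fE m0 mulr0.
have k1 : (1 < k)%N.
  rewrite ltnNge; apply: contra pNm => k1; move: pf; rewrite fE expr2.
  case: k k1 fE => [|[|//]] _ _; first by rewrite mul1r; apply: dvdp_trans; apply: dvdp_mulr.
  by rewrite expr1 dvdp_mul2l.
have pkm : pi ^+ k \is monic by rewrite monic_exp.
have mm : m \is monic by rewrite -(monicMl _ pkm) -fE.
have p1 : (1 < size pi)%N by case: pi_irr.
have mf : (size m < size f)%N.
  rewrite fE size_monicM //.
  have : (1 < size (pi ^+ k))%N.
    apply: leq_trans p1 _; rewrite dvdp_leq ?expf_neq0 //.
    by rewrite -{1}[pi]expr1 dvdp_exp2l // ltnW.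
  have : (0 < size m)%N by rewrite size_poly_gt0.
  by move: (size (pi ^+ k)%R) (size m) => a b; clear; lia.
have coppm g : coprimep pi g -> coprimep (pi ^+ k) g by apply: coprimep_expl.
rewrite (bigID (fun g => pi %| g)) /=.
have -> : \sum_(g <- sq_divs f | ~~ (pi %| g)) x ^+ (size g).-1 * wt (f %/ g ^+ 2) =
    (1 - x ^+ (size pi).-1) *
    \sum_(g <- sq_divs m) x ^+ (size g).-1 * wt (m %/ g ^+ 2).
  rewrite mulr_sumr (@big_seq_bij _ _ _ (sq_divs m) (sq_divs f) predT _ id)
    ?sq_divs_uniq //; last 2 first.
  - move=> g; rewrite mem_sq_divs // => /andP[gm gf] _.
    rewrite mem_sq_divs // gm fE dvdp_mull //=.
    apply: contra pNm => pg; apply: dvdp_trans gf; apply: dvdp_trans pg _.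
    by rewrite expr2 dvdp_mulr.
  - move=> g; rewrite mem_sq_divs // => /andP[gm gf] pg; exists g; split=> //.
    rewrite mem_sq_divs // gm -(Gauss_dvdpr _ (_ : coprimep _ (pi ^+ k))) -?fE //.
    by rewrite coprimep_expl // coprimep_expr // coprimep_sym irred_coprime.
  rewrite big_seq [RHS]big_seq; apply: eq_bigr => g; rewrite mem_sq_divs // => /andP[gm gf].
  rewrite mulrCA; congr (_ * _).
  rewrite fE -divp_mulA // wt_mul_pow //.
    by apply: contraNneq m0 => m'0; rewrite -(divpK gf) m'0 mul0r.
  by apply: contra pNm => pm'; rewrite -(divpK gf) dvdp_mulr.
have -> : \sum_(g <- sq_divs f | pi %| g) x ^+ (size g).-1 * wt (f %/ g ^+ 2) =
    x ^+ (size pi).-1 *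
    \sum_(g <- sq_divs (f %/ pi ^+ 2)) x ^+ (size g).-1 * wt (f %/ pi ^+ 2 %/ g ^+ 2).
  rewrite mulr_sumr.
  have f'0 : f %/ pi ^+ 2 != 0 by rewrite dvdp_div_eq0.
  rewrite (@big_seq_bij _ _ _ (sq_divs (f %/ pi ^+ 2)) (sq_divs f) predT _ ( *%R pi))
    ?sq_divs_uniq //; last 3 first.
  - by move=> g h _ _; apply: mulfI.
  - move=> g; rewrite mem_sq_divs // => /andP[gm gf] _.
    rewrite mem_sq_divs // monicMl // gm dvdp_mulr // andbT /= exprMn.
    by rewrite -(divpK pf) [X in _ %| X]mulrC dvdp_mul2l ?expf_neq0.
  - move=> g; rewrite mem_sq_divs // => /andP[gm gf] /dvdpP[h gE].
    exists h; split=> //; last by rewrite gE mulrC.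
    rewrite mem_sq_divs // -(monicMr _ pm) -gE gm /=.
    by rewrite -(dvdp_mul2l _ _ (expf_neq0 2 p0)) mulrC -exprMn -gE mulrC divpK.
  rewrite big_seq [RHS]big_seq; apply: eq_bigr => g; rewrite mem_sq_divs // => /andP[gm gf].
  by rewrite size_monic_mulD // exprD -mulrA exprMn divp_divl.
rewrite IH ?mulr1; last first.
- by rewrite -(monicMr _ (monic_exp 2 pm)) divpK.
- have f'0 : f %/ pi ^+ 2 != 0 by rewrite dvdp_div_eq0.
  have := fn; rewrite -{1}(divpK pf) size_mul ?expf_neq0 //.
  have : (1 < size (pi ^+ 2))%N.
    apply: leq_trans p1 _; rewrite dvdp_leq ?expf_neq0 //.
    by rewrite expr2 dvdp_mulr.
  by move: (size (pi ^+ 2)%R) (size (f %/ pi ^+ 2)%R) => a b; clear; lia.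
rewrite IH ?mulr1 //; last exact: leq_trans mf _.
by rewrite addrC subrK.
Qed.

End SquareWeights.

(** * Second coefficient of a monic polynomial *)

Section SubleadingCoefficient.
Variable F : finFieldType.
Implicit Types f g h : {poly F}.

(* The factor ['X] gives the value [0] when [f] is constant. *)
Definition subl f : F := ('X * f)`_(size f).-1.

Lemma sublE n f : size f = n.+2 -> subl f = f`_n.
Proof. by rewrite /subl => -> /=; rewrite coefXM. Qed.

Lemma subl1 : subl 1 = 0.
Proof. by rewrite /subl size_poly1 mulr1 coefX. Qed.

(** Minus the sum of the roots is additive. The coefficients are compared after multiplying both
    factors by ['X], which treats constant factors uniformly. *)
Lemma sublM f g : f \is monic -> g \is monic -> subl (f * g) = subl f + subl g.
Proof.
move=> fm gm; rewrite /subl size_monic_mulD //.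
set m := (size f).-1; set n := (size g).-1.
have sf : size f = m.+1 by rewrite /m prednK // size_poly_gt0 monic_neq0.
have sg : size g = n.+1 by rewrite /n prednK // size_poly_gt0 monic_neq0.
have sXg : size ('X * g) = n.+2 by rewrite mulrC size_mulX ?monic_neq0 // sg.
pose r := \poly_(i < m) ('X * f)`_i.
have fE : 'X * f = 'X^(m.+1) + (subl f)%:P * 'X^m + r.
  apply/polyP => i; rewrite !coefD coefXn coefCM coefXn coef_poly /subl -/m.
  have [im|mi] := ltnP i m; first by rewrite !ltn_eqF ?(leq_trans im) // ?mulr0 ?add0r // ltnW.
  move: mi; rewrite leq_eqVlt => /orP[/eqP<-|mi].
    by rewrite ltn_eqF // eqxx mulr1 add0r addr0.
  rewrite [i == m]gtn_eqF // mulr0 !addr0.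
  move: mi; rewrite leq_eqVlt => /orP[/eqP<-|mi].
    by rewrite eqxx coefXM /= -[m]/(m.+1.-1) -sf -lead_coefE (monicP fm).
  by rewrite gtn_eqF // nth_default // mulrC size_mulX ?monic_neq0 // sf.
have -> : ('X * (f * g))`_(m + n) = (('X * f) * ('X * g))`_(m + n).+1.
  have -> : 'X * f * ('X * g) = 'X * ('X * (f * g)) by ring.
  by rewrite [RHS]coefXM.
rewrite -[('X * f)`_m]/(subl f) -[('X * g)`_n]/(subl g).
rewrite fE !mulrDl !coefD -mulrA coefCM !coefXnM.
have -> : ((m + n).+1 < m.+1)%N = false by lia.
have -> : ((m + n).+1 < m)%N = false by lia.
have -> : ((m + n).+1 - m.+1 = n)%N by lia.
have -> : ((m + n).+1 - m = n.+1)%N by lia.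
rewrite [('X * g)`_n.+1]coefXM /= -[g`_n]/(g`_n.+1.-1) -sg -lead_coefE (monicP gm) mulr1.
rewrite [(r * _)`_ _]nth_default ?addr0; first by rewrite addrC.
apply: leq_trans (size_polyMleq _ _) _; rewrite sXg.
by have := size_poly m (fun i => ('X * f)`_i); rewrite -/r => sr; lia.
Qed.

Definition adm (b : F) f := (f.[0] != 0) && (subl f == b).

Lemma horner0M f g : ((f * g).[0] != 0) = (f.[0] != 0) && (g.[0] != 0).
Proof. by rewrite hornerM mulf_eq0 negb_or. Qed.

Lemma adm_sqM b f g : f \is monic -> g \is monic ->
  adm b (f ^+ 2 * g) = (f.[0] != 0) && adm (b - subl f *+ 2) g.
Proof.
move=> fm gm; rewrite /adm horner0M sublM ?monic_exp // expr2 sublM // horner0M andbb.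
rewrite -andbA mulr2n; congr [&& _, _ & _].
by apply/eqP/eqP => [<-|->]; ring.
Qed.

End SubleadingCoefficient.

Lemma sum1_seq (R : nzRingType) (I : Type) (s : seq I) :
  \sum_(i <- s) (1 : R) = (size s)%:R.
Proof. by elim: s => [|i s IH]; rewrite ?big_nil // big_cons IH mulrS. Qed.

(** * Counts with prescribed second coefficient and nonzero constant term *)

Section AdmissibleCounts.
Variables (F : finFieldType) (R : realFieldType) (x : R).
Implicit Types f g h : {poly F}.
Local Notation q := (#|F|%:R : R).

Definition adm_wt n (b : F) : R := \sum_(f <- monics F n | adm b f) wt x f.
Definition adm_card n (b : F) : R := \sum_(f <- monics F n | adm b f) 1.

(** Every [f] divisible by [g^2] is [g^2 h], with the second coefficient of [h] lowered by twice
    that of [g]; there is no admissible one when [g(0) = 0] or [2 k > n]. *)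
Let inner n k b g : g \in monics F k ->
  \sum_(f <- monics F n | adm b f && (g ^+ 2 %| f))
      x ^+ (size g).-1 * wt x (f %/ g ^+ 2) =
  if (k.*2 <= n)%N && (g.[0] != 0) then x ^+ k * adm_wt (n - k.*2) (b - subl g *+ 2)
  else 0.
Proof.
move=> /monicsP[gm sg]; have g0 := monic_neq0 gm.
have sg2 : size (g ^+ 2) = k.*2.+1.
  rewrite -[LHS]prednK ?size_poly_gt0 ?expf_neq0 // expr2 size_monic_mulD // sg.
  by rewrite addnn.
case: ifPn => [/andP[kn gn0]|].
  rewrite (@big_seq_bij _ _ _ (monics F (n - k.*2)) _ (adm (b - subl g *+ 2)) _
    ( *%R (g ^+ 2))) ?monics_uniq //.
  - rewrite sg mulr_sumr; apply: eq_bigr => h _.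
    by rewrite mulKp ?expf_neq0.
  - by move=> h h' _ _; apply: mulfI; rewrite expf_neq0.
  - move=> h /monicsP[hm sh] hb; rewrite adm_sqM // gn0 hb dvdp_mulIl /= andbT.
    apply/monicsP; split; first by rewrite monicMl // monic_exp.
    rewrite size_monicM ?monic_exp ?monic_neq0 // sg2 sh; lia.
  - move=> f /monicsP[fm sf] /andP[fb /dvdpP[h fE]]; exists h.
    have hm : h \is monic by rewrite -(monicMr _ (monic_exp 2 gm)) -fE.
    rewrite mulrC -fE; split=> //.
      apply/monicsP; split=> //; have := sf; rewrite fE size_monicM ?monic_neq0 ?monic_exp // sg2.
      move: (size h) => s; lia.
    by move: fb; rewrite fE mulrC adm_sqM // => /andP[].
rewrite negb_and -ltnNge => ng; rewrite big_seq_cond big_pred0 // => f.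
apply/negP => /andP[/monicsP[fm sf] /andP[/andP[fn0 _] gf]].
case/orP: ng => [nk|/negPn/eqP gn0].
  by have := dvdp_leq (monic_neq0 fm) gf; rewrite sg2 sf ltnS leqNgt nk.
move/negP: fn0; apply; have /dvdpP[h ->] := gf.
by rewrite hornerM horner_exp gn0 expr0n mulr0.
Qed.

(** [wt_convolution] is summed over the admissible [f], and the divisors [g] are grouped by degree
    [k] and second coefficient [c]. *)
Lemma adm_convolution n b : adm_card n b =
  \sum_(k < n./2.+1) x ^+ k *
    \sum_(c : F) adm_card k c * adm_wt (n - k.*2) (b - c *+ 2).
Proof.
transitivity (\sum_(f <- monics F n | adm b f)
    \sum_(g <- monics_lt F n.+1 | g ^+ 2 %| f) x ^+ (size g).-1 * wt x (f %/ g ^+ 2)).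
  rewrite /adm_card big_seq_cond [RHS]big_seq_cond.
  apply: eq_bigr => f /andP[/monicsP[fm sf] _].
  by rewrite -(wt_convolution x fm) /sq_divs big_filter sf.
rewrite (exchange_big_dep predT) //= (@big_monics_lt F _ n.+1 predT).
transitivity (\sum_(k < n.+1) if (k < n./2.+1)%N then
    x ^+ k * \sum_(c : F) adm_card k c * adm_wt (n - k.*2) (b - c *+ 2) else 0); last first.
  rewrite -big_mkcond /= (big_ord_widen_cond n.+1 predT (fun k => x ^+ k * \sum_(c : F) adm_card k c * adm_wt (n - k.*2) (b - c *+ 2))) //.
  by lia.
apply: eq_bigr => k _; rewrite big_seq (eq_bigr _ (fun g gk => inner n b gk)) -big_seq.
have -> : (k < n./2.+1)%N = (k.*2 <= n)%N by rewrite ltnS geq_half_double.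
case: ifP => kn /=; last by rewrite big1.
rewrite -big_mkcond /= -mulr_sumr; congr (_ * _).
rewrite (partition_big (@subl F) predT) //=; apply: eq_bigr => c _.
rewrite mulr_suml; apply: eq_bigr => g /andP[_ /eqP ->].
by rewrite mul1r.
Qed.

Lemma adm_card0 b : adm_card 0 b = (b == 0)%:R.
Proof.
rewrite /adm_card (perm_big [:: 1 : {poly F}]) /=; last first.
  apply: uniq_perm; rewrite ?monics_uniq // => f; rewrite inE.
  apply/monicsP/eqP => [[fm sf]|->]; last by rewrite monic1 size_poly1.
  by apply/eqP; rewrite -eqp_monic ?monic1 // -size_poly_eq1 sf.
by rewrite big_cons big_nil /adm hornerC oner_neq0 subl1 eq_sym; case: eqP; rewrite ?addr0.
Qed.

(** In degree one the second coefficient is the constant term. Degrees zero and one are the only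
    ones where [adm_card] depends on [b]; all dependence of the densities on [b] originates
    there. *)
Lemma adm_card1 b : adm_card 1 b = (b != 0)%:R.
Proof.
have XC (c : F) : 'X + c%:P \is monic /\ size ('X + c%:P) = 2%N.
  have sc : (size (c%:P : {poly F}) < 2)%N by rewrite ltnS size_polyC leq_b1.
  by rewrite monicE lead_coefDl ?lead_coefX ?eqxx ?size_polyX // size_polyDl ?size_polyX.
have admX c : adm b ('X + c%:P) = (c != 0) && (c == b).
  have [_ /sublE slX] := XC c.
  by rewrite /adm !hornerE slX coefD coefX coefC /= add0r.
rewrite /adm_card (@big_seq_bij _ _ _ (enum F) _
  (fun c => (c != 0) && (c == b)) _ (fun c => 'X + c%:P)).
- rewrite big_enum_cond /=; have [->|b0] := eqVneq b 0.
    by rewrite big_pred0 // => c; case: eqP.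
  by rewrite (big_pred1 b) // => c; rewrite andb_idl // => /eqP->.
- exact: enum_uniq.
- exact: monics_uniq.
- by move=> c c' _ _ /addrI /polyC_inj.
- by move=> c _ cb; rewrite admX cb andbT; apply/monicsP.
- move=> f /monicsP[fm sf] fb; have fE : 'X + (f`_0)%:P = f.
    apply/polyP => -[|[|i]]; rewrite coefD coefX coefC ?add0r ?addr0 //=.
      by have /monicP := fm; rewrite lead_coefE sf.
    by rewrite nth_default ?sf.
  by exists f`_0; rewrite mem_enum -admX fE.
Qed.

Let add_subl n c f : f \in monics F n.+2 ->
  [/\ f + c *: 'X^(n.+1) \in monics F n.+2, subl (f + c *: 'X^(n.+1)) = subl f + c
    & (f + c *: 'X^(n.+1)).[0] = f.[0]].
Proof.
move=> /monicsP[fm sf].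
have sc : (size (c *: 'X^(n.+1)) < size f)%N.
  by rewrite sf; apply: leq_ltn_trans (size_scale_leq _ _) _; rewrite size_polyXn.
have sfc : size (f + c *: 'X^(n.+1)) = n.+3 by rewrite size_polyDl.
split.
- by apply/monicsP; rewrite sfc monicE lead_coefDl // -monicE.
- by rewrite !(sublE (n := n.+1)) // coefD coefZ coefXn eqxx mulr1.
- by rewrite hornerD hornerZ hornerXn expr0n mulr0 addr0.
Qed.

(** From degree two on, adding a multiple of ['X^(n.+1)] changes the second coefficient at will and
    leaves the constant term alone. *)
Let adm_card_const n b : adm_card n.+2 b = adm_card n.+2 0.
Proof.
apply/esym; rewrite /adm_card (@big_seq_bij _ _ _ (monics F n.+2) _ (adm b) _
  (fun f => f + (- b) *: 'X^(n.+1))) ?monics_uniq //.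
- by move=> f g _ _; apply: addIr.
- move=> f fn /andP[f0 fb]; have [-> sE h0] := add_subl (- b) fn.
  by rewrite /adm h0 f0 sE subr_eq0.
- move=> f fn /andP[f0 /eqP fb]; exists (f + b *: 'X^(n.+1)).
  have [fb' sE h0] := add_subl b fn; rewrite fb'; split=> //.
    by rewrite /adm h0 f0 sE fb add0r eqxx.
  by rewrite scaleNr addrK.
Qed.

Lemma sum_adm_card n : \sum_b adm_card n.+1 b = q ^+ n.+1 - q ^+ n.
Proof.
rewrite /adm_card.
have -> : \sum_b \sum_(f <- monics F n.+1 | adm b f) 1 =
    \sum_(f <- monics F n.+1 | f.[0] != 0) (1 : R).
  by rewrite [RHS](partition_big (@subl F) predT).
have <- : \sum_(f <- monics F n.+1) 1 - \sum_(f <- monics F n.+1 | f.[0] == 0) 1 =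
    \sum_(f <- monics F n.+1 | f.[0] != 0) (1 : R).
  by rewrite (bigID (fun f => f.[0] == 0)) /= addrC addrK.
congr (_ - _); first by rewrite sum1_seq size_monics natrX.
rewrite (@big_seq_bij _ _ _ (monics F n) _ predT _ ( *%R 'X)) ?monics_uniq //.
- by rewrite sum1_seq size_monics natrX.
- by move=> f g _ _; apply: mulfI; rewrite polyX_eq0.
- move=> f /monicsP[fm sf] _; rewrite hornerM hornerX mul0r eqxx andbT.
  by apply/monicsP; rewrite monicMl ?monicX // mulrC size_mulX ?monic_neq0 ?sf.
- move=> f /monicsP[fm sf]; rewrite -/(root f 0) -dvdp_XsubCl subr0 => /dvdpP[g fE].
  have gm : g \is monic by rewrite -(monicMr _ (monicX F)) -fE.
  exists g; rewrite mulrC -fE; split=> //; apply/monicsP; split=> //.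
  by move: sf; rewrite fE size_mulX ?monic_neq0 // => -[].
Qed.

Lemma q_gt1 : 1 < q.
Proof. by rewrite (ltr_nat R 1); apply: card_finNzRing_gt1. Qed.

Lemma adm_cardSS n b : adm_card n.+2 b = q ^+ n * (q - 1).
Proof.
have q0 : q != 0 by rewrite gt_eqF // (lt_trans ltr01 q_gt1).
apply: (mulfI q0); rewrite adm_card_const.
have := sum_adm_card n.+1; rewrite (eq_bigr (fun _ => adm_card n.+2 0)).
  move=> e; transitivity (\sum_(b' : F) adm_card n.+2 0).
    by rewrite sumr_const mulr_natl.
  by rewrite e !exprS; ring.
by move=> b' _; apply: adm_card_const.
Qed.

End AdmissibleCounts.

(** * Recurrences for the sum over [b] and for the difference between [b = 0] and [b != 0] *)

Section Recursions.
Variables (F : finFieldType) (R : realFieldType) (x : R).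
Local Notation q := (#|F|%:R : R).
Local Notation W := (@adm_wt F R x).
Local Notation M := (@adm_card F R).

(* The series [1 + (q-1) t + (q-1) q t^2 + ...] equals [(1 - t) / (1 - q t)], so
   inverting its value at [x t^2] gives a recurrence of order two. *)
Lemma convolution_step (m a c : nat -> R) :
  m 0 = 1 -> m 1 = q - 1 -> (forall k, m k.+2 = q * m k.+1) ->
  (forall n, c n = \sum_(k < n./2.+1) x ^+ k * (m k * a (n - k.*2)%N)) ->
  [/\ a 0 = c 0, a 1 = c 1 & forall n, a n.+2 = x * a n + c n.+2 - q * x * c n].
Proof.
move=> m0 m1 mS cE; split.
- by rewrite cE big_ord_recl big_ord0 expr0 m0 !mul1r addr0.
- by rewrite cE big_ord_recl big_ord0 expr0 m0 !mul1r addr0.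
move=> n; rewrite (cE n.+2) (cE n) /= !big_ord_recl /=.
rewrite !expr0 expr1 m0 m1 !mul1r !subn0.
rewrite [(n.+2 - _)%N](_ : _ = n) //; last by rewrite doubleS; lia.
set s1 := \sum_(i < _) _; set s2 := \sum_(i < _) _.
suff -> : s1 = q * x * s2 by ring.
rewrite mulr_sumr; apply: eq_bigr => i _; rewrite /bump /= !add1n mS.
have -> : (n.+2 - i.+2.*2 = n - i.+1.*2)%N by rewrite !doubleS.
by rewrite !exprS; ring.
Qed.

Definition tot n : R := \sum_b W n b.
Definition diff n b : R := W n 0 - W n b.

Lemma sum_shift n b : (2%:R : F) != 0 -> \sum_(c : F) W n (b - c *+ 2) = tot n.
Proof.
move=> F2; rewrite /tot [RHS](reindex_inj (h := fun c : F => b - c *+ 2)) //.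
move=> c c' /addrI /oppr_inj; rewrite -mulr_natl -[in RHS]mulr_natl.
exact: mulfI.
Qed.

Let m n : R := \sum_b M n b.

Let m0 : m 0 = 1.
Proof.
rewrite /m (bigD1 0) //= adm_card0 eqxx big1 ?addr0 // => b b0.
by rewrite adm_card0 (negPf b0).
Qed.

Let mS n : m n.+1 = q ^+ n.+1 - q ^+ n.
Proof. exact: sum_adm_card. Qed.

Let mSS k : m k.+2 = q * m k.+1.
Proof. by rewrite !mS !exprS; ring. Qed.

Let m1 : m 1 = q - 1.
Proof. by rewrite mS expr1 expr0. Qed.

(** Summing over [b] absorbs the shift by [2 c] in every characteristic. *)
Lemma tot_rec : [/\ tot 0 = 1, tot 1 = q - 1, tot 2 = x + q ^+ 2 - q - q * x
  & forall n, tot n.+3 = x * tot n.+1 + (q - 1) * q ^+ n * (q ^+ 2 - q * x)].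
Proof.
have [|t0 t1 tS] := convolution_step (a := tot) (c := m) m0 m1 mSS.
  move=> n; rewrite /m; under eq_bigr do rewrite (adm_convolution x).
  rewrite exchange_big; apply: eq_bigr => k _ /=; rewrite -mulr_sumr; congr (_ * _).
  rewrite exchange_big mulr_suml; apply: eq_bigr => c _ /=.
  rewrite -mulr_sumr; congr (_ * _); rewrite /tot.
  rewrite [RHS](reindex_inj (h := fun b : F => b - c *+ 2)) //.
  exact: addIr.
rewrite t0 t1 tS t0 m1 m0 mS; split=> // [|n]; first by ring.
by rewrite tS !mS !exprS; ring.
Qed.

(** As [2] is invertible, the terms [k >= 2] of the convolution see only the totals [tot], because
    [adm_card k c] does not depend on [c]. The term [k = 0] is [W n.+2 b], and [k = 1], where
    [c = 0] is missing, is [x (tot n - W n b)]. The left side is the same for all [b], so the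
    differences of these two terms cancel. *)
Lemma diff_odd b : (2%:R : F) != 0 -> b != 0 ->
  [/\ diff 0 b = 1, diff 1 b = -1 & forall n, diff n.+2 b = x * diff n b].
Proof.
move=> F2 b0; rewrite /diff.
have W0 c : W 0 c = (c == 0)%:R.
  rewrite -[RHS](adm_card0 R) (adm_convolution x) big_ord_recl big_ord0 addr0 expr0 mul1r.
  rewrite (bigD1 0) //= adm_card0 eqxx mul1r mul0rn subr0 big1 ?addr0 // => d d0.
  by rewrite adm_card0 (negPf d0) mul0r.
have W1 c : W 1 c = (c != 0)%:R.
  rewrite -[RHS](adm_card1 R) (adm_convolution x) big_ord_recl big_ord0 addr0 expr0 mul1r.
  rewrite (bigD1 0) //= adm_card0 eqxx mul1r mul0rn subr0 big1 ?addr0 // => d d0.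
  by rewrite adm_card0 (negPf d0) mul0r.
rewrite !W0 !W1 eqxx (negPf b0) /= subr0 sub0r; split=> // n.
have main c : M n.+2 c = W n.+2 c + x * (tot n - W n c) +
    \sum_(i < n./2) x ^+ i.+2 * (q ^+ i * (q - 1) * tot (n.+2 - i.+2.*2)).
  rewrite (adm_convolution x) /= !big_ord_recl /= expr0 mul1r addrA; congr (_ + _ + _).
  - rewrite (bigD1 0) //= adm_card0 eqxx mul1r mul0rn !subr0 big1 ?addr0 // => d d0.
    by rewrite adm_card0 (negPf d0) mul0r.
  - rewrite expr1; congr (_ * _); rewrite -(sum_shift n c F2) [in RHS](bigD1 0) //=.
    rewrite (bigD1 0) //= adm_card1 eqxx mul0r add0r mul0rn subr0 addrC addrK.
    rewrite [(n.+2 - _)%N](_ : _ = n); last by rewrite doubleS; lia.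
    by apply: eq_bigr => d d0; rewrite adm_card1 d0 mul1r.
  - apply: eq_bigr => i _; rewrite /bump /= !add1n; congr (_ * _).
    rewrite -(sum_shift _ c F2) mulr_sumr; apply: eq_bigr => d _.
    by rewrite adm_cardSS.
have := main 0; rewrite adm_cardSS -(adm_cardSS R n b) (main b) => /addIr e.
have -> : W n.+2 0 = W n.+2 b + x * (tot n - W n b) - x * (tot n - W n 0).
  by rewrite e; ring.
by ring.
Qed.

(** Here [2 c = 0], so the convolution has no shift and applies to the differences themselves; on
    the left they vanish from degree two on. *)
Lemma diff_char2 b : (2%:R : F) = 0 -> b != 0 ->
  [/\ diff 0 b = 1, diff 1 b = -1, diff 2 b = x - q * x, diff 3 b = q * x - x
    & forall n, diff n.+4 b = x * diff n.+2 b].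
Proof.
move=> F2 b0.
have [|d0 d1 dS] := convolution_step (a := diff^~ b) (c := fun n => M n 0 - M n b) m0 m1 mSS.
  move=> n; rewrite !(adm_convolution x) -sumrB; apply: eq_bigr => k _.
  rewrite -mulrBr; congr (_ * _); rewrite /m /diff mulrBr.
  have c2 (c : F) : c *+ 2 = 0 by rewrite -mulr_natl F2 mul0r.
  by rewrite !mulr_suml; congr (_ - _); apply: eq_bigr => c _; rewrite c2 subr0.
have c0 : M 0 0 - M 0 b = 1 by rewrite !adm_card0 eqxx (negPf b0) subr0.
have c1 : M 1 0 - M 1 b = -1 by rewrite !adm_card1 eqxx b0 sub0r.
have cSS n : M n.+2 0 - M n.+2 b = 0 by rewrite !adm_cardSS subrr.
rewrite c0 in d0; rewrite c1 in d1.
split=> // [||n]; rewrite /= dS ?d0 ?d1 cSS ?c0 ?c1 ?cSS; ring.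
Qed.

End Recursions.

(** * Polynomials over a finite field with a single double root *)

Section DoubleRoots.
Variables (F : finFieldType) (R : realFieldType).
Implicit Types f g h : {poly F}.
Local Notation q := (#|F|%:R : R).
Local Notation W := (@adm_wt F R 1).

Lemma wt1 f : wt (1 : R) f = (sq_primes f == [::])%:R.
Proof.
rewrite /wt; case: (sq_primes f) => [|g s]; first by rewrite big_nil.
by rewrite big_cons expr1n subrr mul0r.
Qed.

Lemma XsubC_irred (a : F) : irreducible_poly ('X - a%:P).
Proof.
split=> [|g g1 gX]; first by rewrite size_XsubC.
have X0 : 'X - a%:P != 0 by rewrite polyXsubC_eq0.
have := dvdp_leq X0 gX; rewrite size_XsubC => g2.
rewrite -dvdp_size_eqp // size_XsubC eqn_leq g2.
have : g != 0 by apply: contraTneq gX => ->; rewrite dvd0p polyXsubC_eq0.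
by rewrite -size_poly_gt0; case: (size g) g1 => [|[|]].
Qed.

Lemma XsubC_dvd_root (a : F) h : ('X - a%:P %| h) = (h.[a] == 0).
Proof. by rewrite dvdp_XsubCl. Qed.

Lemma monic_linear g : g \is monic -> size g = 2%N -> exists a, g = 'X - a%:P.
Proof.
move=> gm sg; exists (- g`_0); apply/polyP => -[|[|i]]; rewrite coefB coefX coefC /=.
- by rewrite sub0r opprK.
- by rewrite subr0; have /monicP := gm; rewrite lead_coefE sg.
- by rewrite subr0 nth_default ?sg.
Qed.

Lemma subl_XsubC (a : F) : subl ('X - a%:P) = - a.
Proof. by rewrite (sublE (n := 0)) ?size_XsubC // coefB coefX coefC /= sub0r. Qed.

Lemma adm_XsubCM b a h : h \is monic ->
  adm b (('X - a%:P) * h) = (a != 0) && adm (b + a) h.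
Proof.
move=> hm; rewrite /adm horner0M sublM ?monicXsubC // hornerXsubC sub0r oppr_eq0.
rewrite subl_XsubC -andbA; congr [&& _, _ & _].
by apply/eqP/eqP => [<-|->]; ring.
Qed.

Lemma wt1_XsubCM a h : h \is monic ->
  wt (1 : R) (('X - a%:P) * h) = (h.[a] != 0)%:R * wt 1 h.
Proof.
move=> hm; have h0 := monic_neq0 hm; have X0 : 'X - a%:P != 0 by rewrite polyXsubC_eq0.
have f0 : ('X - a%:P) * h != 0 by rewrite mulf_neq0.
have [ha|ha] := eqVneq h.[a] 0; rewrite ?mul0r ?mul1r.
  rewrite wt1 (_ : (_ == _) = false) //; apply/eqP => s0.
  suff : 'X - a%:P \in sq_primes (('X - a%:P) * h) by rewrite s0.
  apply/mem_sq_primes => //; rewrite monicXsubC; split=> //; first exact: XsubC_irred.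
  by rewrite expr2 dvdp_mul2l // XsubC_dvd_root ha.
rewrite !wt1; suff -> : (sq_primes (('X - a%:P) * h) == [::]) = (sq_primes h == [::]) by [].
apply/eqP/eqP => [/(sq_primes_nil f0) hs|/(sq_primes_nil h0) hs].
  by apply/(sq_primes_nil h0) => g gf; apply: hs; apply: dvdp_mull.
apply/(sq_primes_nil f0) => g gf.
rewrite leqNgt; apply/negP => /irred_factor[pi [pi_irr pm pg]].
have {}gf : pi ^+ 2 %| ('X - a%:P) * h by apply: dvdp_trans gf; rewrite dvdp_exp2r.
have p1 : (1 < size pi)%N by case: pi_irr.
have [pX|pX] := boolP (pi %| 'X - a%:P).
  have piE := irred_dvd_monic (XsubC_irred a) (monicXsubC a) pm p1 pX.
  by move: gf; rewrite piE expr2 dvdp_mul2l // XsubC_dvd_root (negPf ha).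
have := hs pi; rewrite leqNgt p1 /= => hs'; have : false by apply: hs';
  rewrite -(Gauss_dvdpr _ (_ : coprimep _ ('X - a%:P))) // coprimep_expl // irred_coprime.
by [].
Qed.

Definition avoid_wt a m b : R :=
  \sum_(h <- monics F m | adm b h && (h.[a] != 0)) wt 1 h.

Lemma avoid_wt0 a b : avoid_wt a 0 b = W 0 b.
Proof.
rewrite /avoid_wt /adm_wt big_seq_cond [RHS]big_seq_cond; apply: eq_bigl => h.
apply: andb_id2l => /monicsP[hm sh]; apply: andb_idr => _.
have /size_poly1P[c c0 ->] : size h == 1%N by rewrite sh.
by rewrite hornerC.
Qed.

(** The squarefree polynomials vanishing at [a] are the [('X - a) h] with [h] squarefree and
    [h(a) != 0]; the second coefficient of [h] is larger by [a]. *)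
Lemma avoid_wtS a m b : a != 0 ->
  avoid_wt a m.+1 b = W m.+1 b - avoid_wt a m (b + a).
Proof.
move=> a0; apply/eqP; rewrite eq_sym subr_eq; apply/eqP.
rewrite /adm_wt (bigID (fun h => h.[a] != 0)) /=; congr (_ + _).
rewrite (@big_seq_bij _ _ _ (monics F m) _ (adm (b + a)) _ ( *%R ('X - a%:P))) ?monics_uniq //.
- rewrite /avoid_wt [RHS]big_mkcondr /= big_seq_cond [RHS]big_seq_cond.
  apply: eq_bigr => h /andP[/monicsP[hm _] _]; rewrite wt1_XsubCM //.
  by case: (h.[a] != 0); rewrite ?mul1r ?mul0r.
- by move=> h h' _ _; apply: mulfI; rewrite polyXsubC_eq0.
- move=> h /monicsP[hm sh] hb; rewrite adm_XsubCM // a0 hb negbK.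
  rewrite hornerM hornerXsubC subrr mul0r eqxx !andbT.
  by apply/monicsP; rewrite monicMl ?monicXsubC // size_monicM ?monicXsubC ?monic_neq0 // size_XsubC sh.
- move=> f /monicsP[fm sf] /andP[fb]; rewrite negbK -XsubC_dvd_root => /dvdpP[h fE].
  have hm : h \is monic by rewrite -(monicMr _ (monicXsubC a)) -fE.
  exists h; rewrite mulrC -fE; split=> //.
    apply/monicsP; split=> //; move: sf.
    by rewrite fE mulrC size_monicM ?monicXsubC ?monic_neq0 // size_XsubC => -[].
  by move: fb; rewrite fE mulrC adm_XsubCM // => /andP[].
Qed.

Definition double_root f : bool :=
  if sq_primes f is [:: g] then (size g == 2%N) && ~~ (g ^+ 3 %| f) else false.

Definition double_card n b : R := \sum_(f <- monics F n | adm b f && double_root f) 1.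

(** The only repeated prime determines the root [a], nonzero since [f(0) != 0]. Dividing by
    [('X - a)^2] leaves a squarefree polynomial not vanishing at [a], with second coefficient
    [b + 2 a]. *)
Lemma double_card_avoid n b :
  double_card n.+2 b = \sum_(a | a != 0) avoid_wt a n (b + a *+ 2).
Proof.
rewrite /double_card.
transitivity (\sum_(f <- monics F n.+2 | adm b f && double_root f)
    \sum_a (sq_primes f == [:: 'X - a%:P])%:R : R).
  rewrite big_seq_cond [RHS]big_seq_cond; apply: eq_bigr => f /andP[/monicsP[fm sf] /andP[_]].
  rewrite /double_root; case sE : (sq_primes f) => [//|g [|//]] /andP[/eqP sg _].
  have /mem_sq_primes-/(_ (monic_neq0 fm))[gm _ _] : g \in sq_primes f by rewrite sE mem_head.
  have [a gE] := monic_linear gm sg.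
  rewrite (bigD1 a) //= gE eqxx big1 ?addr0 // => a' a'a.
  by rewrite (_ : _ == _ = false) //; apply/eqP => -[/addrI/oppr_inj/polyC_inj aa']; rewrite aa' eqxx in a'a.
rewrite exchange_big /= (bigID (fun a => a == 0)) /= big_pred1_eq.
rewrite [X in X + _]big_seq_cond big1 ?add0r; last first.
  move=> f /andP[/monicsP[fm sf] /andP[/andP[f0 _] _]].
  rewrite (_ : _ == _ = false) //; apply/eqP => sE; move/negP: f0; apply.
  have /mem_sq_primes-/(_ (monic_neq0 fm))[_ _] : 'X - 0%:P \in sq_primes f.
    by rewrite sE mem_head.
  by rewrite -XsubC_dvd_root; apply: dvdp_trans; rewrite expr2 dvdp_mulr.
apply: eq_bigr => a a0; pose X2 := 'X - a%:P; have Xm : X2 \is monic := monicXsubC a.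
have Xn0 : X2 != 0 := monic_neq0 Xm.
transitivity (\sum_(f <- monics F n.+2 |
    adm b f && double_root f && (sq_primes f == [:: X2])) (1 : R)).
  by rewrite [RHS]big_mkcondr; apply: eq_bigr => f _; case: eqP.
transitivity (\sum_(h <- monics F n |
    adm (b + a *+ 2) h && (h.[a] != 0) && (sq_primes h == [::])) (1 : R)); last first.
  by rewrite [LHS]big_mkcondr; apply: eq_bigr => h _; rewrite wt1; case: eqP.
have sq_perm h : h \is monic -> h.[a] != 0 ->
    perm_eq (sq_primes (X2 ^+ 2 * h)) (X2 :: sq_primes h).
  move=> hm ha; apply: sq_primes_mul_pow => //; first exact: XsubC_irred.
    exact: monic_neq0.
  by rewrite XsubC_dvd_root.
have admX h : h \is monic -> adm b (X2 ^+ 2 * h) = adm (b + a *+ 2) h.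
  move=> hm; rewrite adm_sqM // subl_XsubC mulNrn opprK hornerXsubC sub0r oppr_eq0.
  by rewrite a0.
rewrite (@big_seq_bij _ _ _ (monics F n) _
  (fun h => adm (b + a *+ 2) h && (h.[a] != 0) && (sq_primes h == [::])) _
  ( *%R (X2 ^+ 2))) ?monics_uniq //.
- by move=> h h' _ _; apply: mulfI; rewrite expf_neq0.
- move=> h /monicsP[hm sh] /andP[/andP[hb ha] /eqP hs].
  have := sq_perm h hm ha; rewrite hs => /perm_small_eq -/(_ isT) sE.
  rewrite admX // hb /double_root sE eqxx size_XsubC eqxx /= andbT; apply/andP; split.
    apply/monicsP; rewrite monicMl ?monic_exp // size_monicM ?monic_exp ?monic_neq0 //.
    by rewrite size_exp_XsubC sh.
  by rewrite exprSr dvdp_mul2l ?expf_neq0 // XsubC_dvd_root.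
- move=> f /monicsP[fm sf] /andP[/andP[fb fd] /eqP sE].
  have f0 := monic_neq0 fm.
  have /mem_sq_primes-/(_ f0)[_ _ /dvdpP[h fE]] : X2 \in sq_primes f by rewrite sE mem_head.
  rewrite mulrC in fE.
  have hm : h \is monic by rewrite -(monicMr _ (monic_exp 2 Xm)) mulrC -fE.
  have ha : h.[a] != 0.
    move: fd; rewrite /double_root sE => /andP[_].
    by rewrite fE exprSr dvdp_mul2l ?expf_neq0 // XsubC_dvd_root.
  exists h; rewrite -fE; split=> //.
    apply/monicsP; split=> //; move: sf.
    by rewrite fE size_monicM ?monic_exp ?monic_neq0 // size_exp_XsubC => -[].
  rewrite -admX // -fE fb ha /= -size_eq0.
  by have := perm_size (sq_perm h hm ha); rewrite -fE sE => -[<-].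
Qed.

(** Each sieving step raises the multiple of [a] in the shift by one, so the case [i = 2] of
    interest requires all [i]. *)
Definition shift_wt m i b : R := \sum_(a | a != 0) avoid_wt a m (b + a *+ i).

(** The factor by which summation over the shifts by [a i], [a != 0], multiplies the difference
    between [b = 0] and [b != 0]. *)
Let e i : R := if (i%:R : F) == 0 then q - 1 else -1.

(** Two cases in one formula: [(q - 1) W m b] if [i = 0] in [F], and [tot - W m b] otherwise. *)
Let tot_shift i m b :
  \sum_(a : F | a != 0) W m (b + a *+ i) = tot F 1 m + (e i + 1) * W m b - W m b - (if (i%:R : F) == 0 then tot F 1 m else 0).
Proof.
have q1 : \sum_(a : F | a != 0) (1 : R) = q - 1.
  by rewrite sumr_const cardC1 -subn1 natrB // ltnW // card_finNzRing_gt1.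
rewrite /e; case: eqVneq => [i0|i0].
  rewrite (eq_bigr (fun _ => W m b * 1)) => [|a _]; first by rewrite -mulr_sumr q1; ring.
  by rewrite -[a *+ i]mulr_natl i0 mul0r addr0 mulr1.
rewrite [tot F 1 m](_ : _ = \sum_(a : F) W m (b + a *+ i)); last first.
  rewrite /tot [LHS](reindex_inj (h := fun a : F => b + a *+ i)) //.
  move=> a a' /addrI; rewrite -[LHS]mulr_natl -[RHS]mulr_natl; exact: mulfI.
by rewrite [in RHS](bigD1 0) //= mul0rn addr0; ring.
Qed.

Lemma shift_wtS m i b : shift_wt m.+1 i b =
  \sum_(a : F | a != 0) W m.+1 (b + a *+ i) - shift_wt m i.+1 b.
Proof.
rewrite /shift_wt -sumrB; apply: eq_bigr => a a0.
by rewrite avoid_wtS // -addrA -mulrSr.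
Qed.

Lemma shift_wt0 i b : shift_wt 0 i b = \sum_(a : F | a != 0) W 0 (b + a *+ i).
Proof. by apply: eq_bigr => a _; rewrite avoid_wt0. Qed.

(** The alternating signs of the sieve and the sign [(-1)^m] of the differences at [x = 1] combine,
    so that all terms carry the same sign. *)
Lemma shift_wt_diff m i b : (2%:R : F) != 0 -> b != 0 ->
  shift_wt m i 0 - shift_wt m i b = (-1) ^+ m * \sum_(j < m.+1) e (i + j).
Proof.
move=> F2 b0; have [d0 d1 dS] := diff_odd (1 : R) F2 b0.
have dE n : diff (1 : R) n b = (-1) ^+ n.
  suff [] : diff (1 : R) n b = (-1) ^+ n /\ diff (1 : R) n.+1 b = (-1) ^+ n.+1 by [].
  elim: n => [|n [IH1 IH2]]; first by rewrite d0 d1 expr0 expr1.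
  by split=> //; rewrite dS IH1 !exprS; ring.
have WE n i' : \sum_(a : F | a != 0) W n (0 + a *+ i') - \sum_(a : F | a != 0) W n (b + a *+ i') =
    e i' * (-1) ^+ n.
  by rewrite !tot_shift -dE /diff; ring.
elim: m i => [|m IH] i.
  by rewrite !shift_wt0 WE big_ord_recl big_ord0 addr0 addn0 mulrC.
have -> : shift_wt m.+1 i 0 - shift_wt m.+1 i b =
    (\sum_(a : F | a != 0) W m.+1 (0 + a *+ i) - \sum_(a : F | a != 0) W m.+1 (b + a *+ i)) -
    (shift_wt m i.+1 0 - shift_wt m i.+1 b) by rewrite !shift_wtS; ring.
have -> : \sum_(j < m.+2) e (i + j) = e i + \sum_(j < m.+1) e (i.+1 + j).
  by rewrite big_ord_recl addn0; congr (_ + _); apply: eq_bigr => j _; rewrite /= /bump /= addnA addn1.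
by rewrite WE IH !exprS; ring.
Qed.

(** Summing over [b] erases the shift; [U] is the alternating sum of the totals produced by the
    sieve. *)
Lemma shift_wt_tot m i : exists U : nat -> R, [/\ U 0 = tot F 1 0,
  forall n, U n.+1 = tot F 1 n.+1 - U n &
  \sum_b shift_wt m i b = (q - 1) * U m].
Proof.
pose U := fix U n := if n is n'.+1 then tot F (1 : R) n'.+1 - U n' else tot F 1 0.
exists U; split=> //.
have sumE n i' : \sum_b \sum_(a : F | a != 0) W n (b + a *+ i') = (q - 1) * tot F 1 n.
  rewrite exchange_big /= (eq_bigr (fun _ => tot F 1 n * 1)); last first.
    by move=> a _; rewrite mulr1 /tot [RHS](reindex_inj (h := fun b : F => b + a *+ i')) //; apply: addIr.
  rewrite -mulr_sumr sumr_const cardC1 -subn1 natrB; first by rewrite mulrC.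
  by rewrite ltnW // card_finNzRing_gt1.
elim: m i => [|m IH] i /=.
  by rewrite -(sumE 0 i); apply: eq_bigr => b _; rewrite shift_wt0.
rewrite mulrBr -(IH i.+1) -(sumE m.+1 i) -sumrB.
by apply: eq_bigr => b _; rewrite shift_wtS.
Qed.

End DoubleRoots.

(** * Counting polynomials that avoid one residue class modulo each of several primes *)

Section ChineseRemainderCount.
Variables (F : finFieldType) (R : realFieldType).
Implicit Types f g r : {poly F}.
Local Notation q := (#|F|%:R : R).

Definition polys_lt N : seq {poly F} := [seq rVpoly v | v : 'rV[F]_N].

Lemma mem_polys_lt N r : (r \in polys_lt N) = (size r <= N)%N.
Proof.
apply/mapP/idP => [[v _ ->]|rN]; first exact: size_poly.
by exists (poly_rV r); rewrite ?mem_enum // poly_rV_K.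
Qed.

Lemma polys_lt_uniq N : uniq (polys_lt N).
Proof.
rewrite map_inj_uniq ?enum_uniq // => u v.
by move=> /(congr1 (@poly_rV _ N)); rewrite !rVpolyK.
Qed.

(** From the polynomials avoiding the classes of the tail of [s], those lying in the class of
    [rho g] modulo [g] are removed. The latter are [rho g %% g + g t] with [t] in a space smaller by
    the degree of [g], and [t] is again to avoid one class modulo each remaining prime. *)
Lemma crt_count (s : seq {poly F}) N (rho : {poly F} -> {poly F}) :
  uniq s -> (forall g, g \in s -> g \is monic /\ irreducible_poly g) ->
  (\sum_(g <- s) (size g).-1 <= N)%N ->
  \sum_(r <- polys_lt N | all (fun g => ~~ (g %| r - rho g)) s) (1 : R) =
    q ^+ N * \prod_(g <- s) (1 - q^-1 ^+ (size g).-1).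
Proof.
have q0 : q != 0 by rewrite gt_eqF // (lt_trans ltr01 (q_gt1 _ _)).
elim: s N rho => [|g s IH] N rho /=.
  by move=> _ _ _; rewrite big_nil mulr1 sum1_seq size_map -cardE card_mx mul1n natrX.
move=> /andP[gs us] sP; rewrite !big_cons => gN.
have [gm gi] := sP g (mem_head _ _).
have {}sP h : h \in s -> h \is monic /\ irreducible_poly h.
  by move=> hs; apply: sP; rewrite inE hs orbT.
have cop h : h \in s -> coprimep h g.
  move=> hs; have [hm hi] := sP h hs; rewrite irred_coprime //.
  apply: contra gs => hg; rewrite (irred_dvd_monic gi gm hm) // in hs.
  by case: hi.
set d := (size g).-1 in gN *.
have sg : size g = d.+1 by rewrite /d prednK // size_poly_gt0 monic_neq0.
have dN : (d <= N)%N by lia.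
have /choice[u uP] : forall h, exists u, h \in s -> h %| g * u - 1.
  move=> h; have [hs|] := boolP (h \in s); last by exists 0.
  have [[a b] /= ab] := Bezout_eq1_coprimepP _ _ (cop h hs).
  exists b => _; rewrite -ab opprD addrCA [b * g]mulrC subrr addr0 dvdpNr dvdp_mull //.
pose P (r : {poly F}) := all (fun h => ~~ (h %| r - rho h)) s.
have -> : \sum_(r <- polys_lt N | ~~ (g %| r - rho g) && P r) (1 : R) =
    \sum_(r <- polys_lt N | P r) 1 - \sum_(r <- polys_lt N | P r && (g %| r - rho g)) 1.
  rewrite [X in _ = X - _](bigID (fun r => g %| r - rho g)) /= addrC addrK.
  by apply: eq_bigl => r; rewrite andbC.
rewrite {1}/P IH //; last exact: leq_trans (leq_addl _ _) gN.
(* Since [u h] inverts [g] modulo [h], this is the class of the [t] with [rho g %% g + g t = rho h]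
   modulo [h]. *)
pose rho2 h := (rho h - rho g %% g) * u h.
rewrite (@big_seq_bij _ _ _ (polys_lt (N - d)) _
  (fun t => all (fun h => ~~ (h %| t - rho2 h)) s) _ (fun t => rho g %% g + g * t)) ?polys_lt_uniq //.
- rewrite IH //; last by rewrite leq_subRL.
  rewrite -{1 3}(subnK dN) exprD exprVn; set X := \prod_(_ <- _) _.
  have qd : q ^+ d / q ^+ d = 1 by rewrite mulfV // expf_neq0.
  transitivity (q ^+ (N - d) * X * (q ^+ d - q ^+ d / q ^+ d)); last by ring.
  by rewrite qd; ring.
- by move=> t t' _ _ /addrI; apply: mulfI; rewrite monic_neq0.
- move=> t; rewrite !mem_polys_lt => tN tP.
  have s1 : (size (rho g %% g)%R <= N)%N.
    by rewrite (leq_trans _ dN) // -ltnS -sg ltn_modp monic_neq0.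
  rewrite (leq_trans (size_polyD _ _)) /=; last first.
    rewrite geq_max s1 /=; have [->|t0] := eqVneq t 0; first by rewrite mulr0 size_poly0.
    by rewrite size_monicM // sg addSn /= -leq_subRL.
  apply/andP; split; last first.
    have -> : rho g %% g + g * t - rho g = g * (t - rho g %/ g).
      by rewrite {2}(divp_eq (rho g) g); ring.
    exact: dvdp_mulIl.
  apply/allP => h hs; have /allP/(_ h hs) := tP; apply: contra => ht.
  rewrite -(Gauss_dvdpr _ (cop h hs)).
  have -> : g * (t - rho2 h) = (rho g %% g + g * t - rho h) -
      (rho h - rho g %% g) * (g * u h - 1) by rewrite /rho2; ring.
  by rewrite dvdp_sub // dvdp_mull // uP.
- move=> r; rewrite mem_polys_lt => rN /andP[rP /dvdpP[t rE]].
  have rE' : rho g %% g + g * (t + rho g %/ g) = r.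
    rewrite mulrDr addrCA [g * (_ %/ _)]mulrC [rho g %% g + _]addrC -divp_eq.
    by rewrite mulrC -rE subrK.
  exists (t + rho g %/ g); split=> //.
    rewrite mem_polys_lt; set t' := t + _ in rE' *.
    have [->|t0] := eqVneq t' 0; first by rewrite size_poly0.
    have : (size (g * t')%R <= N)%N.
      have -> : g * t' = r - rho g %% g by rewrite -rE' addrC addKr.
      rewrite (leq_trans (size_polyD _ _)) // size_polyN geq_max rN /=.
      by rewrite (leq_trans _ dN) // -ltnS -sg ltn_modp monic_neq0.
    by rewrite size_monicM // sg addSn /= -leq_subRL.
  apply/allP => h hs; have /allP/(_ h hs) := rP; apply: contra => ht.
  rewrite -rE'; set t' := t + _.
  have -> : rho g %% g + g * t' - rho h = g * (t' - rho2 h) +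
      (rho h - rho g %% g) * (g * u h - 1) by rewrite /rho2; ring.
  by rewrite dvdp_add // dvdp_mull // uP.
Qed.

End ChineseRemainderCount.

(** * Separability over the prime field *)

Section SeparabilityModP.
Variables (p : nat) (p_pr : prime p).
Implicit Types f g h : {poly 'F_p}.

Lemma deriv_dvd f g : g ^+ 2 %| f -> g %| f^`().
Proof.
move=> /dvdpP[h ->]; rewrite derivM expr2 derivM.
have -> : h^`() * (g * g) + h * (g^`() * g + g * g^`()) =
    (h^`() * g + h * g^`() *+ 2) * g by ring.
exact: dvdp_mull.
Qed.

(** If the derivative vanishes, only exponents divisible by [p] occur; elements of ['F_p] are their
    own [p]-th powers, so [g] is the [p]-th power of the polynomial [h] built from its
    coefficients. *)
Lemma irred_deriv_neq0 g : irreducible_poly g -> g^`() != 0.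
Proof.
move=> [g1 gi]; apply/eqP => g'0.
have chP : p \in [pchar {poly 'F_p}].
  by rewrite inE p_pr /= -polyC_natr pchar_Fp_0.
pose h := \poly_(i < size g) g`_(i * p).
have gE : g = h ^+ p.
  rewrite -(pFrobenius_autE chP) /h poly_def rmorph_sum /=.
  have FrE i : pFrobenius_aut chP (g`_(i * p) *: 'X^i) = g`_(i * p) *: 'X^(i * p).
    rewrite pFrobenius_autE exprZn -exprM; congr (_ *: _).
    by rewrite -[g`_(i * p)]natr_Zp -(pFrobenius_autE (pchar_Fp p_pr)) pFrobenius_aut_nat.
  rewrite (eq_bigr (fun i : 'I_(size g) => g`_(i * p) *: 'X^(i * p))) => [|i _]; last exact: FrE.
  apply/polyP => j; rewrite coef_sum.
  have [/dvdnP[i ->]|pj] := boolP (p %| j)%N.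
    have [ig|gi'] := ltnP i (size g).
      rewrite (bigD1 (Ordinal ig)) //= coefZ coefXn eqxx mulr1 big1 ?addr0 // => k ki.
      rewrite coefZ coefXn eqn_pmul2r ?prime_gt0 // -val_eqE eq_sym in ki *.
      by rewrite (negPf ki) mulr0.
    rewrite nth_default; last by rewrite (leq_trans gi') // leq_pmulr // prime_gt0.
    rewrite big1 // => k _; rewrite coefZ coefXn eqn_pmul2r ?prime_gt0 //.
    by rewrite gtn_eqF ?mulr0 // (leq_trans (ltn_ord k)).
  rewrite big1 => [|k _]; last first.
    rewrite coefZ coefXn; have [jE|_] := eqVneq j (k * p)%N; last by rewrite mulr0.
    by rewrite jE dvdn_mull in pj.
  case: j pj => [|j pj]; first by rewrite dvdn0.
  have := congr1 (fun f : {poly 'F_p} => f`_j) g'0; rewrite coef_deriv coef0.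
  rewrite -mulr_natr => /eqP; rewrite mulf_eq0 => /orP[/eqP//|].
  rewrite -val_eqE /= val_Fp_nat // => /eqP j0; by rewrite /dvdn j0 in pj.
have h1 : size h != 1%N.
  by apply/eqP => /eqP /size_poly1P[c _ hc]; rewrite gE hc -rmorphXn size_polyC in g1;
     move: g1; case: (_ != 0).
have hg : h %| g by rewrite gE -{1}[h]expr1 dvdp_exp2l // prime_gt0.
have := eqp_size (gi h h1 hg); rewrite gE => sh.
have g0 : g != 0 by rewrite -size_poly_gt0 (ltn_trans _ g1).
have h0 : h != 0 by apply: contraNneq g0 => h0; rewrite gE h0 expr0n gtn_eqF ?prime_gt0.
have := size_exp h p; rewrite -sh.
have : (1 < size h)%N by rewrite sh -gE.
have := prime_gt1 p_pr; move: (size h) => [|[|k]] //= p1 _ /eqP.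
by rewrite -{1}[k.+1]muln1 eqn_pmul2l // => /eqP p1'; rewrite -p1' in p1.
Qed.

(** A common prime [g] of [f = k g] and [f'] divides [k g']. It does not divide [g'], which is
    nonzero of smaller degree, so it divides [k], and [g^2] divides [f]. *)
Lemma sqfree_coprime_deriv f : sqfree f -> coprimep f f^`().
Proof.
move=> fs; have f0 := sqfree_neq0 fs; apply/coprimepP => d df df'.
have d0 : d != 0 by apply: contraTneq df => ->; rewrite dvd0p.
rewrite -size_poly_eq1 eqn_leq size_poly_gt0 d0 andbT leqNgt; apply/negP.
move=> /irred_factor[g [gi gm gd]].
have [/dvdpP[k fE] gf'] : g %| f /\ g %| f^`() by rewrite !(dvdp_trans gd).
have gk : g %| k.
  rewrite -(Gauss_dvdpl _ (_ : coprimep _ g^`())).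
    move: gf'; rewrite fE derivM dvdp_addr //.
    exact: dvdp_mull.
  rewrite irred_coprime //; apply/negP => /(dvdp_leq (irred_deriv_neq0 gi)).
  by rewrite leqNgt lt_size_deriv // monic_neq0.
have [g1 _] := gi; have := fs g; rewrite fE expr2 dvdp_mul // leqNgt g1.
by move=> /(_ isT).
Qed.

End SeparabilityModP.

(** * Both conditions in terms of the reduction and its repeated primes *)

Section Criteria.
Variables (p : nat) (p_pr : prime p).
Local Notation Zp := (padic_int p_pr).
Local Notation fp := (map_poly (@red p p_pr)).
Variable f : {poly Zp}.
Hypotheses (f_monic : f \is monic) (f_size : (1 < size f)%N).

Let f0 : fp f != 0. Proof. by rewrite monic_neq0 // monic_map. Qed.

Lemma generates_maximal_orderE : generates_maximal_order f <->
  forall g, g \in sq_primes (fp f) -> ~ dedekind_bad f g.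
Proof.
rewrite /generates_maximal_order; split.
  move=> /(maximal_orderP f_monic f_size) fgood g /mem_sq_primes-/(_ f0)[gm gi _].
  exact: fgood.
move=> fgood; apply/(maximal_orderP f_monic f_size) => g gi gm gb.
by apply: (fgood g _ gb); apply/mem_sq_primes => //; split=> //; apply: dedekind_bad_dvd gb.
Qed.

Lemma sqf_disc_sqfree : sq_primes (fp f) = [::] -> sqf_disc f.
Proof.
move=> /(sq_primes_nil f0) fs; apply: sqf_disc_coprime => //.
exact: sqfree_coprime_deriv.
Qed.

(** In characteristic two [f = h g^2] has derivative [h' g^2], so a repeated prime yields a common
    divisor of degree at least two. *)
Lemma sqf_disc_char2 : p = 2%N -> sqf_disc f <-> sq_primes (fp f) = [::].
Proof.
move=> p2; split=> [fd|]; last exact: sqf_disc_sqfree.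
case sE : (sq_primes (fp f)) => [//|g s]; exfalso.
have /mem_sq_primes-/(_ f0)[gm [g1 _] /dvdpP[h fE]] : g \in sq_primes (fp f).
  by rewrite sE mem_head.
have two0 : 2%:R = 0 :> {poly 'F_p} by rewrite -polyC_natr -[in 2%:R]p2 pchar_Fp_0.
apply: (@not_sqf_disc_common p p_pr f f_monic f_size (g ^+ 2)) fd.
- by rewrite fE dvdp_mull.
- have -> : (fp f)^`() = h^`() * g ^+ 2 + 2%:R * (h * g * g^`()).
    by rewrite fE expr2 !derivM; ring.
  by rewrite two0 mul0r addr0 dvdp_mull.
- rewrite expr2 size_mul ?monic_neq0 //.
  by move: (size g) g1 => k; clear; lia.
Qed.

(** A repeated prime of degree at least two, two distinct repeated primes, or a triple root each
    give [f] and [f'] a common divisor of degree at least two modulo [p]. What remains is one double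
    root, settled by [sqf_disc_double]. *)
Lemma sqf_disc_odd : p != 2%N -> sqf_disc f <->
  sq_primes (fp f) = [::] \/
  double_root (fp f) /\ forall g, g \in sq_primes (fp f) -> ~ dedekind_bad f g.
Proof.
move=> p2; case sE : (sq_primes (fp f)) => [|g s].
  by split=> [_|_]; [left|apply: sqf_disc_sqfree].
have /mem_sq_primes-/(_ f0)[gm gi gf] : g \in sq_primes (fp f) by rewrite sE mem_head.
have [g1 _] := gi; have g0 := monic_neq0 gm.
have gf' := deriv_dvd gf; have gf1 : g %| fp f by apply: dvdp_trans gf; rewrite expr2 dvdp_mulr.
have nd D : D %| fp f -> D %| (fp f)^`() -> (2 < size D)%N -> ~ sqf_disc f.
  exact: not_sqf_disc_common.
have [g3|g2] := ltnP 2 (size g).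
  split=> [fd|]; first by have := nd _ gf1 gf' g3.
  by move=> [//|[]]; rewrite /double_root sE; case: (s) => [|//]; rewrite gtn_eqF.
have sg : size g = 2%N by apply/eqP; rewrite eqn_leq g2 g1.
case: s sE => [|h s] sE; last first.
  have hs : h \in sq_primes (fp f) by rewrite sE !inE eqxx orbT.
  have /mem_sq_primes-/(_ f0)[hm hi hf] := hs.
  have gh : coprimep g h.
    rewrite irred_coprime //; apply/negP => gh.
    have := sq_primes_uniq (fp f); rewrite sE /= inE.
    by rewrite (irred_dvd_monic hi hm gm g1 gh) eqxx.
  have [h1 _] := hi; have h0 := monic_neq0 hm.
  have hf' := deriv_dvd hf; have hf1 : h %| fp f by apply: dvdp_trans hf; rewrite expr2 dvdp_mulr.
  split=> [fd|[//|[]]]; last by rewrite /double_root sE.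
  exfalso; apply: (nd (g * h)) fd; rewrite ?Gauss_dvdp ?gf1 ?gf' //.
  by rewrite size_mul // sg; move: (size h) h1 => k; clear; lia.
have [g3|g3] := boolP (g ^+ 3 %| fp f).
  split=> [fd|[//|[]]]; last by rewrite /double_root sE g3 andbF.
  exfalso; apply: (nd (g ^+ 2)) fd; rewrite ?gf //.
    have /dvdpP[h ->] := g3; rewrite !exprS expr0 mulr1 !derivM.
    have -> : h^`() * (g * (g * g)) + h * (g^`() * (g * g) + g * (g^`() * g + g * g^`())) =
      (h^`() * g + h * g^`() *+ 3) * (g * g) by ring.
    exact: dvdp_mull.
  by rewrite expr2 size_mul // sg.
have [a gE] := monic_linear gm sg.
have /dvdpP[h fE] := gf; rewrite mulrC in fE.
have gh : ~~ (g %| h) by apply: contra g3 => gh; rewrite fE exprSr dvdp_mul.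
have h0 : h != 0 by apply: contraNneq gh => ->; rewrite dvdp0.
have hs : sqfree h.
  apply/(sq_primes_nil h0); have := sq_primes_mul_pow gi gm h0 gh (erefl : (1 < 2)%N).
  by rewrite -fE sE => /perm_size /=; case: (sq_primes h).
have F2 : (2%:R : 'F_p) != 0.
  by rewrite -(dvdn_pcharf (pchar_Fp p_pr)) dvdn_prime2.
(* Modulo [g] the second argument is [2 h], a unit because [p] is odd; modulo [h] it is [g h'], a
   unit because [h] is squarefree. *)
have cop : coprimep (g * h) (2%:R *: h + g * h^`()).
  rewrite coprimepMl -mul_polyC; apply/andP; split.
    rewrite addrC [g * _]mulrC coprimep_addl_mul irred_coprime //.
    by rewrite mul_polyC dvdpZr.
  have cgh : coprimep g h by rewrite irred_coprime.
  rewrite coprimep_addl_mul coprimepMr [coprimep h g]coprimep_sym cgh.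
  exact: sqfree_coprime_deriv.
rewrite gE in fE cop; rewrite (sqf_disc_double f_monic f_size fE cop) -gE.
split=> [gb|[//|[_]]]; last by apply; rewrite mem_head.
right; split; first by rewrite /double_root sE sg eqxx g3.
by move=> h'; rewrite inE => /eqP->.
Qed.

End Criteria.

(** * Free coefficients as coordinates *)

Section CoefficientSpace.
Variable m : nat.
Local Notation n := m.+2.

Definition tail (A : nzRingType) (a : 'rV[A]_m.+1) : {poly A} :=
  \sum_(i < m.+1) a 0 i *: 'X^(n - 2 - i).

(** The coordinates list coefficients by decreasing powers, [rVpoly] by increasing ones. *)
Definition rev_row (A : Type) (a : 'rV[A]_m.+1) : 'rV[A]_m.+1 := \row_i a 0 (rev_ord i).

Lemma rev_rowK (A : Type) : involutive (@rev_row A).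
Proof. by move=> a; apply/rowP => i; rewrite !mxE rev_ordK. Qed.

Lemma tail_rV (A : nzRingType) (a : 'rV[A]_m.+1) : tail a = rVpoly (rev_row a).
Proof.
rewrite /rVpoly poly_def /tail (reindex_inj rev_ord_inj); apply: eq_bigr => i _ /=.
rewrite valK mxE; congr (_ *: 'X^_).
by have := ltn_ord i; rewrite subSS; lia.
Qed.

Definition head (A : nzRingType) (b : A) : {poly A} := 'X^n + b *: 'X^(m.+1).

Lemma size_tail (A : nzRingType) (a : 'rV[A]_m.+1) : (size (tail a) <= m.+1)%N.
Proof. by rewrite tail_rV size_poly. Qed.

Lemma head_tail (A : nzRingType) (b : A) (r : {poly A}) : (size r <= m.+1)%N ->
  [/\ head b + r \is monic, size (head b + r) = n.+1, (head b + r)`_m.+1 = b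
    & (head b + r)`_0 = r`_0].
Proof.
move=> rm.
have sb : (size (b *: 'X^(m.+1) + r)%R < n.+1)%N.
  apply: leq_ltn_trans (size_polyD _ _) _; rewrite gtn_max [(size r < _)%N](leq_ltn_trans rm) ?andbT //.
  by apply: leq_ltn_trans (size_scale_leq _ _) _; rewrite size_polyXn.
split.
- by rewrite -addrA monicE lead_coefDl ?size_polyXn // lead_coefXn.
- by rewrite -addrA size_polyDl size_polyXn.
- rewrite !coefD coefZ !coefXn eqxx mulr1 ltn_eqF // add0r nth_default ?addr0 //.
- by rewrite !coefD coefZ !coefXn mulr0 !add0r.
Qed.

Lemma map_tail (A B : nzRingType) (h : {rmorphism A -> B}) (a : 'rV[A]_m.+1) :
  map_poly h (tail a) = tail (map_mx h a).
Proof.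
rewrite /tail rmorph_sum; apply: eq_bigr => i _ /=.
by rewrite map_polyZ map_polyXn mxE.
Qed.

Lemma map_head (A B : nzRingType) (h : {rmorphism A -> B}) (b : A) :
  map_poly h (head b) = head (h b).
Proof. by rewrite rmorphD /= map_polyZ !map_polyXn. Qed.

Lemma big_tail (A : finFieldType) (V : nmodType) (E : {poly A} -> V) :
  \sum_(a : 'rV[A]_m.+1) E (tail a) = \sum_(r <- polys_lt A m.+1) E r.
Proof.
rewrite /polys_lt big_map big_enum /= (reindex_inj (inv_inj (@rev_rowK A))).
by apply: eq_bigr => a _; rewrite tail_rV rev_rowK.
Qed.

Lemma big_head_tail (A : finFieldType) (V : nmodType) (b : A) (P : pred {poly A})
    (E : {poly A} -> V) :
  \sum_(f <- monics A n | (f.[0] != 0) && (subl f == b) && P f) E f =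
  \sum_(r <- polys_lt A m.+1 | (r`_0 != 0) && P (head b + r)) E (head b + r).
Proof.
rewrite (@big_seq_bij _ _ _ (polys_lt A m.+1) _
  (fun r => (r`_0 != 0) && P (head b + r)) _ (+%R (head b))) ?monics_uniq ?polys_lt_uniq //.
- by move=> r r' _ _; apply: addrI.
- move=> r; rewrite mem_polys_lt => rm /andP[r0 Pr].
  have [fm sf fb f0] := head_tail b rm.
  by rewrite Pr mem_monics fm sf eqxx (sublE sf) fb eqxx horner_coef0 f0 r0.
- move=> f /monicsP[fm sf] /andP[/andP[f0 /eqP fb] Pf].
  have rm : (size (f - head b)%R <= m.+1)%N.
    apply/leq_sizeP => i mi; rewrite /head coefB coefD coefZ !coefXn.
    move: mi; rewrite leq_eqVlt => /orP[/eqP<-|mi].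
      by rewrite eqxx ltn_eqF // mulr1 add0r -(sublE sf) fb subrr.
    rewrite [i == m.+1]gtn_eqF // mulr0 addr0.
    move: mi; rewrite leq_eqVlt => /orP[/eqP<-|mi].
      by have /monicP := fm; rewrite lead_coefE sf eqxx => ->; rewrite subrr.
    by rewrite gtn_eqF // subr0 nth_default // sf.
  have fE : head b + (f - head b) = f by rewrite addrC subrK.
  exists (f - head b); rewrite fE mem_polys_lt rm Pf; split=> //.
  by have [_ _ _] := head_tail b rm; rewrite fE andbT => <-; rewrite -horner_coef0.
Qed.

End CoefficientSpace.

(** * Total degree of the repeated primes *)

Section PrimeFactorSizes.
Variable F : finFieldType.
Implicit Types f g : {poly F}.

Lemma prod_sq_dvd f (s : seq {poly F}) : uniq s ->
  (forall g, g \in s -> [/\ g \is monic, irreducible_poly g & g ^+ 2 %| f]) ->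
  (\prod_(g <- s) g) ^+ 2 %| f.
Proof.
elim: s => [|g s IH] /=; first by move=> _ _; rewrite big_nil expr1n dvd1p.
move=> /andP[gs us] sP; rewrite big_cons exprMn.
have [gm gi gf] := sP g (mem_head _ _).
have {}sP h : h \in s -> [/\ h \is monic, irreducible_poly h & h ^+ 2 %| f].
  by move=> hs; apply: sP; rewrite inE hs orbT.
rewrite Gauss_dvdp ?gf ?IH // coprimep_expl // coprimep_expr //.
rewrite big_seq; elim/big_ind: _ => [|a b ga gb|h hs].
- by rewrite coprimep1.
- by rewrite coprimepMr ga gb.
have [hm hi _] := sP h hs; rewrite irred_coprime //; apply: contra gs => gh.
by rewrite (irred_dvd_monic hi hm gm _ gh) //; case: gi.
Qed.

(** The square of the product of the repeated primes divides [f]. Since [n / 2 <= n - 1], this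
    supplies the degree hypothesis of [crt_count]. *)
Lemma sum_deg_sq_primes f n : f \is monic -> size f = n.+1 ->
  (\sum_(g <- sq_primes f) (size g).-1 <= n./2)%N.
Proof.
move=> fm sf; have f0 := monic_neq0 fm.
have sP g : g \in sq_primes f -> [/\ g \is monic, irreducible_poly g & g ^+ 2 %| f].
  by move=> /(mem_sq_primes _ f0).
have Pm : \prod_(g <- sq_primes f) g \is monic.
  by rewrite big_seq monic_prod // => g /sP[].
have -> : (\sum_(g <- sq_primes f) (size g).-1 = (size (\prod_(g <- sq_primes f) g)%R).-1)%N.
  have : forall g, g \in sq_primes f -> g \is monic by move=> g /sP[].
  elim: (sq_primes f) => [|g s IH] sm; first by rewrite !big_nil size_poly1.
  have smS h : h \in s -> h \is monic by move=> hs; apply: sm; rewrite inE hs orbT.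
  have {}IH := IH smS.
  have Ps : \prod_(h <- s) h \is monic by rewrite big_seq monic_prod.
  by rewrite !big_cons size_monic_mulD ?IH //; apply: sm; exact: mem_head.
have := prod_sq_dvd (sq_primes_uniq f) sP; set P := \prod_(_ <- _) _ in Pm *.
move=> /(dvdp_leq f0); rewrite sf -ltnS => Pf.
have := size_monic_mulD Pm Pm; rewrite geq_half_double -addnn => <-.
by move: Pf; rewrite expr2; case: (size _) => [|k].
Qed.

End PrimeFactorSizes.

(** * Densities as weighted counts over ['F_p] *)

Section DensityFormula.
Variables (p : nat) (p_pr : prime p) (m : nat).
Local Notation Zp := (padic_int p_pr).
Local Notation fp := (map_poly (@red p p_pr)).
Local Notation rd := (@red p p_pr).
Local Notation n := m.+2.
Variables (R : realType) (mu : probability (borel_space p_pr n.-1) R).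
Hypothesis mu_haar : is_haar mu.
Variable b : Zp.
Local Notation q := (p%:R : R).
Local Notation hd := (head m b).
Local Notation hb := (head m (rd b)).

(** The condition is membership in an ideal that contains [p^2]. *)
Lemma dedekind_bad_cong2 f K g :
  dedekind_bad (f + p%:R ^+ 2 * K : {poly Zp}) g <-> dedekind_bad f g.
Proof.
have imp f' K' : dedekind_bad (f' : {poly Zp}) g -> dedekind_bad (f' + p%:R ^+ 2 * K') g.
  move=> /dedekind_badE[C [H [L ->]]]; apply/dedekind_badE; exists C, H, (L + K').
  by ring.
split=> [/(imp _ (- K))|/imp//]; rewrite -addrA -mulrDr subrr mulr0 addr0 //.
Qed.

Lemma tail_lin (a z : 'rV[Zp]_m.+1) k : tail (a + p%:R ^+ k *: z) =
  tail a + p%:R ^+ k * tail z.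
Proof.
rewrite /tail mulr_sumr -big_split; apply: eq_bigr => i _ /=.
have pkE : p%:R ^+ k = (p%:R ^+ k : Zp)%:P by rewrite rmorphXn /= polyC_natr.
by rewrite !mxE scalerDl -scalerA pkE mul_polyC.
Qed.

Lemma fp_head_tail (a : 'rV[Zp]_m.+1) : fp (hd + tail a) = hb + tail (map_mx rd a).
Proof. by rewrite rmorphD /= map_head map_tail. Qed.

Lemma fp_of_digits (u r : 'rV['F_p]_m.+1) :
  fp (hd + tail (of_digits p_pr (u, r))) = hb + tail u.
Proof.
rewrite fp_head_tail; congr (_ + tail _); apply/rowP => i.
by rewrite !mxE rmorphD rmorphM /= red_p mul0r addr0 liftK.
Qed.

Lemma V_fixed_head_tail (a : 'rV[Zp]_m.+1) :
  V_fixed n b (hd + tail a) <-> (tail (map_mx rd a))`_0 != 0.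
Proof.
have [fm sf fb f0] := head_tail b (size_tail a).
rewrite -map_tail coef_map /= -f0; split=> [[_ _ _ nd]|nd].
  by apply/eqP => /red_eq0[y fy]; apply: nd; exists y.
by split=> // -[y fy]; move/eqP: nd; apply; apply/red_eq0; exists y.
Qed.

Variables (P : set {poly Zp}) (sel : pred {poly 'F_p}).
Hypothesis PE : forall f, f \is monic -> size f = n.+1 -> P f <->
  sel (fp f) /\ forall g, g \in sq_primes (fp f) -> ~ dedekind_bad f g.

Let A0 : set 'rV[Zp]_m.+1 := [set a | V_fixed n b (hd + tail a)].
Let A1 : set 'rV[Zp]_m.+1 := [set a | (V_fixed n b `&` P) (hd + tail a)].

Let map_red_cong2 (a a' : 'rV[Zp]_m.+1) : cong2 a a' -> map_mx rd a = map_mx rd a'.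
Proof.
move=> /cong2P[z ->]; apply/rowP => i.
by rewrite !mxE rmorphD rmorphM rmorphXn /= red_p ?expr0n ?mul0r addr0.
Qed.

Let A0_cong2 : cong2_closed A0.
Proof.
by move=> a a' aa' /V_fixed_head_tail A0a; apply/V_fixed_head_tail; rewrite -(map_red_cong2 aa').
Qed.

Let A1_cong2 : cong2_closed A1.
Proof.
move=> a a' aa' [Va Pa]; split; first exact: (A0_cong2 aa').
have [fm sf _ _] := head_tail b (size_tail a).
have [fm' sf' _ _] := head_tail b (size_tail a').
have [sela ba] := (PE fm sf).1 Pa; apply/(PE fm' sf').
have fpE : fp (hd + tail a') = fp (hd + tail a).
  by rewrite !fp_head_tail (map_red_cong2 aa').
rewrite fpE; split=> // g /ba; have /cong2P[z ->] := aa'.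
by rewrite tail_lin addrA dedekind_bad_cong2.
Qed.

Let count_digits (A : set 'rV[Zp]_m.+1) (c : {poly 'F_p} -> R) :
  (forall u : 'rV['F_p]_m.+1,
     \sum_r (`[< A (of_digits p_pr (u, r)) >])%:R = q ^+ m.+1 * c (tail u)) ->
  #|[pred x | `[< A (of_digits p_pr x) >]]|%:R =
    q ^+ m.+1 * \sum_(r <- polys_lt 'F_p m.+1) c r.
Proof.
move=> Ac; rewrite -sum1_card natr_sum big_mkcond /=.
rewrite -big_tail mulr_sumr (eq_bigr _ (fun u _ => esym (Ac u))) pair_big /=.
by apply: eq_bigr => -[u r] _ /=; rewrite inE /=; case: (asbool _).
Qed.

Let map_of_digits (u r : 'rV['F_p]_m.+1) : map_mx rd (of_digits p_pr (u, r)) = u.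
Proof.
apply/rowP => i; by rewrite !mxE rmorphD rmorphM /= red_p mul0r addr0 liftK.
Qed.

Let count0 : #|[pred x | `[< A0 (of_digits p_pr x) >]]|%:R =
  q ^+ m.+1 * (q ^+ m * (q - 1)).
Proof.
rewrite (count_digits (c := fun r => if r`_0 != 0 then 1 else 0)) => [|u].
  congr (_ * _); rewrite -big_mkcond /= -[RHS](_ : adm_card R m.+2 (rd b) = _); last first.
    by rewrite adm_cardSS card_Fp.
  transitivity (\sum_(f <- monics 'F_p m.+2 | (f.[0] != 0) && (subl f == rd b) && predT f) (1 : R)).
    by rewrite big_head_tail; apply: eq_bigl => r; rewrite andbT.
  by apply: eq_bigl => f; rewrite andbT.
have A0E r : `[< A0 (of_digits p_pr (u, r)) >] = ((tail u)`_0 != 0).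
  by apply/asboolP/idP => [/V_fixed_head_tail|u0]; [|apply/V_fixed_head_tail]; rewrite map_of_digits.
rewrite (eq_bigr _ (fun r _ => congr1 (fun c : bool => c%:R) (A0E r))) sumr_const card_mx mul1n card_Fp //.
by rewrite -natrX; case: ifP => _; rewrite ?mulr1 ?mulr0 ?mul0rn.
Qed.

(** If the polynomial with digits [(u, 0)] is [G^2 a + p e], the second digits [r] replace [e] by
    [e + r], so the bad class modulo [g] is that of [- e]. *)
Let bad_digits (u : 'rV['F_p]_m.+1) : exists rho : {poly 'F_p} -> {poly 'F_p},
  forall g, g \in sq_primes (hb + tail u) -> forall r,
    dedekind_bad (hd + tail (of_digits p_pr (u, r))) g <-> g %| tail r - rho g.
Proof.
pose fu := hd + tail (map_mx (@lift p p_pr) u).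
have fuE : fp fu = hb + tail u.
  rewrite fp_head_tail; congr (_ + tail _); apply/rowP => i; by rewrite !mxE liftK.
have [um us _ _] := head_tail (rd b) (size_tail u); have u0 := monic_neq0 um.
have /choice[rho rhoP] : forall g, exists rho, g \in sq_primes (hb + tail u) -> forall r,
    dedekind_bad (hd + tail (of_digits p_pr (u, r))) g <-> g %| tail r - rho.
  move=> g; have [gu|] := boolP (g \in sq_primes (hb + tail u)); last by exists 0.
  have /mem_sq_primes-/(_ u0)[gm gi gf] := gu.
  have [|a [e fuD]] := @redp_dvd p p_pr fu (liftp p_pr g ^+ 2).
    by rewrite fuE rmorphXn /= liftpK.
  exists (- fp e) => _ r; rewrite opprK /of_digits /= -[p%:R]expr1 tail_lin expr1 addrA -/fu.
  rewrite fuD -addrA -mulrDr dedekind_bad_dvdE ?monic_neq0 //.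
  rewrite rmorphD /= map_tail addrC (_ : map_mx rd _ = r) //.
  by apply/rowP => i; rewrite !mxE liftK.
by exists rho.
Qed.

Let count1 : #|[pred x | `[< A1 (of_digits p_pr x) >]]|%:R =
  q ^+ m.+1 * \sum_(f <- monics 'F_p n | adm (rd b) f && sel f) wt (q^-1) f.
Proof.
rewrite (count_digits (c := fun r => if (r`_0 != 0) && sel (hb + r)
  then wt q^-1 (hb + r) else 0)) => [|u].
  by rewrite -big_mkcond /= -(@big_head_tail m 'F_p _ (rd b) sel (fun f => wt q^-1 f)).
have [rho rhoP] := bad_digits u.
have [um us _ _] := head_tail (rd b) (size_tail u); have u0 := monic_neq0 um.
have A1E r : `[< A1 (of_digits p_pr (u, r)) >] = ((tail u)`_0 != 0) && sel (hb + tail u) &&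
    all (fun g => ~~ (g %| tail r - rho g)) (sq_primes (hb + tail u)).
  have [fm sf _ _] := head_tail b (size_tail (of_digits p_pr (u, r))).
  apply/asboolP/idP => [[/V_fixed_head_tail V0 /(PE fm sf)]|].
    rewrite fp_of_digits => -[-> gP]; rewrite map_of_digits in V0; rewrite V0 /=.
    by apply/allP => g gs; apply/negP => /(rhoP g gs r); apply: gP.
  move=> /andP[/andP[V0 su] /allP gP]; split.
    by apply/V_fixed_head_tail; rewrite map_of_digits.
  apply/(PE fm sf); rewrite fp_of_digits; split=> // g gs /(rhoP g gs r).
  by apply/negP/gP.
rewrite (eq_bigr _ (fun r _ => congr1 (fun c : bool => c%:R) (A1E r))).
case: ifP => _ /=; last by rewrite big1 ?mulr0.
rewrite (@big_tail m _ _ (fun r => (all (fun g => ~~ (g %| r - rho g)) (sq_primes (hb + tail u)))%:R)).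
transitivity (\sum_(r <- polys_lt 'F_p m.+1 |
    all (fun g => ~~ (g %| r - rho g)) (sq_primes (hb + tail u))) (1 : R)).
  by rewrite [RHS]big_mkcond; apply: eq_bigr => r _; case: all.
rewrite crt_count ?sq_primes_uniq ?card_Fp //.
- by move=> g /mem_sq_primes-/(_ u0)[].
- by apply: leq_trans (sum_deg_sq_primes um us) _; lia.
Qed.

(** [sel] holds the condition on the reduction: none for maximality, squarefree for [p = 2],
    squarefree or with one double root for odd [p]. The number [q^(n - 1)] of second digit vectors
    cancels between numerator and denominator. *)
Lemma density_formula : density b mu P =
  (\sum_(f <- monics 'F_p n | adm (rd b) f && sel f) wt (q^-1) f) / (q ^+ m * (q - 1)).
Proof.
rewrite /density /=.
rewrite [X in X / _](_ : _ = #|[pred x | `[< A1 (of_digits p_pr x) >]]|%:R / (p ^ m.+1)%:R ^+ 2); last first.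
  exact: (haar_count mu_haar A1_cong2).
rewrite [X in _ / X](_ : _ = #|[pred x | `[< A0 (of_digits p_pr x) >]]|%:R / (p ^ m.+1)%:R ^+ 2); last first.
  exact: (haar_count mu_haar A0_cong2).
have q0 : q != 0 by rewrite pnatr_eq0 -lt0n prime_gt0.
have q1 : q - 1 != 0.
  by rewrite subr_eq0 (eqr_nat R p 1) gtn_eqF // prime_gt1.
rewrite count0 count1 natrX; field.
by rewrite q1 !expf_neq0.
Qed.

End DensityFormula.

(** * Solving the recurrences *)

Section ClosedForms.
Variables (F : finFieldType) (R : realFieldType).
Local Notation q := (#|F|%:R : R).
Local Notation s := (q ^+ 2 + q + 1).

Let q1 : 1 < q. Proof. exact: q_gt1. Qed.
Let q0 : q != 0. Proof. by rewrite gt_eqF // (lt_trans _ q1). Qed.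
Let s0 : s != 0. Proof. have := q1; rewrite lt0r_neq0 //; nra. Qed.
Let qD0 : q + 1 != 0. Proof. have := q1; rewrite lt0r_neq0 //; lra. Qed.

(** A function constant off [0] is determined by its sum and its jump at [0]. *)
Lemma mul_card_of_diff (V : F -> R) d : (forall b, b != 0 -> V 0 - V b = d) ->
  forall b, q * V b = \sum_c V c + (if b == 0 then q - 1 else -1) * d.
Proof.
move=> dE.
have V0 : q * V 0 = \sum_c V c + (q - 1) * d.
  rewrite (bigD1 0) //= (eq_bigr (fun _ => V 0 - d)) => [|b b0]; last first.
    by rewrite -(dE b b0); ring.
  have -> : \sum_(b : F | b != 0) (V 0 - d) = (q - 1) * (V 0 - d).
    rewrite sumr_const -[LHS]mulr_natl; congr (_ * _).
    by rewrite cardC1 -subn1 natrB // ltnW // card_finNzRing_gt1.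
  by ring.
move=> b; have [->|b0] := eqVneq b 0; first exact: V0.
by rewrite (_ : V b = V 0 - d) ?mulrBr ?V0 -?(dE b b0); ring.
Qed.

(** The multiple of [q^(n + 1)] is the particular solution of the inhomogeneous recurrence. The
    homogeneous part advances by steps of two, hence the dependence on parity; the totals in degrees
    one and two fix its constants. *)
Lemma tot_invE n : tot F q^-1 n.+1 = (q ^+ 2 - 1) / s * q ^+ n.+1 +
  q^-1 ^+ n./2 * (if odd n then - ((q ^+ 2 - 1) / (q * s)) else (q - 1) / s).
Proof.
have [_ t1 t2 tS] := tot_rec F q^-1.
suff [] : tot F q^-1 n.+1 = (q ^+ 2 - 1) / s * q ^+ n.+1 +
  q^-1 ^+ n./2 * (if odd n then - ((q ^+ 2 - 1) / (q * s)) else (q - 1) / s) /\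
  tot F q^-1 n.+2 = (q ^+ 2 - 1) / s * q ^+ n.+2 +
  q^-1 ^+ n.+1./2 * (if odd n.+1 then - ((q ^+ 2 - 1) / (q * s)) else (q - 1) / s) by [].
elim: n => [|n [IH1 IH2]]; first by rewrite t1 t2 /=; split; field; rewrite q0 s0.
split=> //; rewrite tS IH1 /= negbK !exprS.
by case: odd; field; rewrite ?q0 ?s0.
Qed.

Lemma tot_1E n : tot F (1 : R) n.+1 = (q - 1) / (q + 1) * (q ^+ n.+1 - (-1) ^+ n.+1).
Proof.
have [_ t1 t2 tS] := tot_rec F (1 : R).
suff [] : tot F (1 : R) n.+1 = (q - 1) / (q + 1) * (q ^+ n.+1 - (-1) ^+ n.+1) /\
  tot F (1 : R) n.+2 = (q - 1) / (q + 1) * (q ^+ n.+2 - (-1) ^+ n.+2) by [].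
elim: n => [|n [IH1 IH2]]; first by rewrite t1 t2; split; field.
by split=> //; rewrite tS IH1 !exprS; field.
Qed.

(** In characteristic two the initial value is [(1 - q) x], which is [- x] exactly for [q = 2]. *)
Lemma diffE x n (b : F) : b != 0 -> ((2%:R : F) = 0 -> #|F| = 2%N) ->
  diff (x : R) n.+2 b =
    (if (2%:R : F) == 0 then -1 else 1) * ((-1) ^+ n * x ^+ n.+2./2).
Proof.
move=> b0 F2; have [F20|F20] := eqVneq (2%:R : F) 0.
  have [_ _ d2 d3 dS] := diff_char2 x F20 b0.
  suff [] : diff x n.+2 b = -1 * ((-1) ^+ n * x ^+ n.+2./2) /\
    diff x n.+3 b = -1 * ((-1) ^+ n.+1 * x ^+ n.+3./2) by [].
  elim: n => [|n [IH1 IH2]]; first by rewrite d2 d3 (F2 F20) /=; split; ring.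
  by split=> //; rewrite dS IH1 /= !exprS; ring.
have [d0 d1 dS] := diff_odd x F20 b0.
suff [] : diff x n.+2 b = 1 * ((-1) ^+ n * x ^+ n.+2./2) /\
  diff x n.+3 b = 1 * ((-1) ^+ n.+1 * x ^+ n.+3./2) by [].
elim: n => [|n [IH1 IH2]]; first by rewrite !dS d0 d1 /=; split; ring.
by split=> //; rewrite dS IH1 /= !exprS; ring.
Qed.

(** The series of the totals at [x = 1] has a simple pole at [t = -1], which the factor
    [1 / (1 + t)] of the sieve doubles. This produces the term linear in [m], and with it the factor
    [n] in the error for odd [p]. *)
Lemma sum_double_cardE m : \sum_b double_card R m.+2 (b : F) =
  (q - 1) * ((q - 1) / (q + 1) ^+ 2 * q ^+ m.+1 +
    (-1) ^+ m * (1 + (q - 1) / (q + 1) ^+ 2 - (q - 1) / (q + 1) * m.+1%:R)).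
Proof.
rewrite (eq_bigr (@shift_wt F R m 2)) => [|b _]; last by rewrite double_card_avoid.
have [U [U0 US ->]] := shift_wt_tot F R m 2; congr (_ * _).
have [t0 _ _ _] := tot_rec F (1 : R).
elim: m => [|m IH]; first by rewrite U0 t0; field.
rewrite US tot_1E IH !exprS -[m.+2]addn1 natrD; field.
by rewrite qD0.
Qed.

Lemma double_card_diff m (b : F) : (2%:R : F) != 0 -> b != 0 ->
  double_card R m.+2 (0 : F) - double_card R m.+2 b =
  (-1) ^+ m * \sum_(j < m.+1) (if ((2 + j)%:R : F) == 0 then q - 1 else -1).
Proof. by move=> F2 b0; rewrite !double_card_avoid -(shift_wt_diff R m 2 F2 b0). Qed.

End ClosedForms.

(** Each of the indices [2, ..., m + 2] contributes [-1], and each multiple of [p] among them an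
    additional [p]. *)
Lemma sum_shift_sign (R : realFieldType) p m : (2 < p)%N -> prime p ->
  \sum_(j < m.+1) (if ((2 + j)%:R : 'F_p) == 0 then p%:R - 1 else -1) =
  1 - (m.+2 %% p)%:R :> R.
Proof.
move=> p2 p_pr; have natr_eq0 k : ((k%:R : 'F_p) == 0) = (p %| k)%N.
  by rewrite -(dvdn_pcharf (pchar_Fp p_pr)).
elim: m => [|m IH].
  by rewrite big_ord1 natr_eq0 addn0 gtnNdvd // modn_small //; ring.
rewrite big_ord_recr /= IH natr_eq0 add2n (modnS m.+2 p); case: ifP => pm; last first.
  by rewrite -[(m.+2 %% p).+1]addn1 natrD; ring.
have -> : (m.+2 %% p)%N = p.-1.
  have rp := ltn_pmod m.+2 (prime_gt0 p_pr).
  move: pm; rewrite [in m.+3](divn_eq m.+2 p) -addnS dvdn_addr ?dvdn_mull // => pr.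
  by have := dvdn_leq (ltn0Sn _) pr; move: (m.+2 %% p)%N rp => r; clear; lia.
by rewrite -subn1 natrB ?prime_gt0 //; ring.
Qed.

(** * Exact formulas for the densities *)

Section Densities.
Variables (p : nat) (p_pr : prime p) (m : nat).
Local Notation Zp := (padic_int p_pr).
Local Notation rd := (@red p p_pr).
Local Notation n := m.+2.
Variables (R : realType) (mu : probability (borel_space p_pr n.-1) R).
Hypothesis mu_haar : is_haar mu.
Variable b : Zp.
Local Notation q := (p%:R : R).
Local Notation eps := (if rd b == 0 then q - 1 else -1).

Let Fp_card : #|'F_p|%:R = q :> R.
Proof. by rewrite card_Fp. Qed.

Lemma density_max : density b mu (@generates_maximal_order p p_pr) =
  adm_wt q^-1 n (rd b) / (q ^+ m * (q - 1)).
Proof.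
rewrite (density_formula mu_haar b (sel := predT)) => [|f fm sf].
  by congr (_ / _); apply: eq_bigl => f; rewrite andbT.
rewrite generates_maximal_orderE ?sf //.
by split=> [|[]].
Qed.

Lemma density_sqf2 : p = 2%N ->
  density b mu (@sqf_disc p p_pr) = adm_wt 1 n (rd b) / (q ^+ m * (q - 1)).
Proof.
move=> p2; rewrite (density_formula mu_haar b (sel := fun f => sq_primes f == [::])).
  congr (_ / _); rewrite /adm_wt big_mkcondr; apply: eq_bigr => f _; rewrite wt1.
  by case: eqP => // fs; rewrite /wt fs big_nil.
move=> f fm sf; rewrite sqf_disc_char2 ?sf //.
by split=> [->|[/eqP]].
Qed.

Lemma density_sqf_odd : p != 2%N ->
  density b mu (@sqf_disc p p_pr) =
  (adm_wt 1 n (rd b) + (1 - q^-1) * double_card R n (rd b)) / (q ^+ m * (q - 1)).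
Proof.
move=> p2; rewrite (density_formula mu_haar b
  (sel := fun f => (sq_primes f == [::]) || double_root f)).
  congr (_ / _); rewrite /adm_wt [double_card _ _ _]big_mkcondr big_mkcondr mulr_sumr -big_split.
  apply: eq_bigr => f _ /=; rewrite wt1 /double_root /wt.
  case: (sq_primes f) => [|g [|h s]] /=; rewrite ?big_nil ?mulr0 ?addr0 //.
  rewrite big_seq1; case: ifP => [/andP[/eqP-> _]|_]; by rewrite ?expr1 add0r ?mulr1 ?mulr0.
move=> f fm sf; rewrite sqf_disc_odd ?sf //; split=> [[fs|[fd fg]]|].
- by rewrite fs.
- by rewrite fd orbT.
- by case=> /orP[/eqP->|fd fg]; [left|right].
Qed.

Lemma density_of_diff (V : 'F_p -> R) d : (forall c, c != 0 -> V 0 - V c = d) ->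
  V (rd b) / (q ^+ m * (q - 1)) = (\sum_c V c + eps * d) / (q ^+ m.+1 * (q - 1)).
Proof.
move=> /mul_card_of_diff/(_ (rd b)); rewrite Fp_card => <-.
have q0 : q != 0 by rewrite pnatr_eq0 -lt0n prime_gt0.
by rewrite exprS -mulrA -mulf_div divff // mul1r.
Qed.

Let natr2_eq0 : ((2%:R : 'F_p) == 0) = (p == 2%N).
Proof. by rewrite -(dvdn_pcharf (pchar_Fp p_pr)) dvdn_prime2. Qed.

Let pchar2 : (2%:R : 'F_p) = 0 -> #|'F_p| = 2%N.
Proof.
by rewrite card_Fp // => /eqP; rewrite natr2_eq0 => /eqP.
Qed.

Lemma density_maxE : density b mu (@generates_maximal_order p p_pr) =
  (tot 'F_p q^-1 n + eps * ((if p == 2%N then -1 else 1) * ((-1) ^+ m * q^-1 ^+ n./2))) /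
  (q ^+ m.+1 * (q - 1)).
Proof.
rewrite density_max (density_of_diff (V := adm_wt q^-1 n)
  (d := (if p == 2%N then -1 else 1) * ((-1) ^+ m * q^-1 ^+ n./2))) // => c c0.
by rewrite -[LHS]/(diff q^-1 n c) diffE // natr2_eq0.
Qed.

Lemma density_sqf2E : p = 2%N -> density b mu (@sqf_disc p p_pr) =
  (tot 'F_p 1 n + eps * - (-1) ^+ m) / (q ^+ m.+1 * (q - 1)).
Proof.
move=> p2; rewrite density_sqf2 // (density_of_diff (V := adm_wt 1 n) (d := - (-1) ^+ m)) // => c c0.
by rewrite -[LHS]/(diff 1 n c) diffE // natr2_eq0 p2 eqxx expr1n mulr1 mulN1r.
Qed.

Lemma density_sqf_oddE : p != 2%N -> density b mu (@sqf_disc p p_pr) =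
  (tot 'F_p 1 n + (1 - q^-1) * (\sum_c double_card R n (c : 'F_p)) +
   eps * ((-1) ^+ m * (1 + (1 - q^-1) * (1 - (n %% p)%:R)))) / (q ^+ m.+1 * (q - 1)).
Proof.
move=> p2; have F2 : (2%:R : 'F_p) != 0 by rewrite natr2_eq0.
rewrite density_sqf_odd //; set d := _ * (1 + _).
rewrite (density_of_diff (V := fun c => adm_wt 1 n c + (1 - q^-1) * double_card R n c) (d := d)).
  by rewrite big_split mulr_sumr.
move=> c c0; have := double_card_diff R m F2 c0; rewrite Fp_card sum_shift_sign //; last first.
  by rewrite ltn_neqAle eq_sym p2 prime_gt1.
have := diffE (1 : R) m c0 pchar2; rewrite (negPf F2) expr1n !mulr1 mul1r /diff => wd cd.
rewrite /d mulrDr mulr1 mulrCA -cd -wd; ring.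
Qed.

End Densities.

(** * Error bounds, positivity and dependence on [b] *)

Section Estimates.
Variables (p : nat) (p_pr : prime p) (m : nat).
Local Notation Zp := (padic_int p_pr).
Local Notation rd := (@red p p_pr).
Local Notation n := m.+2.
Variables (R : realType) (mu : probability (borel_space p_pr n.-1) R).
Hypothesis mu_haar : is_haar mu.
Local Notation q := (p%:R : R).
Local Notation eps b := (if rd b == 0 then q - 1 else -1).
Local Notation K := (q ^+ m.+1 * (q - 1)).

Let q2 : 2 <= q.
Proof. by rewrite ler_nat prime_gt1. Qed.

Let q0 : q != 0. Proof. by apply: lt0r_neq0; have := q2; lra. Qed.

Let q3 : p != 2%N -> 3 <= q.
Proof. by move=> p2; rewrite ler_nat ltn_neqAle eq_sym p2 prime_gt1. Qed.

Let q1 : q - 1 != 0. Proof. by apply: lt0r_neq0; have := q2; lra. Qed.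

Let pow_gt0 k : 0 < q ^+ k. Proof. by rewrite exprn_gt0 //; have := q2; lra. Qed.

Let K_gt0 : 0 < K.
Proof. by rewrite mulr_gt0 //; have := q2; lra. Qed.

Let Fp_card : #|'F_p|%:R = q :> R. Proof. by rewrite card_Fp. Qed.

Let eps_le (b : Zp) : `|eps b| <= q - 1.
Proof. by have q2' := q2; case: ifP => _; rewrite ?normrN1 ?ger0_norm //; lra. Qed.

Lemma ratio_bound (M T B : R) : `|T - M * K| <= B -> `|T / K - M| <= B / K.
Proof.
move=> TB; have -> : T / K - M = (T - M * K) / K by rewrite mulrBl mulfK // lt0r_neq0.
by rewrite normrM normfV (gtr0_norm K_gt0) ler_pM2r ?invr_gt0.
Qed.

(** The two values of [eps] differ by [q], so a nonzero [d] separates units from nonunits. *)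
Lemma eq_iff_unit (T d : R) (b b' : Zp) : d != 0 ->
  (T + eps b * d) / K = (T + eps b' * d) / K <->
  (b \is a GRing.unit) = (b' \is a GRing.unit).
Proof.
move=> d0; rewrite !padic_unitE; split=> [|/negb_inj-> //].
move=> /(mulIf (invr_neq0 (lt0r_neq0 K_gt0))) /addrI /(mulIf d0).
by have := q2; do 2!case: ifP => //= _; lra.
Qed.

Let inv_half : q^-1 ^+ n./2 <= q^-1.
Proof.
rewrite /= -[leRHS]expr1; apply: ler_wiXn2l; rewrite ?invr_ge0 ?ler0n //.
by rewrite invf_le1 ?ltr0n ?prime_gt0 //; have := q2; lra.
Qed.

Let h_gt0 : 0 < q^-1 ^+ n./2.
Proof. by rewrite exprn_gt0 // invr_gt0 ltr0n prime_gt0. Qed.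

Let sgn_norm : `|(if p == 2%N then -1 else 1) * ((-1) ^+ m * q^-1 ^+ n./2) : R| = q^-1 ^+ n./2.
Proof.
rewrite !normrM normrX normrN1 expr1n mul1r (gtr0_norm h_gt0).
by case: ifP; rewrite ?normrN1 ?normr1 mul1r.
Qed.

Let main_max : (1 - 1 / (q ^+ 2 + q + 1)) * K = (q ^+ 2 - 1) / (q ^+ 2 + q + 1) * q ^+ n.
Proof.
by rewrite !exprS; field; apply: lt0r_neq0; have := q2; nra.
Qed.

(** The main term cancels exactly. The parity correction of the total is at most [q^-(n/2)] and the
    term in [eps] at most [(q - 1) q^-(n/2)], with [n/2] rounded down. *)
Let max_error (b : Zp) :
  `|(tot 'F_p q^-1 n + eps b * ((if p == 2%N then -1 else 1) * ((-1) ^+ m * q^-1 ^+ n./2)))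
    - (1 - 1 / (q ^+ 2 + q + 1)) * K| <= q * q^-1 ^+ n./2.
Proof.
rewrite main_max -Fp_card tot_invE !Fp_card addrAC [X in X + _]addrAC subrr add0r.
apply: le_trans (ler_normD _ _) _.
rewrite -[leRHS](_ : q^-1 ^+ n./2 + (q - 1) * q^-1 ^+ n./2 = _); last by ring.
apply: lerD; last by rewrite normrM sgn_norm ler_wpM2r // ltW.
have s_gt0 : 0 < q ^+ 2 + q + 1 by have := q2; nra.
have x0 : 0 < q^-1 by rewrite invr_gt0; have := q2; lra.
rewrite normrM ger0_norm ?exprn_ge0 ?(ltW x0) // -[m.+1./2]uphalfE uphalf_half addnC [odd m.+1]/= exprD.
rewrite (_ : n./2 = m./2.+1) // [in leRHS]exprSr -mulrA ler_pM2l ?exprn_gt0 //.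
case: odd => /=; rewrite ?mulr1 ?expr0 ?expr1.
  rewrite ger0_norm ?divr_ge0; [|have := q2; lra..|exact: ltW].
  by rewrite ler_piMr ?(ltW x0) // ler_pdivrMr // mul1r; have := q2; nra.
have c0 : 0 <= (q ^+ 2 - 1) / (q * (q ^+ 2 + q + 1)).
  by rewrite divr_ge0 ?mulr_ge0 ?ler0n ?(ltW s_gt0) //; have := q2; nra.
rewrite mul1r normrN ger0_norm // ler_pdivrMr ?mulKf //; last first.
  by rewrite mulr_gt0 //; have := q2; lra.
by have := q2; lra.
Qed.

Lemma density_max_bound (b : Zp) :
  `|density b mu (@generates_maximal_order p p_pr) - (1 - 1 / (q ^+ 2 + q + 1))| <=
  5 * (1 / q ^+ (n + n./2 - 1)).
Proof.
rewrite (density_maxE mu_haar); apply: le_trans (ratio_bound (max_error b)) _.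
have -> : (n + n./2 - 1 = m.+1 + n./2)%N by rewrite [(n + _)%N]addSn subn1.
have -> : q * q^-1 ^+ n./2 / K = q / (q - 1) * (1 / q ^+ (m.+1 + n./2)).
  by rewrite exprD exprVn; field; rewrite q1 !expf_neq0.
rewrite ler_wpM2r ?divr_ge0 ?(ltW (pow_gt0 _)) // ler_pdivrMr; by have := q2; lra.
Qed.

(** The error in the numerator is at most [1], whereas its main term exceeds [1]; the smallest case
    [q = n = 2] gives [12 / 7]. *)
Lemma density_max_gt0 (b : Zp) :
  0 < density b mu (@generates_maximal_order p p_pr).
Proof.
rewrite (density_maxE mu_haar) divr_gt0 //.
have := max_error b; set T := _ + _ * _; rewrite ler_distl => /andP[+ _].
apply: lt_le_trans; rewrite subr_gt0 main_max.
have : q * q^-1 ^+ n./2 <= 1.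
  by rewrite mulrC -ler_pdivlMr ?div1r ?inv_half //; have := q2; lra.
move=> /le_lt_trans; apply; rewrite mulrAC ltr_pdivlMr; last by have := q2; nra.
rewrite mul1r !exprS expr0 mulr1.
have c : q * q <= q * (q * q ^+ m).
  by rewrite mulrA ler_peMr ?exprn_ege1 //; have := q2; nra.
have : 3 * (q * q) <= (q * q - 1) * (q * (q * q ^+ m)) by apply: ler_pM; rewrite //; have := q2; nra.
by have := q2; nra.
Qed.

Lemma density_max_eq (b b' : Zp) :
  density b mu (@generates_maximal_order p p_pr) = density b' mu (@generates_maximal_order p p_pr) <->
  (b \is a GRing.unit) = (b' \is a GRing.unit).
Proof.
rewrite !(density_maxE mu_haar); apply: eq_iff_unit.
by rewrite -normr_gt0 sgn_norm.
Qed.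

Let sign_cases : (-1) ^+ m = 1 :> R \/ (-1) ^+ m = -1 :> R.
Proof. by rewrite -signr_odd; case: odd; [right|left]; rewrite ?expr1 ?expr0. Qed.

Section Two.
Hypothesis p2 : p = 2%N.

Let qE : q = 2. Proof. by rewrite p2. Qed.

Let two_num (b : Zp) : tot 'F_p (1 : R) n + eps b * - (-1) ^+ m =
  2 / 3 * K - (1 / 3 + eps b) * (-1) ^+ m.
Proof. by rewrite tot_1E Fp_card qE !exprS; field. Qed.

Lemma density_sqf_bound2 (b : Zp) :
  `|density b mu (@sqf_disc p p_pr) - 2 / 3| <= 5 * (1 / 2 ^+ n).
Proof.
(* [4 / 3] is the larger absolute value of [1 / 3 + eps], attained at [eps = 1]. *)
have bd : `|tot 'F_p (1 : R) n + eps b * - (-1) ^+ m - 2 / 3 * K| <= 4 / 3.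
  rewrite two_num addrAC subrr sub0r normrN normrM normrX normrN1 expr1n mulr1 qE.
  by case: ifP => _; rewrite ler_norml; apply/andP; split; lra.
rewrite (density_sqf2E mu_haar) //; apply: le_trans (ratio_bound bd) _.
rewrite qE (_ : 2 - 1 = 1) ?mulr1; last by ring.
have : 0 < (2 ^+ m.+1)^-1 :> R by rewrite invr_gt0 exprn_gt0.
by rewrite [2 ^+ n]exprS div1r invfM; lra.
Qed.

Lemma density_sqf_gt0_two (b : Zp) : ~ (m = 0 /\ b \isn't a GRing.unit) ->
  0 < density b mu (@sqf_disc p p_pr).
Proof.
rewrite padic_unitE negbK => mb; rewrite (density_sqf2E mu_haar) // divr_gt0 // two_num qE.
have m2 k : 1 <= 2 ^+ k :> R by rewrite exprn_ege1 ?ler1n.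
have [rb|rb] := eqVneq (rd b) 0.
  case: (m) mb (m2 m.-1) sign_cases => [[]|k _ /=]; first by rewrite rb.
  by rewrite !exprS; lra.
by have := m2 m; rewrite exprS; case: sign_cases => ->; lra.
Qed.

(** For [n = 2] and [eps = 1] the main term [(2 / 3) 2] of the numerator equals the correction
    [1 / 3 + 1]. *)
Lemma density_sqf_eq0 (b : Zp) : m = 0 -> b \isn't a GRing.unit ->
  density b mu (@sqf_disc p p_pr) = 0.
Proof.
rewrite padic_unitE negbK => m0 rb; rewrite (density_sqf2E mu_haar) // two_num rb qE m0.
by rewrite expr0 expr1; field.
Qed.

Lemma density_sqf_eq2 (b b' : Zp) :
  density b mu (@sqf_disc p p_pr) = density b' mu (@sqf_disc p p_pr) <->
  (b \is a GRing.unit) = (b' \is a GRing.unit).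
Proof.
rewrite !(density_sqf2E mu_haar) //; apply: eq_iff_unit.
by rewrite oppr_eq0 signr_eq0.
Qed.

End Two.

Section Odd.
Hypothesis p2 : p != 2%N.
Local Notation A := ((q - 1) / (q + 1)).
Local Notation r := ((n %% p)%:R : R).

(** The powers of [q] cancel exactly; what is left is a sign times an expression of size
    [O(q n)]. *)
Let odd_num (b : Zp) :
  tot 'F_p (1 : R) n + (1 - q^-1) * (\sum_c double_card R n (c : 'F_p)) +
  eps b * ((-1) ^+ m * (1 + (1 - q^-1) * (1 - r))) -
  (1 - (3 * q - 1) / (q * (q + 1) ^+ 2)) * K =
  (-1) ^+ m * (- A + (q - 1) * ((1 - q^-1) * (1 + A / (q + 1) - A * m.+1%:R)) +
    eps b * (1 + (1 - q^-1) * (1 - r))).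
Proof.
rewrite tot_1E sum_double_cardE Fp_card !exprS; field.
by rewrite q0 /=; apply: lt0r_neq0; have := q2; lra.
Qed.

Let A_bounds : [/\ 0 <= A, A <= 1, 0 <= A / (q + 1) & A / (q + 1) <= A].
Proof.
have A0 : 0 <= A by apply: divr_ge0; have := q2; lra.
split=> //.
- by rewrite ler_pdivrMr; have := q2; lra.
- by apply: divr_ge0 => //; have := q2; lra.
- by rewrite ler_pdivrMr ?ler_peMr //; have := q2; lra.
Qed.

Let qV_bounds : 0 <= 1 - q^-1 <= 1.
Proof.
have x0 : 0 < q^-1 by rewrite invr_gt0; have := q2; lra.
by have : q^-1 <= 1; [rewrite invf_le1; have := q2; lra|lra].
Qed.

Lemma density_sqf_bound_odd (b : Zp) :
  `|density b mu (@sqf_disc p p_pr) - (1 - (3 * q - 1) / (q * (q + 1) ^+ 2))| <=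
  5 * (n%:R / q ^+ (n - 1)).
Proof.
rewrite (density_sqf_oddE mu_haar) //.
rewrite [leRHS](_ : _ = ((q - 1) * (5 * n%:R)) / K); last first.
  by rewrite subn1 /=; field; rewrite q1 expf_neq0.
apply: ratio_bound; rewrite odd_num normrM normrX normrN1 expr1n mul1r.
have [A0 A1 B0 BA] := A_bounds; have /andP[x0 x1] := qV_bounds.
have r0 : 0 <= r by rewrite ler0n.
have rn : r <= n%:R by rewrite ler_nat leq_mod.
have n0 : 0 <= m%:R :> R by rewrite ler0n.
have nE : n%:R = m%:R + 2 :> R by rewrite -addn2 natrD.
have mE : m.+1%:R = m%:R + 1 :> R by rewrite -addn1 natrD.
rewrite nE mE in rn *.
have X1 : `|(1 - q^-1) * (1 + A / (q + 1) - A * (m%:R + 1))| <= m%:R + 2.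
  rewrite normrM (ger0_norm x0) -[leRHS]mul1r; apply: ler_pM => //.
  by rewrite ler_norml; apply/andP; split; nra.
have Y1 : `|1 + (1 - q^-1) * (1 - r)| <= m%:R + 2.
  by rewrite ler_norml; apply/andP; split; nra.
apply: le_trans (ler_normD _ _) _; rewrite [in X in _ + X]normrM.
apply: le_trans (lerD (ler_normD _ _) (ler_pM (normr_ge0 _) (normr_ge0 _) (eps_le b) Y1)) _.
rewrite normrN (ger0_norm A0) normrM (ger0_norm (_ : 0 <= q - 1)); last by have := q2; lra.
by have := q2; nra.
Qed.

(** Squarefree reductions suffice, as the double roots contribute a nonnegative term. Their total
    exceeds [q - 1], which bounds [eps]; for [q = n = 2] this inequality would be an equality. *)
Lemma density_sqf_gt0_odd (b : Zp) : 0 < density b mu (@sqf_disc p p_pr).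
Proof.
have [A0 A1 B0 BA] := A_bounds; have /andP[x0 x1] := qV_bounds.
have F2 : (2%:R : 'F_p) != 0 by rewrite -(dvdn_pcharf (pchar_Fp p_pr)) dvdn_prime2.
rewrite (density_sqf_odd mu_haar) // divr_gt0 //; last by rewrite mulr_gt0 //; have := q2; lra.
apply: ltr_wpDr; first by rewrite mulr_ge0 // sumr_ge0.
have := @mul_card_of_diff 'F_p R (adm_wt 1 n) ((-1) ^+ m) _ (rd b).
rewrite Fp_card -/(tot 'F_p 1 n) => W; rewrite -(pmulr_rgt0 _ (_ : 0 < q)); last by have := q2; lra.
rewrite W => [|c c0]; last first.
  by rewrite -[LHS]/(diff 1 n c) diffE ?(negPf F2) ?expr1n ?mulr1 ?mul1r // => /eqP; rewrite (negPf F2).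
have T : q - 1 < tot 'F_p 1 n.
  rewrite tot_1E Fp_card mulrAC ltr_pdivlMr; last by have := q2; lra.
  rewrite ltr_pM2l; last by have := q2; lra.
  have : 1 <= q ^+ m by rewrite exprn_ege1 //; have := q2; lra.
  have q3' := q3 p2.
  have : q * q <= q * (q * q ^+ m) by rewrite !ler_pM2l ?ler_peMr ?exprn_ege1 //; lra.
  by rewrite !exprS; case: sign_cases => ->; nra.
have := eps_le b; rewrite ler_norml; move: T; move: (tot _ _ _) (if _ then _ else _) => t e T /andP[e1 e2].
by case: sign_cases => ->; lra.
Qed.

(** With [r = n %% p], a vanishing coefficient of [eps] would mean
    [(p - 1) r = 2 p - 1 = 2 (p - 1) + 1], so [p - 1] would divide [1]. *)
Lemma density_sqf_eq_odd (b b' : Zp) :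
  density b mu (@sqf_disc p p_pr) = density b' mu (@sqf_disc p p_pr) <->
  (b \is a GRing.unit) = (b' \is a GRing.unit).
Proof.
rewrite !(density_sqf_oddE mu_haar) //; apply: eq_iff_unit.
rewrite mulf_neq0 ?signr_eq0 //; apply/eqP => d0.
have : (p.-1 * (n %% p))%:R = (p + p.-1)%:R :> R.
  have pE : p.-1%:R = q - 1 by rewrite -subn1 natrB ?prime_gt0.
  have e : q + (q - 1) * (1 - r) = 0 by rewrite -(mulr0 q) -d0; field.
  by rewrite natrM natrD pE; move: e; lra.
move=> /eqP; rewrite eqr_nat => /eqP.
have : (2 < p)%N by rewrite ltn_neqAle eq_sym p2 prime_gt1.
by move: (n %% p)%N; case: (p) => // k r; clear; case: (leqP r 2) => ?; nia.
Qed.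

End Odd.

End Estimates.

Theorem theorem1p5 (R : realType) :
  exists C : R,
  forall (n : nat) (p : nat) (p_pr : prime p)
    (mu : probability (borel_space p_pr n.-1) R),
  (2 <= n)%N -> is_haar mu ->
  let P_sqf b := density b mu (@sqf_disc p p_pr) in
  let P_max b := density b mu (@generates_maximal_order p p_pr) in
  [/\ forall b : padic_int p_pr,
        if p == 2%N then `|P_sqf b - 2 / 3| <= C * (1 / 2 ^+ n)
        else `|P_sqf b
               - (1 - (3 * p%:R - 1) / (p%:R * (p%:R + 1) ^+ 2))|
             <= C * (n%:R / p%:R ^+ (n - 1)),
      forall b : padic_int p_pr,
        `|P_max b - (1 - 1 / (p%:R ^+ 2 + p%:R + 1))|
          <= C * (1 / p%:R ^+ (n + n./2 - 1)),
      forall b : padic_int p_pr,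
        [/\ ~ [/\ p = 2%N, n = 2%N & b \isn't a GRing.unit] -> 0 < P_sqf b,
            [/\ p = 2%N, n = 2%N & b \isn't a GRing.unit] -> P_sqf b = 0
          & 0 < P_max b]
    & forall b b' : padic_int p_pr,
        (P_sqf b = P_sqf b'
           <-> (b \is a GRing.unit) = (b' \is a GRing.unit)) /\
        (P_max b = P_max b'
           <-> (b \is a GRing.unit) = (b' \is a GRing.unit))].
Proof.
(* A common constant with room to spare: the estimates give [8 / 3] for [p = 2], [3] for odd [p],
   and [q / (q - 1) <= 2] for maximality. *)
exists 5 => -[|[|m]] p p_pr mu // _ mu_haar P_sqf P_max; split=> [b|b|b|b b'].
- case: eqP => [p2|/eqP p2]; first exact: density_sqf_bound2.
  exact: density_sqf_bound_odd.
- exact: density_max_bound.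
- split=> [nb|[p2 [m0] bu]|]; last exact: density_max_gt0.
    have [p2|p2] := eqVneq p 2%N; last exact: density_sqf_gt0_odd.
    apply: density_sqf_gt0_two => // -[m0 bu]; apply: nb; by rewrite m0.
  exact: density_sqf_eq0.
- split; last exact: density_max_eq.
  have [p2|p2] := eqVneq p 2%N; first exact: density_sqf_eq2.
  exact: density_sqf_eq_odd.
Qed.
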